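(* Let $1\le p\le\infty$ and $k\in\mathbb{N}=\{1,2,\dots\}$. For $i=1,2$ let $\Omega_i\subset\mathbb{R}$ be a bounded open interval with fixed base point $x_i\in\Omega_i$, and let $W^{k,p}(\Omega_i)$ be the anchored ordered Sobolev space with base point $x_i$. Let $\Delta:S(W^{k,p}(\Omega_1))^+\to S(W^{k,p}(\Omega_2))^+$ be a surjective isometry, i.e. a surjective map with $\|\Delta(f)-\Delta(g)\|_{k,p}=\|f-g\|_{k,p}$ for all $f,g\in S(W^{k,p}(\Omega_1))^+$. Then there exists a unique complex-linear isometric order isomorphism $\widetilde{\Delta}:W^{k,p}(\Omega_1)\to W^{k,p}(\Omega_2)$ such that $\widetilde{\Delta}|_{S(W^{k,p}(\Omega_1))^+}=\Delta$. More precisely, there exist a unique permutation $\pi$ of $\{0,\ldots,k-1\}$ and a unique complex-linear isometric order isomorphism $\Lambda:L^p(\Omega_1)\to L^p(\Omega_2)$, determined by $\Delta$, such that for all $f\in W^{k,p}(\Omega_1)$ $$(\widetilde{\Delta}f)(x)=\sum_{j=0}^{k-1}f^{(\pi(j))}(x_1)\frac{(x-x_2)^j}{j!}+\frac{1}{(k-1)!}\int_{x_2}^{x}(x-t)^{k-1}\Lambda(f^{(k)})(t)\,dt,\qquad x\in\Omega_2.$$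
   Context: Let $\Omega\subset\mathbb{R}$ be a bounded open interval with Lebesgue measure and $x_0\in\Omega$ a fixed base point. All function spaces are complex. $W^{k,p}_{\mathbb{C}}(\Omega)$ is the complex vector space of $f\in L^p(\Omega)$ having weak derivatives $f^{(j)}\in L^p(\Omega)$ for $j=1,\ldots,k$; $f^{(0)}=f$; for $0\le j\le k-1$, $f^{(j)}$ is identified with its absolutely continuous representative, so $f^{(j)}(x_0)$ is well defined. $W^{k,p}_{\mathbb{R}}(\Omega)$ is the real subspace of real-valued functions. The anchored norm is $\|f\|_{k,p}=\big(\sum_{j=0}^{k-1}|f^{(j)}(x_0)|^p+\|f^{(k)}\|_p^p\big)^{1/p}$ for $1\le p<\infty$ and $\|f\|_{k,\infty}=\max\{\max_{0\le j<k}|f^{(j)}(x_0)|,\ \|f^{(k)}\|_\infty\}$ for $p=\infty$. The positive cone is $W^{k,p}(\Omega)^+=\{f\in W^{k,p}_{\mathbb{R}}(\Omega): f^{(k)}\ge0\text{ a.e.},\ f^{(j)}(x_0)\ge0\ \text{for } j=0,\ldots,k-1\}$, inducing the order $\ge_{k,p}$. $W^{k,p}(\Omega)$ denotes $W^{k,p}_{\mathbb{C}}(\Omega)$ with this norm and order (an ordered Banach space). The positive unit sphere is $S(W^{k,p}(\Omega))^+=\{f\in W^{k,p}(\Omega)^+:\|f\|_{k,p}=1\}$. $L^p(\Omega)$ is the complex $L^p$-space with its usual norm and positive cone $\{u: u\ge0\text{ a.e.}\}$. A complex-linear isometric order isomorphism $\Phi:E\to F$ between ordered Banach spaces with positive cones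 $E^+,F^+$ is a complex-linear surjective isometry with $\Phi(E^+)=F^+$ and $\Phi^{-1}(F^+)=E^+$. *)

(* Defs.v *)
From HB Require Import structures.
From mathcomp Require Import all_boot all_order all_algebra ring_quotient.
From mathcomp Require Import complex.
From mathcomp Require Import all_classical all_reals all_analysis.
From mathcomp Require Import measurable_realfun ess_sup_inf.
From mathcomp Require Import ring.

Set Implicit Arguments.
Unset Strict Implicit.
Unset Printing Implicit Defensive.

Import Order.TTheory GRing.Theory Num.Theory.
Import numFieldNormedType.Exports.
Import ComplexField.Normc.

Local Open Scope classical_set_scope.
Local Open Scope ring_scope.
Local Open Scope complex_scope.
Local Open Scope quotient_scope.

Local Notation Re := complex.Re.
Local Notation Im := complex.Im.

(* R[i] is the field of complex numbers over R.  Its order is the partial one: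
   [0 <= z] means that z is real and nonnegative.  [normc z : R] is the modulus
   of z and [x%:C] the embedding of R. *)

Section ComplexIntegral.
Context d (T : measurableType d) (R : realType).

Definition cintegral (mu : {measure set T -> \bar R}) (D : set T)
    (f : T -> R[i]) : R[i] :=
  (\int[mu]_(x in D) Re (f x)) +i* (\int[mu]_(x in D) Im (f x)).

End ComplexIntegral.

Section ComplexLfun.
Context d (T : measurableType d) (R : realType).
Variables (mu : {measure set T -> \bar R}) (p : \bar R).

(* The measurable f : T -> C with finite p-norm; [Lnorm] covers p = +oo through
   the essential supremum. *)
Definition clfun : {pred T -> R[i]} := fun f =>
  `[< [/\ measurable_fun setT (@Re R \o f), measurable_fun setT (@Im R \o f)
        & ('N[mu]_p[EFin \o (@normc R \o f)] < +oo)%E] >].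

Record clfunType (p1 : (1 <= p)%E) :=
  CLfun { clfun_val :> T -> R[i]; _ : clfun_val \in clfun }.

Lemma le_Lnorm (f g : T -> R) : measurable_fun setT f ->
  measurable_fun setT g -> (0 <= p)%E -> (forall x, `|f x| <= `|g x|) ->
  ('N[mu]_p[EFin \o f] <= 'N[mu]_p[EFin \o g])%E.
Proof.
move=> mf mg p0 fg; rewrite unlock; case: p p0 => [r| |] //=.
- rewrite lee_fin => r0; rewrite gt0_ler_poweR ?invr_ge0//.
  + by rewrite in_itv/= leey integral_ge0// => x _; rewrite lee_fin powR_ge0.
  + by rewrite in_itv/= leey integral_ge0// => x _; rewrite lee_fin powR_ge0.
  + apply: ge0_le_integral => //.
    * apply/measurable_EFinP/(@measurableT_comp _ _ _ _ _ _ (@powR R ^~ r)) => //.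
      exact: measurableT_comp.
    * apply/measurable_EFinP/(@measurableT_comp _ _ _ _ _ _ (@powR R ^~ r)) => //.
      exact: measurableT_comp.
    * by move=> x _; rewrite lee_fin ge0_ler_powR ?nnegrE.
- by move=> _; case: ifPn => // _; apply: le_ess_sup; apply/nearW => x /=;
    rewrite lee_fin.
Qed.

Lemma measurable_normc (f : T -> R[i]) : measurable_fun setT (@Re R \o f) ->
  measurable_fun setT (@Im R \o f) -> measurable_fun setT (@normc R \o f).
Proof.
move=> mr mi.
have -> : @normc R \o f =
    @Num.sqrt R \o (fun x => (Re (f x)) ^+ 2 + (Im (f x)) ^+ 2).
  by apply/funext => x /=; case: (f x).
apply: measurableT_comp.
  by apply: continuous_measurable_fun; exact: sqrt_continuous.
by apply: measurable_funD; exact: measurable_funX.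
Qed.

Lemma normr_Re_le (z : R[i]) : `|Re z| <= normc z.
Proof. by case: z => a b /=; rewrite -sqrtr_sqr ler_wsqrtr// lerDl sqr_ge0. Qed.

Lemma normr_Im_le (z : R[i]) : `|Im z| <= normc z.
Proof. by case: z => a b /=; rewrite -sqrtr_sqr ler_wsqrtr// lerDr sqr_ge0. Qed.

Lemma normc_ge0 (z : R[i]) : 0 <= normc z.
Proof. by case: z => a b /=; rewrite sqrtr_ge0. Qed.

Lemma normc_le_ReIm (z : R[i]) : normc z <= `|Re z| + `|Im z|.
Proof.
case: z => a b /=.
rewrite -[leRHS]ger0_norm ?addr_ge0// -sqrtr_sqr ler_wsqrtr// sqrrD !real_normK ?num_real//.
by rewrite addrAC lerDl mulrn_wge0// mulr_ge0.
Qed.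

Hypothesis p1 : (1 <= p)%E.

Lemma clfunP f : reflect
  (@Re R \o f \in Lfun mu p /\ @Im R \o f \in Lfun mu p) (f \in clfun).
Proof.
have p0 : (0 <= p)%E by exact: le_trans p1.
apply: (iffP idP).
  move=> /asboolP[mr mi fin].
  split; apply/andP; split; rewrite inE//=; apply: le_lt_trans fin;
    apply: le_Lnorm => //; try exact: measurable_normc; move=> x /=.
  - by rewrite [leRHS]ger0_norm ?normc_ge0// normr_Re_le.
  - by rewrite [leRHS]ger0_norm ?normc_ge0// normr_Im_le.
move=> [/andP[]]; rewrite inE/= => mr; rewrite inE/= => fr.
move=> /andP[]; rewrite inE/= => mi; rewrite inE/= => fi.
apply/asboolP; split => //.
have mr' : measurable_fun setT (@Num.norm R _ \o (@Re R \o f)) by exact: measurableT_comp.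
have mi' : measurable_fun setT (@Num.norm R _ \o (@Im R \o f)) by exact: measurableT_comp.
apply: (@le_lt_trans _ _ ('N[mu]_p[EFin \o ((@Num.norm R _ \o (@Re R \o f)) \+ (@Num.norm R _ \o (@Im R \o f)))%R])%E).
  apply: le_Lnorm => //; [exact: measurable_normc | exact: measurable_funD |].
  move=> x /=; rewrite [leLHS]ger0_norm ?normc_ge0// [leRHS]ger0_norm ?addr_ge0//.
  exact: normc_le_ReIm.
apply: (le_lt_trans (eminkowski _ _ _ _)) => //.
by apply: lte_add_pinfty; [move: fr | move: fi]; apply: le_lt_trans;
  apply: le_Lnorm => // x /=; rewrite normr_id.
Qed.

Lemma ReD_fun (f g : T -> R[i]) : @Re R \o (f + g) = (@Re R \o f) + (@Re R \o g).
Proof. by apply/funext => x /=; rewrite !fctE; case: (f x) => ? ?; case: (g x). Qed.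

Lemma ImD_fun (f g : T -> R[i]) : @Im R \o (f + g) = (@Im R \o f) + (@Im R \o g).
Proof. by apply/funext => x /=; rewrite !fctE; case: (f x) => ? ?; case: (g x). Qed.

Lemma ReZ_fun (c : R[i]) (f : T -> R[i]) : @Re R \o (c *: f) =
  Re c *: (@Re R \o f) + (- Im c) *: (@Im R \o f).
Proof.
apply/funext => x /=; rewrite !fctE /=; case: c => a b; case: (f x) => u v.
by rewrite /= -mulNr.
Qed.

Lemma ImZ_fun (c : R[i]) (f : T -> R[i]) : @Im R \o (c *: f) =
  Re c *: (@Im R \o f) + Im c *: (@Re R \o f).
Proof.
by apply/funext => x /=; rewrite !fctE /=; case: c => a b; case: (f x) => u v.
Qed.

Let Lfun_lin (a : R) (f g : T -> R) :
  f \in Lfun mu p -> g \in Lfun mu p -> a *: f + g \in Lfun mu p.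
Proof. exact: (Lfun_submod_closed mu p1).2. Qed.

Let Lfun0 : (0 : T -> R) \in Lfun mu p.
Proof. exact: (Lfun_submod_closed mu p1).1. Qed.

Lemma clfun_submod_closed : submod_closed clfun.
Proof.
split.
  by apply/clfunP; split; rewrite (_ : _ \o _ = 0)//; exact/funext.
move=> c f g /clfunP[fr fi] /clfunP[gr gi]; apply/clfunP.
rewrite ReD_fun ImD_fun ReZ_fun ImZ_fun -!addrA.
by split; do 2![apply: Lfun_lin => //].
Qed.

End ComplexLfun.

Section ComplexLspace.
Context d (T : measurableType d) (R : realType).
Variables (mu : {measure set T -> \bar R}) (p : \bar R) (p1 : (1 <= p)%E).

#[local] HB.instance Definition _ := GRing.isSubmodClosed.Build _ _ (clfun mu p)
  (clfun_submod_closed mu p1).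


HB.instance Definition _ := [isSub for @clfun_val _ _ _ mu p p1].
HB.instance Definition _ := [Choice of clfunType mu p1 by <:].
HB.instance Definition _ := [SubChoice_isSubLmodule of clfunType mu p1 by <:].

Definition ae_zero : {pred clfunType mu p1} :=
  fun f => `[< \forall x \ae mu, f x = 0 >].

Lemma ae_zero_zmod_closed : zmod_closed ae_zero.
Proof.
split; first by apply/asboolP; exact/nearW.
move=> f g /asboolP f0 /asboolP g0; apply/asboolP.
by apply: filterS2 f0 g0 => x fx gx; rewrite -[LHS]/(f x - g x) fx gx subrr.
Qed.

HB.instance Definition _ := GRing.isZmodClosed.Build _ ae_zero
  ae_zero_zmod_closed.

(* The complex L^p(mu): p-integrable functions modulo a.e. equality.  As a
   function, a class denotes a chosen representative, so that only a.e.
   statements and integrals about it are meaningful. *)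
Definition clspace := {ideal_quot ae_zero}.

HB.instance Definition _ := Choice.on clspace.
HB.instance Definition _ := EqQuotient.on clspace.
HB.instance Definition _ := GRing.Zmodule.on clspace.
HB.instance Definition _ := ZmodQuotient.on clspace.

Definition clspace_fun (f : clspace) : T -> R[i] := clfun_val (repr f).
Coercion clspace_fun : clspace >-> Funclass.

Lemma clspace_eqP (f g : clfunType mu p1) :
  \pi_clspace f = \pi_clspace g <-> \forall x \ae mu, f x = g x.
Proof.
have -> : \pi_clspace f = \pi_clspace g <-> f - g \in ae_zero.
  by rewrite Quotient.idealrBE; split => /eqP.
split=> [/asboolP|] H; last apply/asboolP; apply: filterS H => x.
  by rewrite -[LHS]/(f x - g x) => /eqP; rewrite subr_eq0 => /eqP.
by move=> fg; rewrite -[LHS]/(f x - g x) fg subrr.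
Qed.

Lemma clspace_piE (f : clfunType mu p1) : \forall x \ae mu, (\pi_clspace f : clspace) x = f x.
Proof. by apply/clspace_eqP; rewrite reprK. Qed.

Definition clspace_scale (c : R[i]) (f : clspace) : clspace :=
  \pi_clspace (c *: repr f).

Lemma pi_scale c (f : clfunType mu p1) :
  clspace_scale c (\pi_clspace f) = \pi_clspace (c *: f).
Proof.
apply/clspace_eqP; apply: filterS (clspace_piE f) => x fx.
by rewrite -[RHS]/(c * f x) -fx.
Qed.

Lemma clspace_scaleA a b f :
  clspace_scale a (clspace_scale b f) = clspace_scale (a * b) f.
Proof. by rewrite -[f]reprK !pi_scale scalerA reprK. Qed.

Lemma clspace_scale1 : left_id 1 clspace_scale.
Proof. by move=> f; rewrite /clspace_scale scale1r reprK. Qed.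

Lemma clspace_scaleDr : right_distributive clspace_scale +%R.
Proof.
move=> a f g; rewrite -[f]reprK -[g]reprK -(raddfD \pi_clspace) !pi_scale.
by rewrite scalerDr raddfD.
Qed.

Lemma clspace_scaleDl f : {morph clspace_scale^~ f : a b / a + b}.
Proof. by move=> a b; rewrite /clspace_scale scalerDl raddfD. Qed.

HB.instance Definition _ := GRing.Zmodule_isLmodule.Build R[i] clspace
  clspace_scaleA clspace_scale1 clspace_scaleDr clspace_scaleDl.

Lemma clspace_linE c (f g : clspace) :
  \forall x \ae mu, (c *: f + g : clspace) x = c * f x + g x.
Proof.
have -> : c *: f + g = \pi_clspace (c *: repr f + repr g).
  by rewrite raddfD /= reprK.
exact: clspace_piE.
Qed.

Definition clnorm (f : clspace) : R := fine 'N[mu]_p[EFin \o (@normc R \o f)].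

Definition clcone : set clspace := [set f | \forall x \ae mu, 0 <= f x].

End ComplexLspace.

Local Notation "f ^` ( n )" := (derive1n n f) : ring_scope.

Section TestFunctions.
Context (R : realType).

Definition test_function (D : set R) (phi : R -> R) :=
  [/\ forall n x, derivable (phi^`(n)) x 1,
      compact (closure [set x | phi x != 0])
    & closure [set x | phi x != 0] `<=` D].

Lemma test_function_measurable D phi n :
  test_function D phi -> measurable_fun setT (phi^`(n)).
Proof.
move=> [dphi _ _]; apply: continuous_measurable_fun => x.
exact/differentiable_continuous/derivable1_diffP.
Qed.

Lemma test_function_bounded D phi n :
  test_function D phi -> [bounded phi^`(n) x | x in setT].
Proof.
move=> [dphi cK _]; set K := closure _ in cK.
have zero : forall m x, ~ K x -> phi^`(m) x = 0.
  have oK : open (~` K) by rewrite openC; exact: closed_closure.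
  elim=> [|m IH] x Kx.
    rewrite derive1n0; apply: contrapT => /eqP phix; apply: Kx.
    exact: subset_closure.
  rewrite derive1nS derive1E (@near_eq_derive _ _ _ _ (cst 0)) ?derive_cst//.
  by near=> y; apply: IH; near: y; exact: open_nbhs_nbhs.
have : bounded_set (phi^`(n) @` K).
  apply: compact_bounded; apply: continuous_compact => //.
  apply: continuous_subspaceT => x.
  exact/differentiable_continuous/derivable1_diffP.
move=> [M [Mr HM]]; exists (Num.max M 0); split; first exact: num_real.
move=> y; rewrite gt_max => /andP[My y0] x _ /=.
have [Kx|Kx] := pselect (K x); first by apply: (HM y My); exists x.
by rewrite zero// normr0 ltW.
Unshelve. all: by end_near. Qed.

End TestFunctions.

Section Sobolev.
Context (R : realType).
Variables (a b : R).

(* Lebesgue measure on the interval, seen as a measure on the whole line that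
   vanishes outside ]a, b[; hence L^p(]a, b[) is [clspace itv_measure]. *)
Definition itv_measure : set (measurableTypeR R) -> \bar R :=
  mrestr lebesgue_measure (measurable_itv `]a, b[%R).
HB.instance Definition _ := Measure.on itv_measure.

Variables (p : \bar R) (p1 : (1 <= p)%E).

Local Notation Lp := (clspace itv_measure p1).

(* v is a j-th weak derivative of u.  Real test functions are enough, both sides
   being complex-linear in phi. *)
Definition weak_derivative (j : nat) (u v : Lp) :=
  forall phi : R -> R, test_function `]a, b[ phi ->
    cintegral itv_measure setT (fun x => (phi^`(j) x)%:C * u x) =
    (-1) ^+ j * cintegral itv_measure setT (fun x => (phi x)%:C * v x).

Lemma itv_measure_fin : itv_measure setT \is a fin_num.
Proof.
rewrite /itv_measure /= /mrestr setTI lebesgue_measure_itv /=.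
by case: ifPn => // _; rewrite -EFinD.
Qed.

Lemma clspace_integrable (phi : R -> R) (u : Lp) :
  measurable_fun setT phi -> [bounded phi x | x in setT] ->
  itv_measure.-integrable setT (EFin \o (phi \* (@Re R \o u))) /\
  itv_measure.-integrable setT (EFin \o (phi \* (@Im R \o u))).
Proof.
move=> mphi bphi; rewrite /clspace_fun; case: (repr u) => f /= fP.
have [fr fi] := elimT (clfunP _ p1 _) fP.
have int (g : R -> R) : g \in Lfun itv_measure p ->
    itv_measure.-integrable setT (EFin \o (phi \* g)).
  move=> gp; rewrite (_ : _ \o _ = (EFin \o phi) \* (EFin \o g))%E//.
  apply: integrableMr => //; apply/Lfun1_integrable.
  exact: (Lfun_subset _ p1 itv_measure_fin p1 gp).
by split; exact: int.
Qed.

Lemma cintegral_lin (phi : R -> R) c (u v : Lp) :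
  measurable_fun setT phi -> [bounded phi x | x in setT] ->
  cintegral itv_measure setT (fun x => (phi x)%:C * (c *: u + v : Lp) x) =
  c * cintegral itv_measure setT (fun x => (phi x)%:C * u x) +
  cintegral itv_measure setT (fun x => (phi x)%:C * v x).
Proof.
move=> mphi bphi; set w : Lp := c *: u + v.
have wE : \forall x \ae itv_measure, w x = c * u x + v x by exact: clspace_linE.
pose re (z : Lp) := phi \* (@Re R \o z); pose im (z : Lp) := phi \* (@Im R \o z).
have cE (z : Lp) : cintegral itv_measure setT (fun x => (phi x)%:C * z x) =
    (\int[itv_measure]_x re z x) +i* (\int[itv_measure]_x im z x).
  rewrite /cintegral; congr (_ +i* _); apply: eq_Rintegral => x _ /=;
    rewrite /re /im /=; case: (z x) => ? ? /=; first by rewrite mul0r subr0.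
  by rewrite mul0r addr0.
have comb (g f1 f2 f3 : measurableTypeR R -> R) (s t : R) :
    itv_measure.-integrable setT (EFin \o g) ->
    itv_measure.-integrable setT (EFin \o f1) ->
    itv_measure.-integrable setT (EFin \o f2) ->
    itv_measure.-integrable setT (EFin \o f3) ->
    (\forall x \ae itv_measure, g x = s * f1 x + t * f2 x + f3 x) ->
    \int[itv_measure]_x g x = s * (\int[itv_measure]_x f1 x) +
      t * (\int[itv_measure]_x f2 x) + \int[itv_measure]_x f3 x.
  move=> ig i1 i2 i3 gE.
  have is1 : itv_measure.-integrable setT (EFin \o (fun x => s * f1 x)).
    exact: (integrableZl measurableT s i1).
  have it2 : itv_measure.-integrable setT (EFin \o (fun x => t * f2 x)).
    exact: (integrableZl measurableT t i2).
  have i12 : itv_measure.-integrable setT (EFin \o (fun x => s * f1 x + t * f2 x)).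
    exact: (integrableD measurableT is1 it2).
  have i123 : itv_measure.-integrable setT
      (EFin \o (fun x => s * f1 x + t * f2 x + f3 x)).
    exact: (integrableD measurableT i12 i3).
  transitivity (\int[itv_measure]_x (s * f1 x + t * f2 x + f3 x)).
    congr fine; apply: ae_eq_integral => //.
    - exact: measurable_int ig.
    - exact: measurable_int i123.
    - by apply: filterS gE => x gx _ /=; rewrite gx.
  by rewrite RintegralD// RintegralD// !RintegralZl.
have [ru iu] := clspace_integrable u mphi bphi.
have [rv iv] := clspace_integrable v mphi bphi.
have [rw iw] := clspace_integrable w mphi bphi.
rewrite !cE (@comb _ (re u) (im u) (re v) (Re c) (- Im c))//; last first.
  apply: filterS wE => x wx; rewrite /re /im /= wx.
  by case: (c) => ? ?; case: (u x) => ? ?; case: (v x) => ? ? /=; ring.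
rewrite (@comb (im w) (im u) (re u) (im v) (Re c) (Im c))//; last first.
  apply: filterS wE => x wx; rewrite /re /im /= wx.
  by case: (c) => ? ?; case: (u x) => ? ?; case: (v x) => ? ? /=; ring.
by case: (c) => ? ? /=; congr (_ +i* _); rewrite mulNr.
Qed.

Lemma weak_derivative_lin j c (u v u' v' : Lp) :
  weak_derivative j u u' -> weak_derivative j v v' ->
  weak_derivative j (c *: u + v) (c *: u' + v').
Proof.
move=> uu' vv' phi tphi.
rewrite !cintegral_lin ?uu' ?vv'//; first by rewrite mulrDr mulrCA.
- exact: (test_function_measurable 0 tphi).
- exact: (test_function_bounded 0 tphi).
- exact: (test_function_measurable _ tphi).
- exact: (test_function_bounded _ tphi).
Qed.

Lemma weak_derivative0 j : weak_derivative j 0 0.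
Proof.
move=> phi tphi.
have z n : cintegral itv_measure setT (fun x => (phi^`(n) x)%:C * (0 : Lp) x) = 0.
  have := @cintegral_lin (phi^`(n)) (- 1) 0 0
    (test_function_measurable _ tphi) (test_function_bounded _ tphi).
  by rewrite scaler0 addr0 mulN1r addNr.
by rewrite z (z 0%N) mulr0.
Qed.

Definition sobolev_pred (k : nat) : {pred Lp} := fun u =>
  `[< forall j, (1 <= j <= k)%N -> exists v, weak_derivative j u v >].

Lemma sobolev_submod_closed k : submod_closed (sobolev_pred k).
Proof.
split; first by apply/asboolP => j _; exists 0; exact: weak_derivative0.
move=> c u v /asboolP uk /asboolP vk; apply/asboolP => j jk.
have [[u' uu'] [v' vv']] := (uk j jk, vk j jk).
by exists (c *: u' + v'); exact: weak_derivative_lin.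
Qed.

HB.instance Definition _ k := GRing.isSubmodClosed.Build _ _ (sobolev_pred k)
  (sobolev_submod_closed k).

Record sobolev (k : nat) :=
  Sobolev { sobolev_val :> Lp; _ : sobolev_val \in sobolev_pred k }.

HB.instance Definition _ k := [isSub for @sobolev_val k].
HB.instance Definition _ k := [Choice of sobolev k by <:].
HB.instance Definition _ k := [SubChoice_isSubLmodule of sobolev k by <:].

(* The class f^(j): a weak derivative is unique as an element of L^p, and
   f^(0) = f.  The default value 0 is only reached when there is none. *)
Definition weak_deriv (j : nat) (f : Lp) : Lp :=
  if j is 0%N then f else xget 0 [set g | weak_derivative j f g].

Definition abs_continuous (D : set R) (h : R -> R[i]) :=
  forall e : R, 0 < e -> exists2 d : R, 0 < d &
    forall n (l r : 'I_n -> R),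
      (forall i, [/\ l i <= r i, D (l i) & D (r i)]) ->
      trivIset setT (fun i => `]l i, r i[%classic) ->
      \sum_(i < n) (r i - l i) < d ->
      \sum_(i < n) normc (h (r i) - h (l i)) < e.

(* The absolutely continuous representative of u on ]a, b[, when there is one;
   its values outside ]a, b[ are arbitrary. *)
Definition ac_repr (u : Lp) : R -> R[i] :=
  xget (fun=> 0) [set h | abs_continuous `]a, b[ h /\
                          \forall x \ae itv_measure, u x = h x].

Definition deriv_at (j : nat) (f : Lp) (x : R) : R[i] :=
  ac_repr (weak_deriv j f) x.

Variable (k : nat) (x0 : R).

(* The anchored norm with base point x0; p = -oo is excluded by p1. *)
Definition sobolev_norm (f : sobolev k) : R :=
  match p with
  | r%:E => (\sum_(j < k) normc (deriv_at j f x0) `^ r +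
             clnorm (weak_deriv k f) `^ r) `^ r^-1
  | +oo%E => Num.max (\big[Num.max/0]_(j < k) normc (deriv_at j f x0))
                     (clnorm (weak_deriv k f))
  | -oo%E => 0
  end.

Definition sobolev_cone : set (sobolev k) := [set f : sobolev k |
  [/\ \forall x \ae itv_measure, Im (f x) = 0,
      \forall x \ae itv_measure, 0 <= weak_deriv k f x
    & forall j, (j < k)%N -> 0 <= deriv_at j f x0]].

End Sobolev.

Section OrderedNormedSpaces.
Context (R : realType).

(* A complex vector space with the norm and the positive cone that an isometric
   order isomorphism has to preserve.  That these are a complete norm and a
   cone is a property of the instances below, not part of the structure. *)
Structure ordNormed := OrdNormed {
  onv_sort :> lmodType R[i];
  onv_norm : onv_sort -> R;
  onv_cone : set onv_sort }.

Definition Lp_space (a b : R) (p : \bar R) (p1 : (1 <= p)%E) : ordNormed :=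
  @OrdNormed (clspace (itv_measure a b) p1)
    (@clnorm _ _ _ _ _ _) (@clcone _ _ _ _ _ _).

Definition W_space (k : nat) (a b x0 : R) (p : \bar R) (p1 : (1 <= p)%E) :
    ordNormed :=
  @OrdNormed (sobolev a b p1 k)
    (fun f => sobolev_norm x0 f) (@sobolev_cone _ _ _ _ _ _ x0).

Definition positive_sphere (E : ordNormed) : set E :=
  [set f : E | onv_cone f /\ onv_norm f = 1].

Definition isometric_order_iso (E F : ordNormed) (Phi : E -> F) :=
  [/\ linear Phi,
      forall v, exists u, Phi u = v,
      forall u v, onv_norm (Phi u - Phi v) = onv_norm (u - v),
      Phi @` @onv_cone E = @onv_cone F
    & Phi @^-1` @onv_cone F = @onv_cone E].

(* The oriented integral of f from s to x. *)
Definition oint (s x : R) (f : R -> R[i]) : R[i] :=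
  if s <= x then cintegral lebesgue_measure `[s, x] f
  else - cintegral lebesgue_measure `[x, s] f.

End OrderedNormedSpaces.

Arguments positive_sphere {R} E.

(* Main.v *)
Require Import Defs.
From mathcomp Require Import all_boot all_order all_algebra all_fingroup.
From mathcomp Require Import complex.
From mathcomp Require Import all_classical all_reals all_analysis.
From mathcomp Require Import ring_quotient measurable_realfun ess_sup_inf.
From mathcomp Require Import ring lra.

(** Taylor's formula identifies f in W^(k,p) with its anchored derivatives
    f^(j)(x0), j < k, together with its top derivative f^(k), and all such data
    occur ([sobolev_taylor], [sobolev_data_surj]).  In these coordinates the
    anchored norm and cone are the norm and cone of the L^p space of the
    interval to which k atoms of mass one have been added; so W^(k,p) is a
    concrete L^p space over a finite measure ([sobolev_model]).

    Let D be a surjective isometry between the positive unit spheres of two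
    such spaces.  It transports local comparisons: with each measurable set A is
    associated a set B such that [s f <= t g] on A implies [s (D f) <= t (D g)]
    on B.  For finite p the set B is determined by the functions whose images
    vanish on it.  It exists because f and g have disjoint supports exactly when
    the p-th power of their distance is 2, and D preserves the mass of a
    function on matching sets because the distance from f to the functions
    vanishing on A is a strictly increasing function of the mass of f on A
    ([same_support_transport]).  For p = oo the sets are matched through their
    indicators, which have a metric characterization, and upper and lower bounds
    of f on A are expressed by distances from f to indicators
    ([same_indicator_transport]).

    Cutting the space into thin slices on which a f and b g are nearly
    proportional to a f + b g, these comparisons give the additivity of the
    positively homogeneous extension of D ([transport_add]).  It therefore
    extends to a linear map on the whole space.  A positive linear map that
    preserves the norm on the cone is a contraction, because |u| dominates the
    real parts of all z u with |z| = 1; applied to D and to its inverse this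
    makes the extension an isometry ([sphere_isometry_extends]).

    Lastly, the extremal rays of the cone of W^(k,p) are spanned by the Taylor
    monomials: Lebesgue measure being atomless, the top derivative contributes
    none ([extremal_mono]).  An order isomorphism permutes these rays and
    preserves the functions whose anchored derivatives all vanish, so in the
    coordinates above it consists of a permutation and an isometric order
    isomorphism of L^p ([iso_data]).  Taylor's formula turns this into the
    displayed formula, and the uniqueness claims hold because the data of a
    function are determined by its values ([formula_data]). *)

Set Implicit Arguments.
Unset Strict Implicit.
Unset Printing Implicit Defensive.

Import Order.TTheory GRing.Theory Num.Theory.
Import numFieldNormedType.Exports.
Import ComplexField.Normc.

Local Open Scope classical_set_scope.
Local Open Scope ring_scope.
Local Open Scope complex_scope.
Local Open Scope quotient_scope.

Local Notation Re := complex.Re.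
Local Notation Im := complex.Im.

(** * Additivity from local comparisons *)

Section Additivity.
Context d d' (T : measurableType d) (T' : measurableType d') (R : realType).
Variables (mu : {measure set T -> \bar R}) (nu : {measure set T' -> \bar R}).
Variables (X Y : Type) (m : X -> T -> R) (m' : Y -> T' -> R) (D : X -> Y).

(** What a sphere isometry preserves.  The relation [rel] is the graph of an
    unknown transformation of measurable sets behind D; only its effect on
    inclusions, null sets and pointwise comparisons is recorded, which is what
    the cases p finite and p = oo have in common. *)
Record local_transport (rel : set T -> set T' -> Prop) : Prop := {
  transport_meas : forall A B, rel A B -> measurable A /\ measurable B;
  transport_total : forall B, measurable B -> exists A, rel A B;
  transport_onto : forall A, measurable A -> exists B, rel A B;
  transport_sub : forall A B A1 B1, rel A B -> rel A1 B1 ->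
    (\forall x \ae mu, A1 x -> A x) <-> (\forall y \ae nu, B1 y -> B y);
  transport_null : forall A B, rel A B ->
    (\forall x \ae mu, ~ A x) <-> (\forall y \ae nu, ~ B y);
  transport_le : forall A B f g s t, rel A B -> 0 <= s -> 0 <= t ->
    (\forall x \ae mu, A x -> s * m f x <= t * m g x) ->
    \forall y \ae nu, B y -> s * m' (D f) y <= t * m' (D g) y }.

Hypothesis m_meas : forall f, measurable_fun setT (m f).
Hypothesis m'_meas : forall f, measurable_fun setT (m' f).
Hypothesis m_ge0 : forall f x, 0 <= m f x.
Hypothesis m'_ge0 : forall f y, 0 <= m' f y.

Variables (rel : set T -> set T' -> Prop) (relP : local_transport rel).

Lemma mlt_measurable (d0 : measure_display) (S : measurableType d0) (u v : S -> R) :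
  measurable_fun setT u -> measurable_fun setT v ->
  measurable [set x | u x < v x].
Proof.
move=> mu_ mv; rewrite (_ : [set x | _] = (fun x => u x < v x) @^-1` [set true]).
  by rewrite -[X in measurable X]setTI; apply: measurable_fun_ltr.
by apply/seteqP; split => x /=.
Qed.

Lemma mle_measurable (d0 : measure_display) (S : measurableType d0) (u v : S -> R) :
  measurable_fun setT u -> measurable_fun setT v ->
  measurable [set x | u x <= v x].
Proof.
move=> mu_ mv; rewrite (_ : [set x | _] = (fun x => u x <= v x) @^-1` [set true]).
  by rewrite -[X in measurable X]setTI; apply: measurable_fun_ler.
by apply/seteqP; split => x /=.
Qed.

(** Since [a f <= l h], the slices where a f lies between i / n and (i + 1) / n
    of l h, for i <= n, cover the space up to a null set. *)
Lemma slice_null (f h : X) (a l : R) (n : nat) A :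
  measurable A -> 0 <= a -> 0 <= l -> (0 < n)%N ->
  (\forall x \ae mu, a * m f x <= l * m h x) ->
  (forall i, (i <= n)%N -> forall A1, measurable A1 -> A1 `<=` A ->
     (forall x, A1 x -> i%:R * l * m h x <= n%:R * a * m f x /\
                       n%:R * a * m f x <= i.+1%:R * l * m h x) ->
     \forall x \ae mu, ~ A1 x) ->
  \forall x \ae mu, ~ A x.
Proof.
move=> mA a0 l0 n0 fh H.
pose S i := A `&` ([set x | i%:R * l * m h x <= n%:R * a * m f x] `&`
   [set x | n%:R * a * m f x <= i.+1%:R * l * m h x]).
have mS i : measurable (S i).
  apply: measurableI => //.
  by apply: measurableI; apply: mle_measurable; exact: measurable_funM.
have SN : \forall x \ae mu, forall i, (i <= n)%N -> ~ S i x.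
  apply: ae_foralln => i; case: (leqP i n) => [ile|]; last by move=> ?; apply: nearW.
  have : \forall x \ae mu, ~ S i x by apply: (H i) => // x [? [? ?]].
  by apply: filterS.
apply: filterS2 fh SN => x fhx Sx Ax.
have n0r : (0 : R) < n%:R by rewrite ltr0n.
have f0 := mulr_ge0 a0 (m_ge0 f x); have h0 := mulr_ge0 l0 (m_ge0 h x).
have [lh0|lhN0] := eqVneq (l * m h x) 0.
  have af0 : a * m f x = 0 by apply/eqP; rewrite eq_le f0 andbT -lh0.
  by apply: (Sx 0%N) => //; rewrite /S /= -!mulrA af0 lh0 !mulr0 lexx.
have lhp : 0 < l * m h x by rewrite lt_neqAle eq_sym lhN0.
pose q := n%:R * (a * m f x) / (l * m h x).
have q0 : 0 <= q by rewrite /q divr_ge0// mulr_ge0.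
have qn : q <= n%:R by rewrite /q ler_pdivrMr// ler_wpM2l// ltW.
have /andP[q1 q2] := truncn_itv q0.
apply: (Sx (Num.truncn q)).
  by rewrite -(ler_nat R) (le_trans q1).
rewrite /S /= -!mulrA; split => //; split.
  by rewrite -ler_pdivlMr.
by rewrite -ler_pdivrMr// ltW.
Qed.

(** On a slice where a f lies between i / n and (i + 1) / n of l h, the function
    b g lies between (n - i - 1) / n and (n - i) / n of it.  Each of these four
    inequalities is transported, so a (D f) + b (D g) and l (D h) agree up to
    a relative error 1 / n, and n is arbitrary. *)
Lemma transport_add (f g h : X) (a b l : R) : 0 <= a -> 0 <= b -> 0 <= l ->
  (\forall x \ae mu, l * m h x = a * m f x + b * m g x) ->
  \forall y \ae nu, l * m' (D h) y = a * m' (D f) y + b * m' (D g) y.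
Proof.
move=> a0 b0 l0 E.
have fh : \forall x \ae mu, a * m f x <= l * m h x.
  by apply: filterS E => x ->; rewrite lerDl mulr_ge0.
have nl0 n : 0 <= n%:R * l by rewrite mulr_ge0.
have na0 n : 0 <= n%:R * a by rewrite mulr_ge0.
have nb0 n : 0 <= n%:R * b by rewrite mulr_ge0.
(* the two upper bounds add up to (n + 1) / n *)
have U n : (0 < n)%N -> \forall y \ae nu,
    n%:R * (a * m' (D f) y + b * m' (D g) y) <= n.+1%:R * (l * m' (D h) y).
  move=> n0.
  pose B := [set y | n.+1%:R * (l * m' (D h) y) <
                     n%:R * (a * m' (D f) y + b * m' (D g) y)].
  have mB : measurable B.
    apply: mlt_measurable; apply: measurable_funM => //.
      exact: measurable_funM.
    by apply: measurable_funD; exact: measurable_funM.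
  suff : \forall y \ae nu, ~ B y by apply: filterS => y; rewrite /B /= => /negP; rewrite -leNgt.
  have [A AB] := transport_total relP mB.
  have [mA _] := transport_meas relP AB.
  apply/(transport_null relP AB).
  apply: (@slice_null f h a l n A) => // i ile A1 mA1 A1A HA1.
  have [B1 AB1] := transport_onto relP mA1.
  apply/(transport_null relP AB1).
  have B1B : \forall y \ae nu, B1 y -> B y.
    by apply/(transport_sub relP AB AB1); apply: nearW => x; apply: A1A.
  have H1 : \forall y \ae nu, B1 y -> n%:R * a * m' (D f) y <= i.+1%:R * l * m' (D h) y.
    apply: (transport_le relP AB1) => //.
    by apply: nearW => x /HA1[].
  have H2 : \forall y \ae nu, B1 y -> n%:R * b * m' (D g) y <= (n - i)%:R * l * m' (D h) y.
    apply: (transport_le relP AB1) => //.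
    apply: filterS E => x Ex /HA1[] + _.
    by rewrite natrB// -!mulrA Ex; lra.
  apply: filterS3 B1B H1 H2 => y h1 h2 h3 By.
  have := h1 By; rewrite /B/=; have := h2 By; have := h3 By.
  rewrite natrB// -!mulrA -!natr1; lra.
(* the two lower bounds add up to (n - 1) / n; on the last slice, i = n, the
   first one suffices *)
have Low n : (0 < n)%N -> \forall y \ae nu,
    n.-1%:R * (l * m' (D h) y) <= n%:R * (a * m' (D f) y + b * m' (D g) y).
  move=> n0.
  pose B := [set y | n%:R * (a * m' (D f) y + b * m' (D g) y) <
                     n.-1%:R * (l * m' (D h) y)].
  have mB : measurable B.
    apply: mlt_measurable; apply: measurable_funM => //.
      by apply: measurable_funD; exact: measurable_funM.
    exact: measurable_funM.
  suff : \forall y \ae nu, ~ B y by apply: filterS => y; rewrite /B /= => /negP; rewrite -leNgt.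
  have [A AB] := transport_total relP mB.
  have [mA _] := transport_meas relP AB.
  apply/(transport_null relP AB).
  apply: (@slice_null f h a l n A) => // i ile A1 mA1 A1A HA1.
  have [B1 AB1] := transport_onto relP mA1.
  apply/(transport_null relP AB1).
  have B1B : \forall y \ae nu, B1 y -> B y.
    by apply/(transport_sub relP AB AB1); apply: nearW => x; apply: A1A.
  have H1 : \forall y \ae nu, B1 y -> i%:R * l * m' (D h) y <= n%:R * a * m' (D f) y.
    apply: (transport_le relP AB1) => //.
    by apply: nearW => x /HA1[].
  have H2 : \forall y \ae nu, B1 y -> (n.-1 - i)%:R * l * m' (D h) y <= n%:R * b * m' (D g) y.
    apply: (transport_le relP AB1) => //.
    apply: filterS E => x Ex /HA1[] _.
    rewrite -!mulrA; have hx := mulr_ge0 b0 (m_ge0 g x).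
    have := mulr_ge0 (ler0n R n) hx.
    have [ilt|nle] := ltnP i n.
      by rewrite -subn1 -subnDA add1n natrB// Ex -natr1; lra.
    by rewrite (_ : n.-1 - i = 0)%N ?mul0r//; apply/eqP; rewrite subn_eq0 (leq_trans (leq_pred n)).
  apply: filterS3 B1B H1 H2 => y h1 h2 h3 By.
  have hx := mulr_ge0 l0 (m'_ge0 (D h) y).
  have gx := mulr_ge0 b0 (m'_ge0 (D g) y).
  have n1E : n.-1%:R = n%:R - 1 :> R by rewrite -subn1 natrB.
  have := h1 By; rewrite /B/=; have := h2 By; rewrite -!mulrA n1E.
  have [ilt|nle] := ltnP i n.
    have := h3 By; rewrite -subn1 -subnDA add1n natrB// -natr1 -!mulrA; lra.
  have -> : i = n by apply/eqP; rewrite eqn_leq ile.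
  have := mulr_ge0 (ler0n R n) gx.
  lra.
have UU := @ae_foralln _ _ _ nu _ (fun n => U n.+1 isT).
have LL := @ae_foralln _ _ _ nu _ (fun n => Low n.+1 isT).
apply: filterS2 UU LL => y Uy Ly.
set s := a * _ + _ in Uy Ly *; set t := l * _ in Uy Ly *.
have t0 : 0 <= t by rewrite mulr_ge0.
have key (e : R) : e <= 0 \/ exists n, t < e * n.+1%:R.
  have [e0|e0] := leP e 0; first by left.
  right; exists (Num.truncn (t / e)).
  by rewrite mulrC -ltr_pdivrMr// truncnS_gt.
apply/eqP; rewrite eq_le; apply/andP; split; rewrite -subr_le0.
- have [//|[n]] := key (t - s).
  have := Ly n; rewrite -!natr1 /=; have := ler0n R n.
  nra.
- have [//|[n]] := key (s - t).
  have := Uy n; rewrite -!natr1 /=; have := ler0n R n.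
  nra.
Qed.

End Additivity.

(** * The positive unit sphere of L^p for finite p *)

Section PowerIntegral.
Context d (T : measurableType d) (R : realType).
Variables (mu : {measure set T -> \bar R}) (r : R).
Hypothesis r1 : 1 <= r.

(** The r-th power of the L^r norm of u on A: the mass of u on A, which, unlike
    the norm, is additive in A. *)
Definition pint (A : set T) (u : T -> R) : \bar R :=
  (\int[mu]_(x in A) (`|u x| `^ r)%:E)%E.

Let r0 : 0 < r. Proof. exact: lt_le_trans r1. Qed.

Lemma pint_meas D (u : T -> R) : measurable_fun setT u ->
  measurable_fun D (fun x => (`|u x| `^ r)%:E : \bar R).
Proof.
move=> mu_; apply: (@measurable_funS _ _ _ _ setT) => //.
apply/measurable_EFinP/(@measurableT_comp _ _ _ _ _ _ (@powR R ^~ r)) => //.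
exact: measurableT_comp.
Qed.

Lemma pint_ge0 A u : (0 <= pint A u)%E.
Proof. by apply: integral_ge0 => x _; rewrite lee_fin powR_ge0. Qed.

Lemma pint_ae A (u v : T -> R) : measurable A -> measurable_fun setT u ->
  measurable_fun setT v -> (\forall x \ae mu, A x -> u x = v x) ->
  pint A u = pint A v.
Proof.
move=> mA mu_ mv uv; apply: ge0_ae_eq_integral => //.
- exact: pint_meas.
- exact: pint_meas.
by apply: filterS uv => x uv Ax; rewrite uv.
Qed.

Lemma pint_le A (u v : T -> R) : measurable A -> measurable_fun setT u ->
  measurable_fun setT v -> (\forall x \ae mu, A x -> `|u x| <= `|v x|) ->
  (pint A u <= pint A v)%E.
Proof.
move=> mA mu_ mv uv; apply: ae_ge0_le_integral => //.
- exact: pint_meas.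
- exact: pint_meas.
apply: filterS uv => x uv Ax; rewrite lee_fin ge0_ler_powR ?nnegrE ?(ltW r0)//.
exact: uv.
Qed.

Lemma pint0 A (u : T -> R) : measurable A -> measurable_fun setT u ->
  (\forall x \ae mu, A x -> u x = 0) -> pint A u = 0.
Proof.
move=> mA mu_ u0; rewrite (@pint_ae _ _ (cst 0))//.
rewrite /pint; under eq_integral do rewrite /= normr0 powR0 ?gt_eqF//.
exact: integral0.
Qed.

Lemma pint_eq0 A (u : T -> R) : measurable A -> measurable_fun setT u -> pint A u = 0 ->
  \forall x \ae mu, A x -> u x = 0.
Proof.
move=> mA mu_ I0.
have : (\int[mu]_(x in A) `|(`|u x| `^ r)%:E| = 0)%E.
  by rewrite -[RHS]I0; apply: eq_integral => x _; rewrite gee0_abs// lee_fin powR_ge0.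
move/ae_eq_integral_abs => /(_ mA (pint_meas mu_)).
apply: filterS => x ux Ax; have [/powR_eq0_eq0/normr0_eq0] := ux Ax; exact.
Qed.

Lemma pint_setC A (u : T -> R) : measurable A -> measurable_fun setT u ->
  pint setT u = (pint A u + pint (~` A) u)%E.
Proof.
move=> mA mu_; rewrite /pint -(setUv A) ge0_integral_setU//.
- exact: measurableC.
- exact: pint_meas.
- by apply/disj_setPS; rewrite setICr.
Qed.

Lemma pintZ A (c : R) (u : T -> R) : 0 <= c -> measurable A -> measurable_fun setT u ->
  pint A (fun x => c * u x) = ((c `^ r)%:E * pint A u)%E.
Proof.
move=> c0 mA mu_; rewrite /pint -ge0_integralZl//.
- apply: eq_integral => x _; rewrite normrM powRM// EFinM.
  by rewrite (ger0_norm c0).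
- exact: pint_meas.
- by rewrite lee_fin powR_ge0.
Qed.

Lemma pint_indic A (u : T -> R) : measurable A ->
  pint setT (fun x => \1_A x * u x) = pint A u.
Proof.
move=> mA; rewrite /pint [RHS]integral_mkcond; apply: eq_integral => x _.
rewrite patchE indicE; case: (x \in A) => /=; first by rewrite mul1r.
by rewrite mul0r normr0 powR0// gt_eqF.
Qed.

Lemma pint_gt_null A (u v : T -> R) : measurable A -> measurable_fun setT u ->
  measurable_fun setT v -> (forall x, A x -> 0 <= v x < u x) ->
  (pint A u <= pint A v)%E -> (pint A v < +oo)%E -> \forall x \ae mu, ~ A x.
Proof.
move=> mA mu_ mv vu uv vfin.
pose w x := (`|u x| `^ r - `|v x| `^ r).
have wp x : A x -> 0 < w x.
  move=> Ax; have /andP[v0 vux] := vu _ Ax.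
  rewrite /w subr_gt0 gt0_ltr_powR ?nnegrE// !ger0_norm//.
  exact: le_trans (ltW vux).
have mw : measurable_fun A (EFin \o w).
  apply/measurable_EFinP/measurable_funB; exact/measurable_EFinP/pint_meas.
have E : (\int[mu]_(x in A) (EFin \o w) x + pint A v = pint A u)%E.
  rewrite /pint -ge0_integralD//.
  - by apply: eq_integral => x _; rewrite /= -EFinD subrK.
  - by move=> x Ax; rewrite /= lee_fin ltW// wp.
  - exact: pint_meas.
have I0 : (\int[mu]_(x in A) (EFin \o w) x = 0)%E.
  apply/eqP; rewrite eq_le integral_ge0 ?andbT; last first.
    by move=> x Ax; rewrite /= lee_fin ltW// wp.
  move: uv; rewrite -E.
  move: vfin (pint_ge0 A v); case: (pint A v) => [s| |]// _ _.
  by rewrite -[leRHS]add0e leeD2rE.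
have : (\int[mu]_(x in A) `|(EFin \o w) x| = 0)%E.
  rewrite -[RHS]I0; apply: eq_integral => x; rewrite inE => Ax.
  by rewrite gee0_abs//= lee_fin ltW// wp.
move/ae_eq_integral_abs => /(_ mA mw).
apply: filterS => x ux Ax; have [w0] := ux Ax.
by have := wp _ Ax; rewrite w0 ltxx.
Qed.

Lemma one_powR (x : R) : 1 `^ x = 1.
Proof. by rewrite powR1. Qed.

(** For f of norm 1 with mass a on A, this is the r-th power of the distance
    from f to the functions of the sphere that vanish on A: the mass a is lost,
    and the rest of f, of norm (1 - a)^(1/r), is rescaled to norm 1. *)
Definition gap (a : R) := a + (1 - (1 - a) `^ r^-1) `^ r.

Lemma gap_lt a b : 0 <= a -> a < b -> b <= 1 -> gap a < gap b.
Proof.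
move=> a0 ab b1.
suff : (1 - (1 - a) `^ r^-1) `^ r <= (1 - (1 - b) `^ r^-1) `^ r.
  by move=> H; exact: (ltr_leD ab H).
have le1 c : 0 <= c <= 1 -> (1 - c) `^ r^-1 <= 1.
  move=> /andP[c0 c1]; rewrite -[leRHS](one_powR r^-1).
  by apply: ge0_ler_powR; rewrite ?nnegrE ?invr_ge0 ?subr_ge0 ?ler01 ?(ltW r0)// lerBlDr lerDl.
apply: ge0_ler_powR; rewrite ?nnegrE ?subr_ge0 ?(ltW r0)//.
- by apply: le1; rewrite a0 (le_trans (ltW ab)).
- by apply: le1; rewrite b1 (le_trans a0 (ltW ab)).
rewrite lerD2l lerN2; apply: ge0_ler_powR.
- by rewrite invr_ge0 ltW.
- by rewrite nnegrE subr_ge0.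
- by rewrite nnegrE subr_ge0 (le_trans (ltW ab)).
- by rewrite lerD2l lerN2 ltW.
Qed.

Lemma powR_root (a : R) : 0 <= a -> (a `^ r^-1) `^ r = a.
Proof. by move=> a0; rewrite -powRrM mulVf ?gt_eqF// powRr1. Qed.

Lemma pint_minkowski (u v : T -> R) (a b c : R) : measurable_fun setT u ->
  measurable_fun setT v ->
  pint setT u = a%:E -> pint setT v = b%:E -> pint setT (u \- v) = c%:E ->
  a `^ r^-1 <= b `^ r^-1 + c `^ r^-1.
Proof.
move=> mu_ mv ua vb uvc.
have NE (w : T -> R) (s : R) : pint setT w = s%:E ->
    ('N[mu]_r%:E[EFin \o w] = (s `^ r^-1)%:E)%E.
  by move=> ws; rewrite unlock /= -poweR_EFin -ws.
have := @minkowski_EFin _ _ _ mu v (u \- v) r mv (measurable_funB mu_ mv) r1.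
rewrite (NE _ _ vb) (NE _ _ uvc) (NE (v \+ (u \- v)) a); last first.
  by rewrite -ua; congr pint; apply/funext => x /=; rewrite addrC subrK.
by rewrite -EFinD lee_fin.
Qed.

End PowerIntegral.

Section Sphere.
Context d (T : measurableType d) (R : realType).
Variables (mu : {measure set T -> \bar R}) (r : R).
Hypothesis r1 : 1 <= r.
Hypothesis mufin : (mu setT < +oo)%E.
Variables (X : Type) (m : X -> T -> R).

(** The elements of a sphere are kept abstract; [m] reads them as nonnegative
    functions of norm 1 and reaches each of these up to a null set. *)
Record psphere : Prop := {
  psphere_meas : forall f, measurable_fun setT (m f);
  psphere_ge0 : forall f x, 0 <= m f x;
  psphere_norm : forall f, pint mu r setT (m f) = 1%E;
  psphere_onto : forall u : T -> R, measurable_fun setT u -> (forall x, 0 <= u x) ->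
    pint mu r setT u = 1%E -> exists f, \forall x \ae mu, m f x = u x }.

Hypothesis S : psphere.
Let r0 : 0 < r. Proof. exact: lt_le_trans r1. Qed.
Let mm f : measurable_fun setT (m f). Proof. exact: psphere_meas. Qed.
Let m0 f x : 0 <= m f x. Proof. exact: psphere_ge0. Qed.
Hint Resolve mm m0 : core.

Lemma psphere_le1 A f : measurable A -> (pint mu r A (m f) <= 1)%E.
Proof.
move=> mA; rewrite -(psphere_norm S f); apply: ge0_subset_integral => //.
  exact: pint_meas.
Qed.

Lemma psphere_fin A f : measurable A -> pint mu r A (m f) \is a fin_num.
Proof.
move=> mA; rewrite ge0_fin_numE ?pint_ge0//.
by rewrite (le_lt_trans (psphere_le1 f mA))// ltry.
Qed.

Lemma psphere_normalize (u : T -> R) (s : R) : measurable_fun setT u -> (forall x, 0 <= u x) ->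
  pint mu r setT u = s%:E -> 0 < s ->
  exists f, \forall x \ae mu, m f x = (s `^ r^-1)^-1 * u x.
Proof.
move=> mu_ u0 us s0.
have c0 : 0 < (s `^ r^-1)^-1 by rewrite invr_gt0 powR_gt0.
apply: (psphere_onto S).
- exact: measurable_funM.
- by move=> x; rewrite mulr_ge0// ltW.
rewrite pintZ// ?ltW// us -EFinM -powR_inv1 ?powR_ge0// -!powRrM.
have -> : r^-1 * (-1 * r) = -1 by rewrite mulN1r mulrN mulVf// gt_eqF.
by rewrite powR_inv1 ?(ltW s0)// mulVf// gt_eqF.
Qed.

Lemma psphere_indic A : measurable A -> ~ (\forall x \ae mu, ~ A x) ->
  exists f c, 0 < c /\ \forall x \ae mu, m f x = c * \1_A x.
Proof.
move=> mA An.
have Afin : mu A \is a fin_num.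
  by rewrite ge0_fin_numE// (le_lt_trans _ mufin)// le_measure ?inE.
have A0 : 0 < fine (mu A).
  rewrite fine_gt0// -ge0_fin_numE// Afin andbT lt0e measure_ge0 andbT.
  apply/negP => /eqP A0; apply: An; exists A; split => // x /=.
  by move/contrapT.
have [|||//|f fE] := @psphere_normalize (\1_A) (fine (mu A)).
- exact: measurable_indic.
- by [].
  rewrite fineK// /pint -[RHS]mul1e -integral_cst// integral_mkcond.
  rewrite [RHS]integral_mkcond; apply: eq_integral => x _.
  rewrite !patchE in_setT indicE; case: (x \in A) => /=.
    by rewrite normr1 powR1.
  by rewrite normr0 powR0// gt_eqF.
by exists f, (fine (mu A) `^ r^-1)^-1; split => //; rewrite invr_gt0 powR_gt0.
Qed.

(** For u, v >= 0 one has |u - v|^r + min(u, v)^r <= u^r + v^r, so distance 2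
    leaves no mass for min(f, g).  Disjointness of supports thereby becomes
    a metric notion. *)
Lemma psphere_disjoint f g :
  pint mu r setT (m f \- m g) = 2%:E <-> \forall x \ae mu, m f x = 0 \/ m g x = 0.
Proof.
have fg2 : (pint mu r setT (m f) + pint mu r setT (m g) = 2%:E)%E.
  by rewrite !(psphere_norm S) -EFinD.
split=> [E|E].
  pose w x := Num.min (m f x) (m g x).
  have mw : measurable_fun setT w by exact: measurable_minr.
  have : pint mu r setT w = 0.
    apply/eqP; rewrite eq_le pint_ge0 andbT.
    have : (pint mu r setT (m f \- m g)%R + pint mu r setT w <= 2%:E)%E.
      have mfg := @pint_meas _ _ _ r setT _ (measurable_funB (mm f) (mm g)).
      have [mf mg] := (@pint_meas _ _ _ r setT _ (mm f), @pint_meas _ _ _ r setT _ (mm g)).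
      have mw' := @pint_meas _ _ _ r setT _ mw.
      have -> : (2%:E = \int[mu]_x ((`|m f x| `^ r)%:E + (`|m g x| `^ r)%:E))%E.
        by rewrite -fg2 ge0_integralD.
      have -> : (pint mu r setT (m f \- m g)%R + pint mu r setT w =
          \int[mu]_x ((`|(m f \- m g)%R x| `^ r)%:E + (`|w x| `^ r)%:E))%E.
        by rewrite ge0_integralD.
      apply: ge0_le_integral => //.
      - by move=> x _; rewrite adde_ge0// lee_fin powR_ge0.
      - exact: emeasurable_funD.
      - exact: emeasurable_funD.
      move=> x _; rewrite -!EFinD lee_fin /w /=.
      have f0 := m0 f x; have g0 := m0 g x.
      rewrite (ger0_norm f0) (ger0_norm g0).
      have [fg|gf] := leP (m f x) (m g x).
        rewrite (ger0_norm f0) addrC lerD2l ge0_ler_powR ?nnegrE ?(ltW r0)//.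
        by rewrite distrC ger0_norm ?subr_ge0// lerBlDr lerDl.
      rewrite (ger0_norm g0) lerD2r ge0_ler_powR ?nnegrE ?(ltW r0)//.
      by rewrite ger0_norm ?subr_ge0 ?(ltW gf)// lerBlDr lerDl.
    by rewrite E -[leRHS]adde0 leeD2lE.
  move/(pint_eq0 measurableT mw); apply: filterS => x /(_ I).
  by rewrite /w; case: leP => _ ->; [left|right].
rewrite -fg2 /pint -ge0_integralD//.
- apply: ge0_ae_eq_integral => //.
  + exact/pint_meas/measurable_funB.
  + by apply: emeasurable_funD; exact: pint_meas.
  + by move=> x _; rewrite adde_ge0// lee_fin powR_ge0.
  apply: filterS E => x [|] /= -> _.
    by rewrite sub0r normrN normr0 powR0 ?gt_eqF// -EFinD add0r.
  by rewrite subr0 normr0 powR0 ?gt_eqF// -EFinD addr0.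
- exact: pint_meas.
- exact: pint_meas.
Qed.

Lemma psphere_dist_split A f g : measurable A ->
  (\forall x \ae mu, A x -> m g x = 0) ->
  pint mu r setT (m f \- m g) =
   (pint mu r A (m f) + pint mu r (~` A) (m f \- m g)%R)%E.
Proof.
move=> mA g0; rewrite (pint_setC mu r mA); last exact: measurable_funB.
suff -> : pint mu r A (m f \- m g) = pint mu r A (m f) by [].
apply: pint_ae; [exact: mA|exact: measurable_funB|exact: mm|].
by apply: filterS g0 => x g0 Ax /=; rewrite g0// subr0.
Qed.

(** Off A, Minkowski's inequality separates f, of norm (1 - a)^(1/r), from g,
    of norm 1. *)
Lemma psphere_gap_le A f g a : measurable A -> pint mu r A (m f) = a%:E ->
  (\forall x \ae mu, A x -> m g x = 0) ->
  ((gap r a)%:E <= pint mu r setT (m f \- m g)%R)%E.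
Proof.
move=> mA fa g0; rewrite (psphere_dist_split _ mA)// fa /gap EFinD leeD2l//.
have mCA := measurableC mA.
have I (u : T -> R) : measurable_fun setT u -> measurable_fun setT (fun x => \1_(~` A) x * u x).
  by move=> ?; apply: measurable_funM => //; exact: measurable_indic.
case E : (pint mu r (~` A) (m f \- m g)) => [c| |]; [|by rewrite leey|]; last first.
  by have := pint_ge0 mu r (~` A) (m f \- m g); rewrite E.
have c0 : 0 <= c by rewrite -lee_fin -E pint_ge0.
have fC : pint mu r (~` A) (m f) = (1 - a)%:E.
  have := psphere_norm S f; rewrite (pint_setC mu r mA)// fa.
  case: (pint _ _ _ _) => [s| |]//; rewrite -EFinD => -[<-].
  by rewrite addrAC subrr add0r.
have gC : pint mu r (~` A) (m g) = 1%:E.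
  have := psphere_norm S g; rewrite (pint_setC mu r mA)// (pint0 _ _ _ g0)//.
  by rewrite add0e.
have := @pint_minkowski _ _ _ mu r r1 (fun x => \1_(~` A) x * m g x)
   (fun x => \1_(~` A) x * m f x) 1 (1 - a) c (I _ (mm g)) (I _ (mm f)).
rewrite !pint_indic// => /(_ gC fC).
rewrite (_ : _ \- _ = (fun x => \1_(~` A) x * (m g \- m f) x)); last first.
  by apply/funext => x /=; rewrite mulrBr.
rewrite pint_indic// => H.
have {}H : 1 `^ r^-1 <= (1 - a) `^ r^-1 + c `^ r^-1.
  apply: H; rewrite -E; apply: eq_integral => x _ /=; by rewrite distrC.
rewrite lee_fin -[leRHS](powR_root r1 c0) ge0_ler_powR ?nnegrE ?powR_ge0 ?(ltW r0)//.
  have a1 : a <= 1 by rewrite -lee_fin -fa psphere_le1.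
  have a0 : 0 <= a by rewrite -lee_fin -fa pint_ge0.
  rewrite subr_ge0 -[leRHS](one_powR r^-1) ge0_ler_powR ?nnegrE ?invr_ge0 ?(ltW r0)//; lra.
by move: H; rewrite powR1; lra.
Qed.

(** The minimum is reached at the normalized restriction of f to the complement
    of A, which is nonzero because a < 1. *)
Lemma psphere_gap_attained A f a : measurable A -> pint mu r A (m f) = a%:E ->
  a < 1 -> exists2 g, (\forall x \ae mu, A x -> m g x = 0) &
    pint mu r setT (m f \- m g) = (gap r a)%:E.
Proof.
move=> mA fa a1.
have mCA := measurableC mA.
have a0 : 0 <= a by rewrite -lee_fin -fa pint_ge0.
have fC : pint mu r (~` A) (m f) = (1 - a)%:E.
  have := psphere_norm S f; rewrite (pint_setC mu r mA)// fa.
  case: (pint _ _ _ _) => [s| |]//; rewrite -EFinD => -[<-].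
  by rewrite addrAC subrr add0r.
have a1' : 0 < 1 - a by rewrite subr_gt0.
have [|||//|g gE] := @psphere_normalize (fun x => \1_(~` A) x * m f x) (1 - a).
- by apply: measurable_funM => //; exact: measurable_indic.
- by move=> x; rewrite mulr_ge0.
- by rewrite pint_indic.
have g0 : \forall x \ae mu, A x -> m g x = 0.
  apply: filterS gE => x -> Ax.
  by rewrite indicE memNset ?mul0r ?mulr0//; apply.
exists g => //; rewrite (psphere_dist_split _ mA)// fa /gap EFinD; congr (_ + _)%E.
set q := (1 - a) `^ r^-1.
have q1 : q <= 1.
  rewrite -[leRHS](one_powR r^-1) ge0_ler_powR ?nnegrE ?invr_ge0 ?(ltW r0)//; lra.
have q0 : 0 < q by rewrite powR_gt0.
have iq1 : 1 <= q^-1 by rewrite invf_ge1.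
have -> : pint mu r (~` A) (m f \- m g) =
    pint mu r (~` A) (fun x => (q^-1 - 1) * - m f x).
  apply: pint_ae => //; first exact: measurable_funB.
    by apply: measurable_funM => //; exact: measurableT_comp.
  by apply: filterS gE => x /= -> Ax; rewrite -/q indicE mem_set// mul1r; ring.
rewrite pintZ ?subr_ge0//; last exact: measurableT_comp.
rewrite (_ : pint _ _ _ _ = pint mu r (~` A) (m f)); last first.
  by apply: eq_integral => x _; rewrite normrN.
rewrite fC -EFinM -[X in _ * X](powR_root r1 (ltW a1')) -/q.
rewrite -powRM ?subr_ge0 ?(ltW q0)// mulrBl mul1r mulVf//.
by rewrite gt_eqF.
Qed.

End Sphere.

(** * Matching sets by supports *)

Section SupportTransport.
Context (R : realType) (r : R) (r1 : 1 <= r).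

(** The image of a set is read off from the functions that vanish on it, since
    vanishing somewhere can be tested by distances ([psphere_disjoint]). *)
Definition same_support d d' (T : measurableType d) (T' : measurableType d')
  (mu : {measure set T -> \bar R}) (nu : {measure set T' -> \bar R})
  (X Y : Type) (m : X -> T -> R) (m' : Y -> T' -> R) (D : X -> Y)
  (A : set T) (B : set T') :=
  [/\ measurable A, measurable B & forall f,
    (\forall x \ae mu, A x -> m f x = 0) <->
    (\forall y \ae nu, B y -> m' (D f) y = 0)].

Section OneSide.
Context d d' (T : measurableType d) (T' : measurableType d').
Variables (mu : {measure set T -> \bar R}) (nu : {measure set T' -> \bar R}).
Hypothesis mufin : (mu setT < +oo)%E.
Variables (X Y : Type) (m : X -> T -> R) (m' : Y -> T' -> R) (D : X -> Y) (D' : Y -> X).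
Hypotheses (S : psphere mu r m) (S' : psphere nu r m').
Hypotheses (DK : cancel D D') (D'K : cancel D' D).
Hypothesis iso : forall f g, pint nu r setT (m' (D f) \- m' (D g)) =
  pint mu r setT (m f \- m g).
Local Notation rel := (same_support mu nu m m' D).

(** Vanishing on A is being disjoint from the normalized indicator e of A, so
    the support of D e corresponds to A. *)
Lemma same_support_onto A : measurable A -> exists B, rel A B.
Proof.
move=> mA; have [A0|An] := pselect (\forall x \ae mu, ~ A x).
  exists set0; split => // f; split=> _; first exact: nearW.
  by apply: filterS A0.
have [e [c [c0 ec]]] := psphere_indic r1 mufin S mA An.
pose B := [set y | 0 < m' (D e) y].
exists B; split => //.
  by apply: mlt_measurable => //; exact: psphere_meas S' _.
move=> f; split=> [f0|f0].
  have : pint mu r setT (m f \- m e) = 2%:E.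
    apply/(psphere_disjoint r1 S); apply: filterS2 ec f0 => x ex fx.
    have [Ax|nAx] := pselect (A x); [by left; exact: fx|right].
    by rewrite ex indicE memNset// mulr0.
  rewrite -iso => /(psphere_disjoint r1 S'); apply: filterS => y + By.
  by case=> // y0; move: By; rewrite /B /= y0 ltxx.
have : pint nu r setT (m' (D f) \- m' (D e)) = 2%:E.
  apply/(psphere_disjoint r1 S'); apply: filterS f0 => y fy.
  have [/eqP ->|e0] := boolP (m' (D e) y == 0); [by right|left].
  by apply: fy; rewrite /B /= lt_neqAle eq_sym e0 (psphere_ge0 S').
rewrite iso => /(psphere_disjoint r1 S); apply: filterS2 ec => x ex [//|].
rewrite ex indicE => + Ax; rewrite mem_set// mulr1 => c00.
by rewrite c00 ltxx in c0.
Qed.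

(** If D increased the mass, D f would by monotonicity of [gap] be farther from
    all functions vanishing on B than f is from some function vanishing on A. *)
Lemma same_support_mass_le A B f : rel A B ->
  (pint nu r B (m' (D f)) <= pint mu r A (m f))%E.
Proof.
move=> [mA mB AB].
have [fa fb] := (psphere_fin S f mA, psphere_fin S' (D f) mB).
set a := fine (pint mu r A (m f)); set b := fine (pint nu r B (m' (D f))).
have aE : pint mu r A (m f) = a%:E by rewrite fineK.
have bE : pint nu r B (m' (D f)) = b%:E by rewrite fineK.
rewrite aE bE lee_fin leNgt; apply/negP => ab.
have b1 : b <= 1 by rewrite -lee_fin -bE (psphere_le1 S').
have a0 : 0 <= a by rewrite -lee_fin -aE pint_ge0.
have [g g0 gE] := psphere_gap_attained r1 S mA aE (lt_le_trans ab b1).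
have := psphere_gap_le r1 S' mB bE ((AB g).1 g0).
by rewrite iso gE lee_fin leNgt (gap_lt r1 a0 ab b1).
Qed.

End OneSide.

Section TwoSides.
Context d d' (T : measurableType d) (T' : measurableType d').
Variables (mu : {measure set T -> \bar R}) (nu : {measure set T' -> \bar R}).
Hypotheses (mufin : (mu setT < +oo)%E) (nufin : (nu setT < +oo)%E).
Variables (X Y : Type) (m : X -> T -> R) (m' : Y -> T' -> R) (D : X -> Y) (D' : Y -> X).
Hypotheses (S : psphere mu r m) (S' : psphere nu r m').
Hypotheses (DK : cancel D D') (D'K : cancel D' D).
Hypothesis iso : forall f g, pint nu r setT (m' (D f) \- m' (D g)) =
  pint mu r setT (m f \- m g).
Local Notation rel := (same_support mu nu m m' D).

Let iso' f g : pint mu r setT (m (D' f) \- m (D' g)) =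
  pint nu r setT (m' f \- m' g).
Proof. by rewrite -iso !D'K. Qed.

Let rel_sym A B : rel A B <-> same_support nu mu m' m D' B A.
Proof.
split=> -[mA mB AB]; split => // f; first by rewrite AB D'K.
by rewrite AB DK.
Qed.

Let mass A B f : rel A B -> pint nu r B (m' (D f)) = pint mu r A (m f).
Proof.
move=> AB; apply/eqP; rewrite eq_le (same_support_mass_le S S' iso)//=.
rewrite -{1}(DK f); apply: (same_support_mass_le S' S iso').
exact/rel_sym.
Qed.

Let sub_half d1 d2 (T1 : measurableType d1) (T2 : measurableType d2)
  (mu1 : {measure set T1 -> \bar R}) (nu1 : {measure set T2 -> \bar R})
  (X1 Y1 : Type) (m1 : X1 -> T1 -> R) (m1' : Y1 -> T2 -> R) (D1 : X1 -> Y1)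
  A B A1 B1 : (mu1 setT < +oo)%E -> psphere mu1 r m1 ->
  same_support mu1 nu1 m1 m1' D1 A B ->
  same_support mu1 nu1 m1 m1' D1 A1 B1 ->
  (\forall y \ae nu1, B1 y -> B y) -> \forall x \ae mu1, A1 x -> A x.
Proof.
move=> mu1fin S1 [mA mB AB] [mA1 mB1 AB1] BB.
suff : \forall x \ae mu1, ~ (A1 `\` A) x.
  by apply: filterS => x H A1x; apply: contrapT => nAx; apply: H.
apply: contrapT => An.
have [e [c [c0 ec]]] := psphere_indic r1 mu1fin S1 (measurableD mA1 mA) An.
have e0 : \forall x \ae mu1, A x -> m1 e x = 0.
  by apply: filterS ec => x -> Ax; rewrite indicE memNset ?mulr0// => -[].
have : \forall x \ae mu1, A1 x -> m1 e x = 0.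
  apply/AB1; move/AB: e0; apply: filterS2 BB => y h1 h2 By; exact/h2/h1.
move=> e1; apply: An; apply: filterS2 ec e1 => x -> + [A1x nAx] => /(_ A1x).
by rewrite indicE mem_set// mulr1 => c00; rewrite c00 ltxx in c0.
Qed.

(** For the comparison, let B1 be the part of B where t (D g) < s (D f), and A1
    a matching part of A.  Masses are preserved and s f <= t g on A1, so the
    strict inequality on B1 forces B1 to be null. *)
Lemma same_support_transport : local_transport mu nu m m' D rel.
Proof.
have sub A B A1 B1 : rel A B -> rel A1 B1 ->
    (\forall x \ae mu, A1 x -> A x) <-> (\forall y \ae nu, B1 y -> B y).
  move=> AB AB1; split; last exact: (sub_half mufin S AB AB1).
  exact: (sub_half nufin S' ((rel_sym _ _).1 AB) ((rel_sym _ _).1 AB1)).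
have r00 : rel set0 set0 by split => // f; split => _; exact: nearW.
have onto A : measurable A -> exists B, rel A B.
  exact: (same_support_onto mufin S S' iso).
have total B : measurable B -> exists A, rel A B.
  move=> mB; have [A AB] := same_support_onto nufin S' S iso' mB.
  by exists A; apply/rel_sym.
split => //.
- by move=> A B [].
- move=> A B AB; have := sub _ _ _ _ r00 AB.
  by rewrite /set0.
move=> A B f g s t AB s0 t0 fg.
have [mA mB _] := AB.
have mm := psphere_meas S; have mm' := psphere_meas S'.
pose B1 := B `&` [set y | t * m' (D g) y < s * m' (D f) y].
have mB1 : measurable B1.
  by apply: measurableI => //; apply: mlt_measurable; exact: measurable_funM.
suff : \forall y \ae nu, ~ B1 y.
  apply: filterS => y nB By; rewrite leNgt; apply/negP => H; exact: nB.
have [A1 AB1] := total _ mB1.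
have [mA1 _ _] := AB1.
have A1A : \forall x \ae mu, A1 x -> A x.
  by apply/(sub _ _ _ _ AB AB1); apply: nearW => y [].
have m0 h y : 0 <= t * m' h y by rewrite mulr_ge0// (psphere_ge0 S').
apply: (@pint_gt_null _ _ _ nu r r1 B1 (fun y => s * m' (D f) y) (fun y => t * m' (D g) y)) => //.
- exact: measurable_funM.
- exact: measurable_funM.
- by move=> y [By H]; rewrite m0.
- rewrite !pintZ// !(mass _ AB1) -!pintZ//.
  apply: pint_le => //.
  + exact: measurable_funM.
  + exact: measurable_funM.
  apply: filterS2 A1A fg => x h1 h2 A1x.
  by rewrite !ger0_norm ?mulr_ge0 ?(psphere_ge0 S)//; apply: h2; exact: h1.
- rewrite pintZ// ltey_eq fin_numM//.
  by rewrite (psphere_fin S').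
Qed.

End TwoSides.
End SupportTransport.

(** * The positive unit sphere for p = oo *)

Section SupSphere.
Context d (T : measurableType d) (R : realType).
Variables (mu : {measure set T -> \bar R}).
Variables (X : Type) (m : X -> T -> R).

(** The analogue of [psphere] for p = oo, the essential supremum being 1. *)
Record isphere : Prop := {
  isphere_meas : forall f, measurable_fun setT (m f);
  isphere_ge0 : forall f x, 0 <= m f x;
  isphere_le1 : forall f, \forall x \ae mu, m f x <= 1;
  isphere_sup : forall f c, c < 1 -> ~ (\forall x \ae mu, m f x <= c);
  isphere_onto : forall u : T -> R, measurable_fun setT u -> (forall x, 0 <= u x) ->
    (\forall x \ae mu, u x <= 1) ->
    (forall c, c < 1 -> ~ (\forall x \ae mu, u x <= c)) ->
    exists f, \forall x \ae mu, m f x = u x }.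

Definition sup_dist (c : R) (f g : X) := \forall x \ae mu, `|m f x - m g x| <= c.

(** Distance less than 1, the largest distance in the sphere. *)
Definition close (f g : X) := exists2 c : R, c < 1 & sup_dist c f g.

Definition is_ind (A : set T) (f : X) := \forall x \ae mu, m f x = \1_A x.

Hypothesis S : isphere.
Let mm f : measurable_fun setT (m f). Proof. exact: isphere_meas. Qed.
Let m0 f x : 0 <= m f x. Proof. exact: isphere_ge0. Qed.

Lemma ind1 (A : set T) x : A x -> \1_A x = 1 :> R.
Proof. by move=> Ax; rewrite indicE mem_set. Qed.

Lemma ind0 (A : set T) x : ~ A x -> \1_A x = 0 :> R.
Proof. by move=> Ax; rewrite indicE memNset. Qed.

Lemma isphere_indic A : measurable A -> ~ (\forall x \ae mu, ~ A x) ->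
  exists f, is_ind A f.
Proof.
move=> mA An; apply: (isphere_onto S).
- exact: measurable_indic.
- by [].
- by apply: nearW => x; rewrite indicE; case: (_ \in _).
move=> c c1 H; apply: An; apply: filterS H => x + Ax.
by rewrite ind1// leNgt c1.
Qed.

(** Supplies the comparison functions for [ind_rigid] and [meet_ind]. *)
Lemma isphere_three D E : measurable D -> measurable E ->
  ~ (\forall x \ae mu, ~ E x) -> D `&` E = set0 ->
  exists g, \forall x \ae mu, [/\ E x -> m g x = 1, D x -> m g x = 0 &
    ~ D x -> ~ E x -> m g x = 2^-1].
Proof.
move=> mD mE En DE.
pose u x : R := 2^-1 + 2^-1 * \1_E x - 2^-1 * \1_D x.
have uE x : E x -> u x = 1.
  move=> Ex; rewrite /u ind1// ind0; first by lra.
  by move=> Dx; have : (D `&` E) x by []; rewrite DE.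
have uD x : D x -> u x = 0.
  move=> Dx; rewrite /u [\1_D x]ind1// ind0; first by lra.
  by move=> Ex; have : (D `&` E) x by []; rewrite DE.
have u2 x : ~ D x -> ~ E x -> u x = 2^-1.
  by move=> nD nE; rewrite /u !ind0//; lra.
have u01 x : 0 <= u x <= 1.
  have [Ex|nE] := pselect (E x); first by rewrite uE// ler01 lexx.
  have [Dx|nD] := pselect (D x); first by rewrite uD// ler01 lexx.
  by rewrite u2//; apply/andP; split; lra.
have [||||g gE] := isphere_onto S (u := u).
- apply: measurable_funB; first apply: measurable_funD => //.
    by apply: measurable_funM => //; exact: measurable_indic.
  by apply: measurable_funM => //; exact: measurable_indic.
- by move=> x; have /andP[] := u01 x.
- by apply: nearW => x; have /andP[] := u01 x.
- move=> c c1 H; apply: En; apply: filterS H => x + Ex.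
  by rewrite uE// leNgt c1.
by exists g; apply: filterS gE => x ->; split; [exact: uE|exact: uD|exact: u2].
Qed.

Lemma small_sequence : exists ee : nat -> R, (forall n, 0 < ee n <= 2^-1) /\
  forall e : R, 0 < e -> exists n, ee n < e.
Proof.
exists (fun n => n.+2%:R^-1); split=> [n|e e0].
  by rewrite invr_gt0 ltr0n/= lef_pV2 ?posrE// ler_nat.
exists (Num.truncn e^-1); rewrite invf_plt ?posrE//.
by rewrite (lt_trans (truncnS_gt _))// ltr_nat.
Qed.

(** The indicator f of A is the only h such that everything close to h is close
    to f.  If h > 0 on a nonnull set D outside A, the function equal to 1 on D
    and to 1/2 elsewhere is close to h but not to f; if h < 1 on a nonnull
    part D of A, take 0 on D, 1 on the rest of {h > 1/2} and 1/2 elsewhere. *)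
Lemma ind_rigid A f h : measurable A -> is_ind A f ->
  (forall g, close h g -> close f g) -> \forall x \ae mu, m h x = m f x.
Proof.
move=> mA fA H.
have [ee [eps key]] := small_sequence.
have h1 := isphere_le1 S h.
have out n : \forall x \ae mu, ~ (~` A `&` [set x | ee n < m h x]) x.
  set D := _ `&` _.
  have mD : measurable D.
    by apply: measurableI; [exact: measurableC|exact: mlt_measurable].
  have /andP[e0 e2] := eps n.
  apply: contrapT => Dn.
  have [g gE] := isphere_three measurable0 mD Dn (set0I _).
  have [] := H g.
    exists (1 - ee n); first lra.
    apply: filterS2 h1 gE => x hx [g1 _ g2].
    have hx0 := m0 h x.
    have [Dx|nDx] := pselect (D x).
      by rewrite g1//; case: Dx => _ /= Dx; rewrite ler_norml; apply/andP; split; lra.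
    by rewrite g2//; rewrite ler_norml; apply/andP; split; lra.
  move=> c c1 fg; apply: Dn; apply: filterS3 fA gE fg => x fx [g1 _ _] + Dx.
  by rewrite g1// fx ind0; [rewrite sub0r normrN normr1 leNgt c1|case: Dx].
have inn n : \forall x \ae mu, ~ (A `&` [set x | m h x < 1 - ee n]) x.
  set D := _ `&` _.
  have mD : measurable D.
    by apply: measurableI => //; exact: mlt_measurable.
  have /andP[e0 e2] := eps n.
  apply: contrapT => Dn.
  pose E := [set x | 2^-1 < m h x] `\` D.
  have mE : measurable E by apply: measurableD => //; exact: mlt_measurable.
  have En : ~ (\forall x \ae mu, ~ E x).
    move=> H0; apply: (@isphere_sup S h (1 - ee n)); first lra.
    apply: filterS H0 => x nE; rewrite leNgt; apply/negP => hx.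
    apply: nE; split; first by rewrite /=; lra.
    by case=> _ /=; lra.
  have [|g gE] := isphere_three mD mE En.
    by apply/seteqP; split => // x [Dx [_]].
  have [] := H g.
    exists (1 - ee n); first lra.
    apply: filterS2 h1 gE => x hx [g1 g0 g2].
    have hx0 := m0 h x.
    have [Ex|nEx] := pselect (E x).
      by rewrite g1//; case: Ex => /= Ex _; rewrite ler_norml; apply/andP; split; lra.
    have [Dx|nDx] := pselect (D x).
      by rewrite g0//; case: Dx => _ /= Dx; rewrite ler_norml; apply/andP; split; lra.
    by rewrite g2//; rewrite ler_norml; apply/andP; split; lra.
  move=> c c1 fg; apply: Dn; apply: filterS3 fA gE fg => x fx [_ g0 _] + Dx.
  by rewrite g0// fx ind1; [rewrite subr0 normr1 leNgt c1|case: Dx].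
have out' := ae_foralln out; have inn' := ae_foralln inn.
have hh : \forall x \ae mu, m h x <= 1 /\ m f x = \1_A x by apply: filterS2 h1 fA.
apply: filterS3 out' inn' hh => x ox ix [hx ->].
have [Ax|nAx] := pselect (A x).
  rewrite ind1//; apply/eqP; rewrite eq_le hx /= leNgt; apply/negP => hx1.
  have [|n ne] := key (1 - m h x); first by lra.
  by apply: (ix n); split => //=; lra.
rewrite ind0//; apply/eqP; rewrite eq_le m0 andbT leNgt; apply/negP => hx1.
by have [n ne] := key _ hx1; apply: (ox n).
Qed.

(** Conversely, if e < f < 1 - e on a nonnull set, lowering f on that set gives
    another h such that everything close to h is close to f. *)
Lemma rigid_ind f :
  (forall h, (forall g, close h g -> close f g) -> \forall x \ae mu, m h x = m f x) ->
  is_ind [set x | m f x = 1] f.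
Proof.
move=> H.
have [ee [eps key]] := small_sequence.
have f1 := isphere_le1 S f.
have mid n : \forall x \ae mu,
    ~ ([set x | ee n < m f x] `&` [set x | m f x < 1 - ee n]) x.
  set D := _ `&` _; set e := ee n.
  have mD : measurable D by apply: measurableI; exact: mlt_measurable.
  have /andP[e0 e2] := eps n; rewrite -/e in e0 e2.
  pose u x := m f x - \1_D x * ((m f x - e) / 2).
  have uD x : D x -> u x = (m f x + e) / 2 by move=> Dx; rewrite /u ind1//; lra.
  have unD x : ~ D x -> u x = m f x by move=> Dx; rewrite /u ind0//; lra.
  have uf x : 0 <= u x <= m f x.
    have [Dx|nDx] := pselect (D x).
      by rewrite uD//; case: Dx => /=; rewrite -/e => *; apply/andP; split; lra.
    by rewrite unD// m0 lexx.
  have [||||h hE] := isphere_onto S (u := u).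
  - apply: measurable_funB => //; apply: measurable_funM.
      exact: measurable_indic.
    by apply: measurable_funM => //; exact: measurable_funB.
  - by move=> x; have /andP[] := uf x.
  - by apply: filterS f1 => x fx; have /andP[_ ux] := uf x; exact: le_trans fx.
  - move=> c c1 uc; apply: (@isphere_sup S f (Num.max c (1 - e))).
      by rewrite gt_max c1/=; lra.
    apply: filterS uc => x uc; rewrite le_max.
    have [Dx|nDx] := pselect (D x).
      by case: Dx => /= _ Dx; apply/orP; right; rewrite ltW.
    by rewrite -unD// uc.
  have fh : \forall x \ae mu, m h x = m f x.
    apply: H => g [c c1 hg]; exists (Num.max c (1 - e)).
      by rewrite gt_max c1/=; lra.
    have g1 := isphere_le1 S g.
    apply: filterS3 hE hg g1 => x -> ug gx; rewrite le_max.
    have g0 := m0 g x.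
    have [Dx|nDx] := pselect (D x).
      apply/orP; right; case: Dx => /=; rewrite -/e => d1 d2.
      by rewrite ler_norml; apply/andP; split; lra.
    by rewrite -unD// ug.
  apply: filterS2 hE fh => x -> + Dx; rewrite uD//.
  case: Dx => /=; rewrite -/e => d1 d2; lra.
have mid' := ae_foralln mid.
apply: filterS2 f1 mid' => x fx mx.
have [f1x|f1x] := eqVneq (m f x) 1; first by rewrite f1x ind1.
rewrite ind0; last by move=> /= fE; rewrite fE eqxx in f1x.
apply/eqP; rewrite eq_le m0 andbT leNgt; apply/negP => f0x.
have fx1 : m f x < 1 by rewrite lt_neqAle f1x.
have [n] : exists n, ee n < Num.min (m f x) (1 - m f x).
  by apply: key; rewrite lt_min f0x subr_gt0.
rewrite lt_min => /andP[n1 n2]; apply: (mx n); split => //=; lra.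
Qed.

(** If the intersection is null, a function within 1/2 of both indicators is at
    most 1/2 almost everywhere, whereas its norm is 1. *)
Lemma ind_meet A C f g : is_ind A f -> is_ind C g ->
  (exists h, sup_dist 2^-1 h f /\ sup_dist 2^-1 h g) ->
  ~ (\forall x \ae mu, ~ (A `&` C) x).
Proof.
move=> fA gC [h [hf hg]] AC; apply: (@isphere_sup S h 2^-1); first lra.
have fg : \forall x \ae mu, m f x = \1_A x /\ m g x = \1_C x by apply: filterS2 fA gC.
have hh : \forall x \ae mu, `|m h x - m f x| <= 2^-1 /\ `|m h x - m g x| <= 2^-1.
  by apply: filterS2 hf hg.
apply: filterS3 AC fg hh => x nAC [-> ->] [h1 h2].
have [Ax|nAx] := pselect (A x); last first.
  by move: h1; rewrite ind0// subr0 ger0_norm.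
by move: h2; rewrite ind0 ?subr0 ?ger0_norm// => Cx; apply: nAC.
Qed.

(** The witness is 1 on the intersection and 1/2 elsewhere. *)
Lemma meet_ind A C f g : measurable A -> measurable C -> is_ind A f -> is_ind C g ->
  ~ (\forall x \ae mu, ~ (A `&` C) x) ->
  exists h, sup_dist 2^-1 h f /\ sup_dist 2^-1 h g.
Proof.
move=> mA mC fA gC AC.
have [h hE] := isphere_three measurable0 (measurableI _ _ mA mC) AC (set0I _).
exists h; split.
  apply: filterS2 fA hE => x -> [h1 _ h2].
  have [ACx|nACx] := pselect ((A `&` C) x).
    by rewrite h1// ind1 ?subrr ?normr0 ?invr_ge0//; case: ACx.
  rewrite h2// indicE; case: (x \in A) => /=; rewrite ler_norml; apply/andP; split; lra.
apply: filterS2 gC hE => x -> [h1 _ h2].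
have [ACx|nACx] := pselect ((A `&` C) x).
  by rewrite h1// ind1 ?subrr ?normr0 ?invr_ge0//; case: ACx.
rewrite h2// indicE; case: (x \in C) => /=; rewrite ler_norml; apply/andP; split; lra.
Qed.

(** For C take the part of {f > 1/2} outside A, which is nonnull because f has
    norm 1 and f <= c < 1 on A. *)
Lemma upper_level A f c : measurable A -> 2^-1 <= c < 1 ->
  (\forall x \ae mu, A x -> m f x <= c) <->
  exists C g, [/\ measurable C, is_ind C g, \forall x \ae mu, ~ (C `&` A) x & sup_dist c f g].
Proof.
move=> mA /andP[c2 c1]; split=> [fA|[C [g [mC gC CA fg]]]]; last first.
  apply: filterS3 gC CA fg => x -> nCA + Ax.
  by rewrite ind0 ?subr0 ?ger0_norm// => Cx; apply: nCA.
pose C := [set x | 2^-1 < m f x] `\` A.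
have mC : measurable C by apply: measurableD => //; exact: mlt_measurable.
have [|g gC] := isphere_indic mC.
  move=> C0; apply: (isphere_sup S c1); apply: filterS2 fA C0 => x fA nC.
  have [Ax|nAx] := pselect (A x); first exact: fA.
  rewrite leNgt; apply/negP => fx; apply: nC; split => //=; exact: le_lt_trans fx.
exists C, g; split => //; first by apply: nearW => x [[_ nA] Ax]; exact: nA.
apply: filterS3 (isphere_le1 S f) fA gC => x f1 fA ->.
have f0 := m0 f x.
have [Cx|nCx] := pselect (C x).
  by rewrite ind1//; case: Cx => /= *; rewrite ler_norml; apply/andP; split; lra.
rewrite ind0// subr0 ger0_norm//.
have [Ax|nAx] := pselect (A x); first exact: fA.
by rewrite leNgt; apply/negP => fx; apply: nCx; split => //=; exact: le_lt_trans fx.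
Qed.

(** For C take the union of {f > 1/2} and A: then f is at least c on C and at most
    1/2 <= 1 - c off C. *)
Lemma lower_level A f c : measurable A -> ~ (\forall x \ae mu, ~ A x) -> 0 <= c <= 2^-1 ->
  (\forall x \ae mu, A x -> c <= m f x) <->
  exists C g, [/\ measurable C, is_ind C g, \forall x \ae mu, A x -> C x & sup_dist (1 - c) f g].
Proof.
move=> mA An /andP[c0 c2]; split=> [fA|[C [g [mC gC CA fg]]]]; last first.
  apply: filterS3 gC CA fg => x -> AC + Ax.
  by rewrite ind1 ?ler_norml; [move=> /andP[]; lra|exact: AC].
pose C := [set x | 2^-1 < m f x] `|` A.
have mC : measurable C by apply: measurableU => //; exact: mlt_measurable.
have [|g gC] := isphere_indic mC.
  by move=> C0; apply: An; apply: filterS C0 => x nC Ax; apply: nC; right.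
exists C, g; split => //; first by apply: nearW => x; right.
apply: filterS3 (isphere_le1 S f) fA gC => x f1 fA ->.
have f0 := m0 f x.
have [Cx|nCx] := pselect (C x).
  rewrite ind1// ler_norml; case: Cx => [/= fx|/fA fx]; apply/andP; split; lra.
rewrite ind0// subr0 ger0_norm//.
rewrite leNgt; apply/negP => fx; apply: nCx; left => /=; lra.
Qed.

End SupSphere.

(** * Matching sets by indicators *)

Section IndicatorTransport.
Context (R : realType).

(** Null sets have no indicator in the sphere and are matched separately. *)
Definition same_indicator d d' (T : measurableType d) (T' : measurableType d')
  (mu : {measure set T -> \bar R}) (nu : {measure set T' -> \bar R})
  (X Y : Type) (m : X -> T -> R) (m' : Y -> T' -> R) (D : X -> Y)
  (A : set T) (B : set T') :=
  [/\ measurable A, measurable B &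
    ((\forall x \ae mu, ~ A x) /\ (\forall y \ae nu, ~ B y)) \/
    [/\ ~ (\forall x \ae mu, ~ A x), ~ (\forall y \ae nu, ~ B y) &
    exists f, is_ind mu m A f /\ is_ind nu m' B (D f)]].

Section OneSide.
Context d d' (T : measurableType d) (T' : measurableType d').
Variables (mu : {measure set T -> \bar R}) (nu : {measure set T' -> \bar R}).
Variables (X Y : Type) (m : X -> T -> R) (m' : Y -> T' -> R) (D : X -> Y) (D' : Y -> X).
Hypotheses (S : isphere mu m) (S' : isphere nu m').
Hypotheses (DK : cancel D D') (D'K : cancel D' D).
Hypothesis iso : forall c f g, sup_dist nu m' c (D f) (D g) <-> sup_dist mu m c f g.
Local Notation rel := (same_indicator mu nu m m' D).

Let mm f : measurable_fun setT (m f). Proof. exact: isphere_meas S f. Qed.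
Let m0 f x : 0 <= m f x. Proof. exact: isphere_ge0 S f x. Qed.
Let mm' f : measurable_fun setT (m' f). Proof. exact: isphere_meas S' f. Qed.
Let m0' f x : 0 <= m' f x. Proof. exact: isphere_ge0 S' f x. Qed.

Lemma close_iso f g : close nu m' (D f) (D g) <-> close mu m f g.
Proof. by split=> -[c c1 H]; exists c => //; apply/iso. Qed.

Lemma sup_dist0 f g : (\forall x \ae mu, m g x = m f x) <-> sup_dist mu m 0 g f.
Proof.
by split; apply: filterS => x; rewrite normr_le0 subr_eq0 => /eqP.
Qed.

Lemma is_ind_nonnull A f : is_ind mu m A f -> ~ (\forall x \ae mu, ~ A x).
Proof.
move=> fA A0; apply: (@isphere_sup _ _ _ _ _ _ S f 0) => //.
by apply: filterS2 fA A0 => x -> nA; rewrite ind0.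
Qed.

Lemma ae_eq_iso f g : (\forall x \ae mu, m g x = m f x) ->
  \forall x \ae nu, m' (D g) x = m' (D f) x.
Proof.
move=> /sup_dist0 /iso; apply: filterS => x.
by rewrite normr_le0 subr_eq0 => /eqP.
Qed.

(** Being an indicator is a metric property by [ind_rigid] and [rigid_ind]. *)
Lemma same_indicator_onto A : measurable A -> exists B, rel A B.
Proof.
move=> mA; have [A0|An] := pselect (\forall x \ae mu, ~ A x).
  by exists set0; split => //; left; split => //; apply: nearW => y [].
have [f fA] := isphere_indic S mA An.
have Df : is_ind nu m' [set y | m' (D f) y = 1] (D f).
  apply: (rigid_ind S') => h H; rewrite -(D'K h).
  apply: ae_eq_iso; apply: (ind_rigid S mA fA) => g /close_iso.
  by rewrite D'K => /H /close_iso.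
exists [set y | m' (D f) y = 1]; split => //.
  rewrite (_ : [set _ | _] = m' (D f) @^-1` [set 1])//.
  by rewrite -[X in measurable X]setTI; apply: mm'.
right; split => //; last by exists f.
move=> B0; apply: (@isphere_sup _ _ _ _ _ _ S' (D f) 0) => //.
by apply: filterS2 Df B0 => x -> nA; rewrite ind0.
Qed.

Lemma same_indicatorP A B f : rel A B -> is_ind mu m A f -> is_ind nu m' B (D f).
Proof.
move=> [mA mB [[A0 B0]|[An Bn [g [gA gB]]]]] fA.
  by case: (is_ind_nonnull fA).
have : \forall x \ae mu, m f x = m g x by apply: filterS2 fA gA => x -> ->.
by move/ae_eq_iso; apply: filterS2 gB => x -> ->.
Qed.

Lemma same_indicator_null A B : rel A B ->
  (\forall x \ae mu, ~ A x) <-> (\forall y \ae nu, ~ B y).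
Proof. by move=> [_ _ [[? ?]|[? ? _]]]. Qed.

(** That two sets have a nonnull intersection is a metric property of their
    indicators by [ind_meet] and [meet_ind]. *)
Lemma same_indicator_meet A B C E : rel A B -> rel C E ->
  (\forall y \ae nu, ~ (B `&` E) y) -> \forall x \ae mu, ~ (A `&` C) x.
Proof.
move=> AB CE BE; have [mA mB [[A0 B0]|[An Bn [f [fA fB]]]]] := AB.
  by apply: filterS A0 => x nA [].
have [mC mE [[C0 E0]|[Cn En [g [gC gE]]]]] := CE.
  by apply: filterS C0 => x nA [].
apply: contrapT => /(meet_ind S mA mC fA gC)[h [/iso hf /iso hg]].
by apply: (ind_meet S' fB gE _ BE); exists (D h).
Qed.

End OneSide.

Section TwoSides.
Context d d' (T : measurableType d) (T' : measurableType d').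
Variables (mu : {measure set T -> \bar R}) (nu : {measure set T' -> \bar R}).
Variables (X Y : Type) (m : X -> T -> R) (m' : Y -> T' -> R) (D : X -> Y) (D' : Y -> X).
Hypotheses (S : isphere mu m) (S' : isphere nu m').
Hypotheses (DK : cancel D D') (D'K : cancel D' D).
Hypothesis iso : forall c f g, sup_dist nu m' c (D f) (D g) <-> sup_dist mu m c f g.
Local Notation rel := (same_indicator mu nu m m' D).
Local Notation rel' := (same_indicator nu mu m' m D').

Lemma same_indicator_sym A B : rel A B -> rel' B A.
Proof.
move=> [mA mB [[A0 B0]|[An Bn [f [fA fB]]]]]; split => //; first by left.
by right; split => //; exists (D f); rewrite DK.
Qed.

Lemma same_indicator_sub A B A1 B1 : rel A B -> rel A1 B1 ->
  (\forall y \ae nu, B1 y -> B y) -> (\forall x \ae mu, A1 x -> A x).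
Proof.
move=> AB AB1 BB.
have [[mA mB _] [mA1 mB1 _]] := (AB, AB1).
have [B2 AB2] := same_indicator_onto S S' D'K iso (measurableD mA1 mA).
have B2B : \forall y \ae nu, ~ (B2 `&` B) y.
  apply: (same_indicator_meet S' S _ (same_indicator_sym AB2) (same_indicator_sym AB)).
    by move=> c f g; rewrite -iso !D'K.
  by apply: nearW => x [[]].
have : \forall x \ae mu, ~ ((A1 `\` A) `&` A1) x.
  apply: (same_indicator_meet S S' iso AB2 AB1).
  by apply: filterS2 BB B2B => y h1 h2 [h3 h4]; apply: h2; split => //; exact: h1.
by apply: filterS => x H A1x; apply: contrapT => nAx; apply: H.
Qed.

End TwoSides.

Section Levels.
Context d d' (T : measurableType d) (T' : measurableType d').
Variables (mu : {measure set T -> \bar R}) (nu : {measure set T' -> \bar R}).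
Variables (X Y : Type) (m : X -> T -> R) (m' : Y -> T' -> R) (D : X -> Y) (D' : Y -> X).
Hypotheses (S : isphere mu m) (S' : isphere nu m').
Hypotheses (DK : cancel D D') (D'K : cancel D' D).
Hypothesis iso : forall c f g, sup_dist nu m' c (D f) (D g) <-> sup_dist mu m c f g.
Local Notation rel := (same_indicator mu nu m m' D).
Local Notation rel' := (same_indicator nu mu m' m D').

Let iso' c f g : sup_dist mu m c (D' f) (D' g) <-> sup_dist nu m' c f g.
Proof. by rewrite -iso !D'K. Qed.

Let sym A B : rel A B -> rel' B A. Proof. exact: same_indicator_sym. Qed.

Lemma same_indicator_lower A B f q : rel A B -> 0 <= q <= 2^-1 ->
  (\forall x \ae mu, A x -> q <= m f x) -> \forall y \ae nu, B y -> q <= m' (D f) y.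
Proof.
move=> AB q01 fA; have [mA mB [[A0 B0]|[An Bn _]]] := AB.
  by apply: filterS B0.
have [C [g [mC gC AC fg]]] := (lower_level S f mA An q01).1 fA.
have [E CE] := same_indicator_onto S S' D'K iso mC.
apply/(lower_level S' (D f) mB Bn q01); exists E, (D g); split => //.
- by case: CE.
- exact: (same_indicatorP S iso CE).
- exact: (same_indicator_sub S' S D'K DK iso' (sym CE) (sym AB)).
- exact/iso.
Qed.

End Levels.

Section Transport.
Context d d' (T : measurableType d) (T' : measurableType d').
Variables (mu : {measure set T -> \bar R}) (nu : {measure set T' -> \bar R}).
Variables (X Y : Type) (m : X -> T -> R) (m' : Y -> T' -> R) (D : X -> Y) (D' : Y -> X).
Hypotheses (S : isphere mu m) (S' : isphere nu m').
Hypotheses (DK : cancel D D') (D'K : cancel D' D).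
Hypothesis iso : forall c f g, sup_dist nu m' c (D f) (D g) <-> sup_dist mu m c f g.
Local Notation rel := (same_indicator mu nu m m' D).
Local Notation rel' := (same_indicator nu mu m' m D').

Let iso' c f g : sup_dist mu m c (D' f) (D' g) <-> sup_dist nu m' c f g.
Proof. by rewrite -iso !D'K. Qed.

Let sym A B : rel A B -> rel' B A. Proof. exact: same_indicator_sym. Qed.

Let total B : measurable B -> exists A, rel A B.
Proof.
move=> mB; have [A BA] := same_indicator_onto S' S DK iso' mB; exists A.
have := same_indicator_sym D'K BA.
by [].
Qed.

(** For 1/2 <= c < 1 the bound is a metric property by [upper_level].  For
    smaller c, lower bounds q with c < q <= 1/2 are pulled back by the inverse
    map: the part of B where D f >= q matches a part of A where f >= q > c, which
    is null. *)
Lemma same_indicator_upper A B f c : rel A B -> 0 <= c ->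
  (\forall x \ae mu, A x -> m f x <= c) -> \forall y \ae nu, B y -> m' (D f) y <= c.
Proof.
move=> AB c0 fA; have [mA mB _] := AB.
have [c1|c1] := leP 1 c.
  by apply: filterS (isphere_le1 S' (D f)) => y fy _; exact: le_trans c1.
have [c2|c2] := leP 2^-1 c.
  have c21 : 2^-1 <= c < 1 by rewrite c2.
  have [C [g [mC gC CA fg]]] := (upper_level S f mA c21).1 fA.
  have [E CE] := same_indicator_onto S S' D'K iso mC.
  apply/(upper_level S' (D f) mB c21); exists E, (D g); split => //.
  - by case: CE.
  - exact: (same_indicatorP S iso CE).
  - exact: (same_indicator_meet S' S iso' (sym CE) (sym AB)).
  - exact/iso.
have [ee [eps key]] := small_sequence R.
have mm' := isphere_meas S' (D f).
pose q n := Num.min 2^-1 (c + ee n).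
have qc n : c < q n by rewrite /q lt_min c2 ltrDl; case/andP: (eps n).
have Bn n : \forall y \ae nu, ~ (B `&` [set y | q n <= m' (D f) y]) y.
  set Bn := _ `&` _.
  have mBn : measurable Bn by apply: measurableI => //; exact: mle_measurable.
  have [An ABn] := total mBn.
  apply/(same_indicator_null ABn).
  have AnA : \forall x \ae mu, An x -> A x.
    by apply: (same_indicator_sub S S' DK D'K iso AB ABn); apply: nearW => y [].
  have : \forall x \ae mu, An x -> q n <= m (D' (D f)) x.
    apply: (same_indicator_lower S' S D'K DK iso' (sym ABn)).
      by rewrite (le_trans c0 (ltW (qc n)))/= /q ge_min lexx.
    by apply: nearW => y [].
  rewrite DK; apply: filterS3 fA AnA => x h1 h2 h3 Anx.
  have := h1 (h2 Anx); have := h3 Anx; have := qc n; lra.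
have Bn' := ae_foralln Bn.
apply: filterS Bn' => y nB By; rewrite leNgt; apply/negP => cf.
have [n ne] := key (m' (D f) y - c) ltac:(by rewrite subr_gt0).
by apply: (nB n); split => //=; rewrite /q ge_min; apply/orP; right; lra.
Qed.

End Transport.

Section LocalTransport.
Context d d' (T : measurableType d) (T' : measurableType d').
Variables (mu : {measure set T -> \bar R}) (nu : {measure set T' -> \bar R}).
Variables (X Y : Type) (m : X -> T -> R) (m' : Y -> T' -> R) (D : X -> Y) (D' : Y -> X).
Hypotheses (S : isphere mu m) (S' : isphere nu m').
Hypotheses (DK : cancel D D') (D'K : cancel D' D).
Hypothesis iso : forall c f g, sup_dist nu m' c (D f) (D g) <-> sup_dist mu m c f g.
Local Notation rel := (same_indicator mu nu m m' D).
Local Notation rel' := (same_indicator nu mu m' m D').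

(** For the comparison, let B' be the part of B where t (D g) <= q < s (D f) for
    a fixed rational q.  The bound g <= q / t holds on the matching part A' of A,
    hence f <= q / s there, hence D f <= q / s on B', which must be null. *)
Lemma same_indicator_transport : local_transport mu nu m m' D rel.
Proof.
have iso' c f g : sup_dist mu m c (D' f) (D' g) <-> sup_dist nu m' c f g.
  by rewrite -iso !D'K.
have sym A B : rel A B -> rel' B A by exact: same_indicator_sym.
have total B : measurable B -> exists A, rel A B.
  move=> mB; have [A BA] := same_indicator_onto S' S DK iso' mB; exists A.
  exact: (same_indicator_sym D'K BA).
have sub A B A1 B1 : rel A B -> rel A1 B1 ->
    (\forall y \ae nu, B1 y -> B y) -> (\forall x \ae mu, A1 x -> A x).
  exact: (same_indicator_sub S S' DK D'K iso).
split => //.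
- by move=> A B [].
- exact: (same_indicator_onto S S' D'K iso).
- move=> A B A1 B1 AB AB1; split; last exact: sub.
  exact: (same_indicator_sub S' S D'K DK iso' (sym _ _ AB) (sym _ _ AB1)).
- by move=> A B AB; exact: (same_indicator_null AB).
move=> A B f g s t AB s0 t0 fg.
have [mA mB _] := AB.
have mm' := isphere_meas S'; have m0' := isphere_ge0 S'.
have [->|sN0] := eqVneq s 0; first by apply: nearW => y _; rewrite mul0r mulr_ge0.
have sp : 0 < s by rewrite lt_neqAle eq_sym sN0.
have [tE|tN0] := eqVneq t 0.
  have : \forall y \ae nu, B y -> m' (D f) y <= 0.
    apply: (same_indicator_upper S S' DK D'K iso AB) => //.
    apply: filterS fg => x fx Ax; have := fx Ax.
    by rewrite tE mul0r pmulr_rle0.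
  by apply: filterS => y fy By; rewrite tE mul0r pmulr_rle0// fy.
have tp : 0 < t by rewrite lt_neqAle eq_sym tN0.
have [q qP] : exists q : nat -> R, forall x y, x < y -> exists n, x < q n < y.
  exists (fun n => ratr (odflt 0 (unpickle n : option rat))) => x y xy.
  have [z] := rat_in_itvoo xy; rewrite in_itv /= => xzy.
  by exists (pickle z); rewrite pickleK.
have Bn n : \forall y \ae nu, ~ (B `&` ([set y | t * m' (D g) y <= q n] `&`
    [set y | q n < s * m' (D f) y])) y.
  set Bn := _ `&` _.
  have mBn : measurable Bn.
    apply: measurableI => //; apply: measurableI.
      by apply: mle_measurable => //; exact: measurable_funM.
    by apply: mlt_measurable => //; exact: measurable_funM.
  have [q0|q0] := ltP (q n) 0.
    by apply: nearW => y [_ [/= + _]]; rewrite leNgt (lt_le_trans q0)// mulr_ge0.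
  have [An ABn] := total _ mBn.
  have AnA : \forall x \ae mu, An x -> A x.
    by apply: (sub _ _ _ _ AB ABn); apply: nearW => y [].
  have gn : \forall x \ae mu, An x -> m (D' (D g)) x <= q n / t.
    apply: (same_indicator_upper S' S D'K DK iso' (sym _ _ ABn)).
      by rewrite divr_ge0.
    by apply: nearW => y [_ [yq _]]; rewrite ler_pdivlMr// [_ * t]mulrC; exact: yq.
  have : \forall y \ae nu, Bn y -> m' (D f) y <= q n / s.
    apply: (same_indicator_upper S S' DK D'K iso ABn).
      by rewrite divr_ge0.
    move: gn; rewrite DK; apply: filterS3 fg AnA => x h1 h2 h3 Anx.
    have := h3 Anx; rewrite !ler_pdivlMr// => h4.
    by rewrite mulrC (le_trans (h1 (h2 Anx)))// mulrC.
  apply: filterS => y H By; have := H By; case: By => _ [_ /=].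
  by rewrite ler_pdivlMr// [_ * s]mulrC => ? ?; lra.
have Bn' := ae_foralln Bn.
apply: filterS Bn' => y nB By; rewrite leNgt; apply/negP => H.
have [n /andP[n1 n2]] := qP _ _ H.
by apply: (nB n); split => //; split => //=; exact: ltW.
Qed.

End LocalTransport.

End IndicatorTransport.

(** * Linear extension from a generating cone *)

Section LinearMaps.
Context (A : pzRingType) (U V : lmodType A) (Phi : U -> V) (lin : linear Phi).

Lemma linear_zero : Phi 0 = 0.
Proof. by have := lin (-1) 0 0; rewrite scaler0 addr0 scaleN1r addNr. Qed.

Lemma linear_add u v : Phi (u + v) = Phi u + Phi v.
Proof. by have := lin 1 u v; rewrite !scale1r. Qed.

Lemma linear_scale c u : Phi (c *: u) = c *: Phi u.
Proof. by have := lin c u 0; rewrite !addr0 linear_zero addr0. Qed.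

Lemma linear_sub u v : Phi (u - v) = Phi u - Phi v.
Proof. by rewrite linear_add -scaleN1r linear_scale scaleN1r. Qed.

Lemma linear_bigsum (I : Type) (s : seq I) (F : I -> U) :
  Phi (\sum_(i <- s) F i) = \sum_(i <- s) Phi (F i).
Proof. exact: (big_morph Phi linear_add linear_zero). Qed.

End LinearMaps.

Section ConeExtension.
Context (R : realType) (E F : lmodType R[i]) (K : set E).
Hypothesis KD : forall a b, K a -> K b -> K (a + b).
Hypothesis KZ : forall (l : R) a, 0 <= l -> K a -> K (l%:C *: a).
Hypothesis Kgen : forall u, exists a b c d,
  [/\ K a, K b, K c, K d & u = a - b + 'i *: (c - d)].
Hypothesis Kind : forall a b c d, K a -> K b -> K c -> K d ->
  a - b + 'i *: (c - d) = 0 -> a = b /\ c = d.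
Variable (S : E -> F).
Hypothesis SD : forall a b, K a -> K b -> S (a + b) = S a + S b.
Hypothesis SZ : forall (l : R) a, 0 <= l -> K a -> S (l%:C *: a) = l%:C *: S a.

Let rep (u : E) (w : F) := exists a b c d,
  [/\ K a, K b, K c, K d & u = a - b + 'i *: (c - d) /\
    w = S a - S b + 'i *: (S c - S d)].

Let rep_ex u : exists w, rep u w.
Proof.
have [a [b [c [d [Ka Kb Kc Kd uE]]]]] := Kgen u.
by exists (S a - S b + 'i *: (S c - S d)), a, b, c, d.
Qed.

Let repD u v w z : rep u w -> rep v z -> rep (u + v) (w + z).
Proof.
move=> [a [b [c [d [Ka Kb Kc Kd [-> ->]]]]]] [a' [b' [c' [d' [Ka' Kb' Kc' Kd' [-> ->]]]]]].
exists (a + a'), (b + b'), (c + c'), (d + d'); split; try exact: KD; split.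
  by rewrite addrACA -scalerDr !opprD (addrACA a) (addrACA c).
by rewrite !SD// addrACA -scalerDr !opprD (addrACA (S a)) (addrACA (S c)).
Qed.

Let repN u w : rep u w -> rep (- u) (- w).
Proof.
move=> [a [b [c [d [Ka Kb Kc Kd [-> ->]]]]]]; exists b, a, d, c; split => //; split.
  by rewrite opprD -scalerN !opprB.
by rewrite opprD -scalerN !opprB.
Qed.

Let repi u w : rep u w -> rep ('i *: u) ('i *: w).
Proof.
move=> [a [b [c [d [Ka Kb Kc Kd [-> ->]]]]]]; exists d, c, a, b; split => //; split.
  by rewrite scalerDr scalerA -expr2 sqr_i scaleN1r opprB addrC.
by rewrite scalerDr scalerA -expr2 sqr_i scaleN1r opprB addrC.
Qed.

Let repZ (l : R) u w : 0 <= l -> rep u w -> rep (l%:C *: u) (l%:C *: w).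
Proof.
move=> l0 [a [b [c [d [Ka Kb Kc Kd [-> ->]]]]]].
exists (l%:C *: a), (l%:C *: b), (l%:C *: c), (l%:C *: d); split; try exact: KZ; split.
  by rewrite scalerDr !scalerBr !scalerA (mulrC 'i).
by rewrite !SZ// scalerDr !scalerBr !scalerA (mulrC 'i).
Qed.

Let rep_uniq u w z : rep u w -> rep u z -> w = z.
Proof.
move=> /repN uw uz; have := repD uw uz; rewrite addNr.
move=> [a [b [c [d [Ka Kb Kc Kd [/esym E0 wz]]]]]].
have [ab cd] := Kind Ka Kb Kc Kd E0.
by move: wz; rewrite ab cd !subrr scaler0 addr0 addrC => /eqP; rewrite subr_eq0 => /eqP.
Qed.

(** Write u = a - b + i (c - d) with a, b, c, d in the cone and send it to
    S a - S b + i (S c - S d).  Two decompositions of u differ by one of 0, on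
    which this expression vanishes. *)
Lemma cone_extension : exists Phi : E -> F, linear Phi /\ forall a, K a -> Phi a = S a.
Proof.
pose Phi u := projT1 (cid (rep_ex u)).
have PhiP u : rep u (Phi u) by rewrite /Phi; case: cid.
have PhiE u w : rep u w -> Phi u = w by apply: rep_uniq.
have PD u v : Phi (u + v) = Phi u + Phi v by apply: PhiE; exact: repD.
have PN u : Phi (- u) = - Phi u by apply: PhiE; exact: repN.
have Pi u : Phi ('i *: u) = 'i *: Phi u by apply: PhiE; exact: repi.
have PR (l : R) u : Phi (l%:C *: u) = l%:C *: Phi u.
  have [l0|l0] := leP 0 l; first by apply: PhiE; exact: repZ.
  have -> : l%:C = - (- l)%:C :> R[i] by rewrite raddfN/= opprK.
  rewrite !scaleNr PN; congr (- _); apply: PhiE; apply: repZ => //.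
  by rewrite oppr_ge0 ltW.
have PZ z u : Phi (z *: u) = z *: Phi u.
  have -> : z = (Re z)%:C + 'i * (Im z)%:C by case: z => x y; simpc.
  by rewrite !scalerDl PD PR -!scalerA Pi PR.
have K0 : K 0.
  have [a [_ [_ [_ [Ka _ _ _ _]]]]] := Kgen 0.
  by have := KZ (lexx 0) Ka; rewrite scale0r.
have S0 : S 0 = 0.
  by have := SZ (lexx 0) K0; rewrite !scale0r.
exists Phi; split; first by move=> z u v; rewrite PD PZ.
move=> a Ka; apply: PhiE; exists a, 0, 0, 0; split => //; split.
  by rewrite !subr0 scaler0 addr0.
by rewrite S0 !subr0 scaler0 addr0.
Qed.

Lemma cone_linear_eq (Phi Psi : E -> F) : linear Phi -> linear Psi ->
  (forall a, K a -> Phi a = Psi a) -> Phi = Psi.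
Proof.
move=> lP lQ PQ; apply/funext => u.
have [a [b [c [d [Ka Kb Kc Kd ->]]]]] := Kgen u.
have L (L : E -> F) (lL : linear L) : L (a - b + 'i *: (c - d)) =
    L a - L b + 'i *: (L c - L d).
  by rewrite (linear_add lL) (linear_scale lL) !(linear_sub lL).
by rewrite !L// !PQ.
Qed.

End ConeExtension.

Section LnormAe.
Context d (T : measurableType d) (R : realType).
Variables (mu : {measure set T -> \bar R}) (p : \bar R).

Lemma le_Lnorm_ae (f g : T -> R) : measurable_fun setT f ->
  measurable_fun setT g -> (0 <= p)%E -> (\forall x \ae mu, `|f x| <= `|g x|) ->
  ('N[mu]_p[EFin \o f] <= 'N[mu]_p[EFin \o g])%E.
Proof.
move=> mf mg p0 fg; rewrite unlock; case: p p0 => [r| |] /=; last by [].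
- rewrite lee_fin => r0; rewrite gt0_ler_poweR ?invr_ge0//.
  + by rewrite in_itv/= leey integral_ge0// => x _; rewrite lee_fin powR_ge0.
  + by rewrite in_itv/= leey integral_ge0// => x _; rewrite lee_fin powR_ge0.
  + apply: ae_ge0_le_integral => //.
    * exact: pint_meas.
    * exact: pint_meas.
    * by apply: filterS fg => x fg _; rewrite lee_fin ge0_ler_powR ?nnegrE.
- by move=> _; case: ifPn => [_|_]; [|by rewrite lexx]; apply: le_ess_sup; apply: filterS fg => x /=;
    rewrite lee_fin.
Qed.

Lemma eq_Lnorm_ae (f g : T -> R) : measurable_fun setT f ->
  measurable_fun setT g -> (0 <= p)%E -> (\forall x \ae mu, `|f x| = `|g x|) ->
  ('N[mu]_p[EFin \o f] = 'N[mu]_p[EFin \o g])%E.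
Proof.
move=> mf mg p0 fg; apply/eqP; rewrite eq_le !le_Lnorm_ae//.
  by apply: filterS fg => x ->.
by apply: filterS fg => x ->.
Qed.

End LnormAe.

Lemma ge0_normc (R : realType) (z : R[i]) : 0 <= z -> z = (normc z)%:C.
Proof.
case: z => a b; rewrite lecE /= => /andP[/eqP -> a0].
by rewrite expr0n addr0 sqrtr_sqr ger0_norm.
Qed.

Lemma normc_real (R : realType) (x : R) : normc x%:C = `|x|.
Proof. by rewrite /= expr0n addr0 sqrtr_sqr. Qed.

Lemma ler0c (R : realType) (x : R) : (0 <= x%:C) = (0 <= x).
Proof. by rewrite lecE /= eqxx. Qed.

(** * Spaces modelled on L^p *)

(** E is a copy of the complex L^p(mu) with its norm and cone, through the choice
    [ev] of representatives.  The anchored Sobolev space is an instance for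
    a measure with atoms ([sobolev_model]). *)
Record Lp_model (R : realType) (p : \bar R) d (T : measurableType d)
    (mu : {measure set T -> \bar R}) (E : ordNormed R) (ev : E -> T -> R[i]) : Prop := {
  model_lin : forall c u v, \forall x \ae mu, ev (c *: u + v) x = c * ev u x + ev v x;
  model_inj : forall u v, (\forall x \ae mu, ev u x = ev v x) -> u = v;
  model_fun : forall u, ev u \in clfun mu p;
  model_surj : forall h, h \in clfun mu p -> exists u, \forall x \ae mu, ev u x = h x;
  model_norm : forall u, onv_norm u = fine ('N[mu]_p[EFin \o (@normc R \o ev u)])%E;
  model_cone : forall u, onv_cone u <-> \forall x \ae mu, 0 <= ev u x }.

Section ModelTheory.
Context (R : realType) (p : \bar R) (p1 : (1 <= p)%E) d (T : measurableType d).
Variables (mu : {measure set T -> \bar R}) (E : ordNormed R) (ev : E -> T -> R[i]).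
Hypothesis M : Lp_model p mu ev.
Local Notation K := (@onv_cone R E).

Let p0 : (0 <= p)%E. Proof. exact: le_trans p1. Qed.

Lemma model_D (u v : E) : \forall x \ae mu, ev (u + v) x = ev u x + ev v x.
Proof. by have := model_lin M 1 u v; apply: filterS => x; rewrite scale1r mul1r. Qed.

Lemma model_0 : \forall x \ae mu, ev 0 x = 0.
Proof.
by have := model_lin M (-1) 0 0; apply: filterS => x; rewrite scaler0 addr0 mulN1r addNr.
Qed.

Lemma model_Z c (u : E) : \forall x \ae mu, ev (c *: u) x = c * ev u x.
Proof.
have := model_lin M c u 0; apply: filterS2 model_0 => x x0.
by rewrite addr0 x0 addr0.
Qed.

Lemma model_B (u v : E) : \forall x \ae mu, ev (u - v) x = ev u x - ev v x.
Proof.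
by have := model_lin M (-1) v u; apply: filterS => x; rewrite scaleN1r mulN1r addrC => ->; rewrite addrC.
Qed.

Lemma model_meas (u : E) : [/\ measurable_fun setT (@Re R \o ev u),
  measurable_fun setT (@Im R \o ev u) & measurable_fun setT (@normc R \o ev u)].
Proof.
have /asboolP[mr mi _] := model_fun M u; split => //; exact: measurable_normc.
Qed.

Lemma model_norm_fin (u : E) : ('N[mu]_p[EFin \o (@normc R \o ev u)])%E = (onv_norm u)%:E.
Proof.
rewrite (model_norm M) fineK// ge0_fin_numE ?Lnorm_ge0//.
by have /asboolP[] := model_fun M u.
Qed.

Lemma model_norm_ge0 (u : E) : 0 <= onv_norm u.
Proof. by rewrite -lee_fin -model_norm_fin Lnorm_ge0. Qed.

Lemma model_le_norm (u v : E) : (\forall x \ae mu, normc (ev u x) <= normc (ev v x)) ->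
  onv_norm u <= onv_norm v.
Proof.
move=> uv; rewrite -lee_fin -!model_norm_fin; apply: le_Lnorm_ae => //.
- by have [] := model_meas u.
- by have [] := model_meas v.
by apply: filterS uv => x; rewrite !ger0_norm ?normc_ge0.
Qed.

Lemma model_cone_real (u : E) : K u -> \forall x \ae mu, ev u x = (normc (ev u x))%:C.
Proof. by move=> /(model_cone M); apply: filterS => x; exact: ge0_normc. Qed.

Lemma model_coneD (u v : E) : K u -> K v -> K (u + v).
Proof.
move=> /(model_cone M) u0 /(model_cone M) v0; apply/(model_cone M).
by apply: filterS3 (model_D u v) u0 v0 => x -> ? ?; exact: addr_ge0.
Qed.

Lemma model_coneZ (l : R) (u : E) : 0 <= l -> K u -> K (l%:C *: u).
Proof.
move=> l0 /(model_cone M) u0; apply/(model_cone M).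
by apply: filterS2 (model_Z l%:C u) u0 => x -> ?; apply: mulr_ge0; rewrite ?ler0c.
Qed.

Lemma model_surj_real (f : T -> R) : measurable_fun setT f ->
  ('N[mu]_p[EFin \o f] < +oo)%E -> exists u, \forall x \ae mu, ev u x = (f x)%:C.
Proof.
move=> mf ff; apply: (model_surj M); apply/asboolP; split.
- by rewrite (_ : _ \o _ = f)//; apply/funext.
- rewrite (_ : _ \o _ = cst 0)//; apply/funext.
- rewrite (_ : 'N[mu]_p[_] = 'N[mu]_p[EFin \o f])%E//.
  apply: eq_Lnorm_ae => //.
    rewrite (_ : _ \o _ = @Num.norm R R \o f); first exact: measurableT_comp.
    by apply/funext => x; exact: normc_real.
  by apply: nearW => x /=; rewrite expr0n addr0 sqrtr_sqr normr_id.
Qed.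

Lemma model_surj_dom (f : T -> R) (u : E) : measurable_fun setT f ->
  (forall x, `|f x| <= normc (ev u x)) -> exists v, \forall x \ae mu, ev v x = (f x)%:C.
Proof.
move=> mf fu; apply: model_surj_real => //.
have /asboolP[_ _] := model_fun M u; apply: le_lt_trans; apply: le_Lnorm_ae => //.
  by have [] := model_meas u.
by apply: nearW => x /=; rewrite [leRHS]ger0_norm ?normc_ge0.
Qed.

Lemma model_modulus (u : E) : exists v, [/\ K v,
  \forall x \ae mu, ev v x = (normc (ev u x))%:C & onv_norm v = onv_norm u].
Proof.
have [_ _ mn] := model_meas u.
have [|v vE] := @model_surj_dom (@normc R \o ev u) u mn.
  by move=> x /=; rewrite ger0_norm ?normc_ge0.
exists v; split => //.
  by apply/(model_cone M); apply: filterS vE => x ->; rewrite ler0c normc_ge0.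
by apply/eqP; rewrite eq_le !model_le_norm//; apply: filterS vE => x ->;
  rewrite normc_real ger0_norm ?normc_ge0.
Qed.

Lemma model_cone_gen (u : E) : exists a b c d,
  [/\ K a, K b, K c, K d & u = a - b + 'i *: (c - d)].
Proof.
have [mr mi _] := model_meas u.
have maxB (t : R) : Num.max t 0 - Num.max (- t) 0 = t.
  by have [t1|t1] := leP t 0; have [t2|t2] := leP (- t) 0; lra.
have pos (f : T -> R) : measurable_fun setT f -> (forall x, `|f x| <= normc (ev u x)) ->
   exists v, [/\ K v & \forall x \ae mu, ev v x = (Num.max (f x) 0)%:C].
  move=> mf fu; have [||v vE] := @model_surj_dom (fun x => Num.max (f x) 0) u.
  - exact: measurable_maxr.
  - move=> x; apply: le_trans (fu x); have [f0|f0] := leP (f x) 0.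
      by rewrite normr0.
    by [].
  exists v; split => //; apply/(model_cone M); apply: filterS vE => x ->.
  by rewrite ler0c le_max lexx orbT.
have [||a [Ka aE]] := pos (@Re R \o ev u) => //; first by move=> x; exact: normr_Re_le.
have [||b [Kb bE]] := pos (fun x => - Re (ev u x)).
- exact: measurableT_comp.
- by move=> x; rewrite normrN; exact: normr_Re_le.
have [||c [Kc cE]] := pos (@Im R \o ev u) => //; first by move=> x; exact: normr_Im_le.
have [||e [Ke eE]] := pos (fun x => - Im (ev u x)).
- exact: measurableT_comp.
- by move=> x; rewrite normrN; exact: normr_Im_le.
exists a, b, c, e; split => //; apply: (model_inj M).
have ab := model_B a b; have ce := model_B c e.
have iE := model_Z 'i (c - e); have D := model_D (a - b) ('i *: (c - e)).
have ab' : \forall x \ae mu, ev (a - b) x = (Re (ev u x))%:C.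
  apply: filterS3 ab aE bE => x -> -> -> /=; rewrite -raddfB /=; congr (_%:C).
  exact: maxB.
have ce' : \forall x \ae mu, ev (c - e) x = (Im (ev u x))%:C.
  apply: filterS3 ce cE eE => x -> -> -> /=; rewrite -raddfB /=; congr (_%:C).
  exact: maxB.
have DD : \forall x \ae mu, ev (a - b + 'i *: (c - e)) x = ev (a - b) x + 'i * ev (c - e) x.
  by apply: filterS2 D iE => x -> ->.
apply: filterS3 DD ab' ce' => x -> -> ->.
by case: (ev u x) => r s; simpc.
Qed.

Lemma model_cone_ind (a b c e : E) : K a -> K b -> K c -> K e ->
  a - b + 'i *: (c - e) = 0 -> a = b /\ c = e.
Proof.
move=> Ka Kb Kc Ke H.
have ab := model_B a b; have ce := model_B c e.
have iE := model_Z 'i (c - e); have D := model_D (a - b) ('i *: (c - e)).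
rewrite H in D.
have D0 : \forall x \ae mu, 0 = ev (a - b) x + 'i * ev (c - e) x.
  by apply: filterS3 D iE model_0 => x h1 h2 h3; rewrite -h3 h1 h2.
have D1 : \forall x \ae mu, 0 = (ev a x - ev b x) + 'i * (ev c x - ev e x).
  by apply: filterS3 D0 ab ce => x -> -> ->.
have R1 : \forall x \ae mu, Im (ev a x) = 0 /\ Im (ev b x) = 0.
  move: Ka Kb => /(model_cone M) + /(model_cone M); apply: filterS2 => x.
  by rewrite !lecE /= => /andP[/eqP -> _] /andP[/eqP -> _].
have R2 : \forall x \ae mu, Im (ev c x) = 0 /\ Im (ev e x) = 0.
  move: Kc Ke => /(model_cone M) + /(model_cone M); apply: filterS2 => x.
  by rewrite !lecE /= => /andP[/eqP -> _] /andP[/eqP -> _].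
have F : \forall x \ae mu, ev a x = ev b x /\ ev c x = ev e x.
  apply: filterS3 D1 R1 R2 => x.
  case: (ev a x) (ev b x) (ev c x) (ev e x) => a1 a2 [b1 b2] [c1 c2] [e1 e2] /= + [a20 b20] [c20 e20].
  move=> /eqP; rewrite eq_complex /= => /andP[/eqP h1 /eqP h2].
  by split; congr (_ +i* _); lra.
by split; apply: (model_inj M); apply: filterS F => x [].
Qed.

Lemma model_cone_add0 (a b : E) : K a -> K b -> a + b = 0 -> a = 0.
Proof.
move=> /(model_cone M) Ka /(model_cone M) Kb ab; apply: (model_inj M).
have := model_D a b; rewrite ab => D.
have D1 : \forall x \ae mu, ev a x + ev b x = 0.
  by apply: filterS2 D model_0 => x + h; rewrite h.
have KK : \forall x \ae mu, 0 <= ev a x /\ 0 <= ev b x by apply: filterS2 Ka Kb.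
apply: filterS3 KK D1 model_0 => x [a0 b0] /eqP + ->.
by rewrite paddr_eq0// => /andP[/eqP].
Qed.

Lemma model_normZ (l : R) (u : E) : 0 <= l -> onv_norm (l%:C *: u) = l * onv_norm u.
Proof.
move=> l0; apply/eqP; rewrite -eqe EFinM -!model_norm_fin.
have [_ _ mn] := model_meas u.
have uL : @normc R \o ev u \in Lfun mu p.
  apply/andP; split; rewrite inE//=; have /asboolP[] := model_fun M u => //.
have := LnormZ (Lfun_Sub p1 uL) l; rewrite (ger0_norm l0) /= => <-.
apply/eqP/eq_Lnorm_ae => //.
- by have [] := model_meas (l%:C *: u).
- exact: measurable_funM.
apply: filterS (model_Z l%:C u) => x /= ->.
by rewrite ComplexField.Normc.normcM normc_real !ger0_norm ?mulr_ge0 ?normc_ge0.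
Qed.

Lemma model_norm_eq0 (u : E) : onv_norm u = 0 -> u = 0.
Proof.
move=> u0; apply: (model_inj M).
have [_ _ mn] := model_meas u.
have N0 : ('N[mu]_p[EFin \o (@normc R \o ev u)] = 0)%E by rewrite model_norm_fin u0.
have p0' : (0 < p)%E by exact: lt_le_trans p1.
have mE : measurable_fun setT (EFin \o (@normc R \o ev u)) by exact/measurable_EFinP.
have H' : \forall x \ae mu, normc (ev u x) = 0.
  by have := Lnorm_eq0_eq0 mE p0' N0; apply: filterS => x /(_ I) [].
apply: filterS2 model_0 H' => x ->.
exact: ComplexField.Normc.eq0_normc.
Qed.

Lemma model_norm0 : onv_norm (0 : E) = 0.
Proof. by rewrite -(scale0r (0 : E)) (@model_normZ 0) ?mul0r. Qed.

End ModelTheory.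

(** * Extension of a sphere isometry *)

Lemma pint_Lnorm (R : realType) d (T : measurableType d)
    (mu : {measure set T -> \bar R}) (r : R) (u : T -> R) : r != 0 ->
  pint mu r setT u = ('N[mu]_r%:E[EFin \o u] `^ r)%E.
Proof. by move=> r0; rewrite powR_Lnorm. Qed.

Section SphereModel.
Context (R : realType) (p : \bar R) (p1 : (1 <= p)%E) d (T : measurableType d).
Variables (mu : {measure set T -> \bar R}) (E : ordNormed R) (ev : E -> T -> R[i]).
Hypothesis M : Lp_model p mu ev.
Local Notation K := (@onv_cone R E).

Let p0 : (0 <= p)%E. Proof. exact: le_trans p1. Qed.

Lemma sphereP (f : positive_sphere E) : K (val f) /\ onv_norm (val f) = 1.
Proof. exact: set_mem (valP f). Qed.

Lemma sphere_of (v : E) : K v -> onv_norm v = 1 -> exists f : positive_sphere E, val f = v.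
Proof.
move=> Kv v1; have H : positive_sphere E v by [].
by exists (SigSub (mem_set H)).
Qed.

(** The modulus of the representative of a positive element is a representative
    that is nonnegative everywhere. *)
Definition modulus (f : positive_sphere E) : T -> R := @normc R \o ev (val f).

Lemma modulus_meas f : measurable_fun setT (modulus f).
Proof. by have [] := model_meas M (val f). Qed.

Lemma modulus_ge0 f x : 0 <= modulus f x.
Proof. exact: normc_ge0. Qed.

Lemma modulusE f : \forall x \ae mu, ev (val f) x = (modulus f x)%:C.
Proof. by have [Kf _] := sphereP f; exact: (model_cone_real M). Qed.

Lemma modulus_dist (f g : positive_sphere E) :
  ('N[mu]_p[EFin \o (modulus f \- modulus g)%R] = (onv_norm (val f - val g)%R)%:E)%E.
Proof.
rewrite -(model_norm_fin M); apply: eq_Lnorm_ae => //.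
- by apply: measurable_funB; exact: modulus_meas.
- by have [] := model_meas M (val f - val g).
apply: filterS3 (model_B M (val f) (val g)) (modulusE f) (modulusE g) => x /= -> -> ->.
by rewrite -raddfB normc_real normr_id.
Qed.

Lemma modulus_norm f : ('N[mu]_p[EFin \o modulus f] = 1)%E.
Proof. by rewrite (model_norm_fin M); have [_ ->] := sphereP f. Qed.

Lemma modulus_onto (u : T -> R) : measurable_fun setT u -> (forall x, 0 <= u x) ->
  ('N[mu]_p[EFin \o u] = 1)%E ->
  exists f, \forall x \ae mu, modulus f x = u x.
Proof.
move=> mu_ u0 u1; have [|v vE] := @model_surj_real _ _ p1 _ _ _ _ _ M u mu_.
  by rewrite u1 ltry.
have [||f fv] := @sphere_of v.
- by apply/(model_cone M); apply: filterS vE => x ->; rewrite ler0c.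
- apply/eqP; rewrite -eqe -(model_norm_fin M) -u1; apply/eqP/eq_Lnorm_ae => //.
    by have [] := model_meas M v.
  by apply: filterS vE => x /= ->; rewrite normc_real normr_id.
exists f; rewrite /modulus fv; apply: filterS vE => x /= ->.
by rewrite normc_real ger0_norm.
Qed.

Lemma sphere_psphere r : p = r%:E -> psphere mu r modulus.
Proof.
move=> pE.
have r0 : r != 0 by rewrite gt_eqF// -lte_fin -pE (lt_le_trans _ p1).
have NE u : pint mu r setT u = ('N[mu]_p[EFin \o u] `^ r)%E.
  by rewrite pE powR_Lnorm.
split.
- exact: modulus_meas.
- exact: modulus_ge0.
- by move=> f; rewrite NE modulus_norm poweR1r.
move=> u mu_ u0 u1; apply: modulus_onto => //.
have := NE u; rewrite u1 => /esym.
have := Lnorm_ge0 mu p (EFin \o u); case: ('N[mu]_p[_])%E => [s| |]//=.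
  rewrite lee_fin => s0 -[] /eqP; rewrite powR_eq1 (negbTE r0) orbF ltNge s0 orbF.
  by move=> /eqP ->.
move=> _; rewrite /poweR; case: ifP => //.
  by move=> /eqP r00; rewrite r00 eqxx in r0.
Qed.

Lemma sup_distE c (f g : positive_sphere E) : p = +oo%E ->
  sup_dist mu modulus c f g <-> onv_norm (val f - val g) <= c.
Proof.
move=> pE; rewrite -lee_fin -modulus_dist pE unlock.
have mu0 : (0 < mu setT)%E.
  rewrite lt0e measure_ge0 andbT; apply/negP => /eqP mu0.
  have := modulus_norm f; rewrite pE unlock mu0 ltxx => /eqP.
  by rewrite eqe eq_sym oner_eq0.
rewrite mu0; split=> [H|/ess_supP H].
  by apply/ess_supP; apply: filterS H => x /=; rewrite lee_fin.
by apply: filterS H => x /=; rewrite lee_fin.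
Qed.

Lemma sphere_isphere : p = +oo%E -> isphere mu modulus.
Proof.
move=> pE.
have NE (f : positive_sphere E) : (0 < mu setT)%E /\
    ess_sup mu (abse \o (EFin \o modulus f)) = 1%E.
  have := modulus_norm f; rewrite pE unlock; case: ifPn => // _ /eqP.
  by rewrite eqe eq_sym oner_eq0.
split.
- exact: modulus_meas.
- exact: modulus_ge0.
- move=> f; have [_ N1] := NE f.
  have : (ess_sup mu (abse \o (EFin \o modulus f)) <= 1)%E by rewrite N1.
  by move/ess_supP; apply: filterS => x /=; rewrite lee_fin ger0_norm ?normc_ge0.
- move=> f c c1 H; have [_ N1] := NE f.
  have : (ess_sup mu (abse \o (EFin \o modulus f)) <= c%:E)%E.
    by apply/ess_supP; apply: filterS H => x /=; rewrite lee_fin ger0_norm ?normc_ge0.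
  by rewrite N1 lee_fin leNgt c1.
move=> u mu_ u0 u1 uc; apply: modulus_onto => //.
rewrite pE unlock.
have mu0 : (0 < mu setT)%E.
  rewrite lt0e measure_ge0 andbT; apply/negP => /eqP mu0.
  by apply: (uc 0) => //; exact: measure0_ae.
rewrite mu0; apply/eqP; rewrite eq_le; apply/andP; split.
  by apply/ess_supP; apply: filterS u1 => x /=; rewrite lee_fin ger0_norm.
rewrite leNgt; apply/negP => lt1.
have [c c1 cE] : exists2 c : R, c < 1 & (ess_sup mu (abse \o (EFin \o u)) <= c%:E)%E.
  move: lt1; case: (ess_sup _ _) => [s| |]//.
    by rewrite lte_fin => s1; exists s.
  by move=> _; exists 0; rewrite ?ltr01// leNye.
apply: (uc c c1); move/ess_supP: cE; apply: filterS => x /=.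
by rewrite lee_fin ger0_norm.
Qed.

End SphereModel.

Section ExtendOneSide.
Context (R : realType) (p : \bar R) (p1 : (1 <= p)%E).
Context d (T : measurableType d) d' (T' : measurableType d').
Variables (mu : {measure set T -> \bar R}) (nu : {measure set T' -> \bar R}).
Hypotheses (mufin : (mu setT < +oo)%E) (nufin : (nu setT < +oo)%E).
Variables (E F : ordNormed R) (ev : E -> T -> R[i]) (ew : F -> T' -> R[i]).
Hypotheses (M : Lp_model p mu ev) (N : Lp_model p nu ew).
Variables (D : positive_sphere E -> positive_sphere F)
          (D' : positive_sphere F -> positive_sphere E).
Hypotheses (DK : cancel D D') (D'K : cancel D' D).
Hypothesis iso : forall f g,
  onv_norm (val (D f) - val (D g)) = onv_norm (val f - val g).
Local Notation K := (@onv_cone R E).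

Lemma sphere_transport : exists rel,
  local_transport mu nu (modulus ev) (modulus ew) D rel.
Proof.
have [[r pE]|pE|pE] : [\/ exists r, p = r%:E, p = +oo%E | p = -oo%E].
- by case: p => [r| |]; [constructor 1; exists r|constructor 2|constructor 3].
- have r1 : 1 <= r by rewrite -lee_fin -pE.
  exists (same_support mu nu (modulus ev) (modulus ew) D).
  apply: (same_support_transport r1 mufin nufin
    (sphere_psphere p1 M pE) (sphere_psphere p1 N pE) DK D'K) => f g.
  have r0 : r != 0 by rewrite gt_eqF// (lt_le_trans ltr01).
  rewrite !pint_Lnorm// -pE.
  by rewrite (modulus_dist p1 N) (modulus_dist p1 M) iso.
- exists (same_indicator mu nu (modulus ev) (modulus ew) D).
  apply: (same_indicator_transport (sphere_isphere p1 M pE)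
    (sphere_isphere p1 N pE) DK D'K) => c f g.
  by rewrite (sup_distE p1 M)// (sup_distE p1 N)// iso.
- by move: p1; rewrite pE.
Qed.

Lemma sphere_map_add (f g h : positive_sphere E) (a b l : R) :
  0 <= a -> 0 <= b -> 0 <= l ->
  l%:C *: val h = a%:C *: val f + b%:C *: val g ->
  l%:C *: val (D h) = a%:C *: val (D f) + b%:C *: val (D g).
Proof.
move=> a0 b0 l0 H; have [rel relP] := sphere_transport.
have comb (S : ordNormed R) d0 (U : measurableType d0) (la : {measure set U -> \bar R})
   (es : S -> U -> R[i]) (MS : Lp_model p la es) (f1 g1 : positive_sphere S) :
   \forall x \ae la, es (a%:C *: val f1 + b%:C *: val g1) x =
     (a * modulus es f1 x + b * modulus es g1 x)%:C.
  have L := model_lin MS a%:C (val f1) (b%:C *: val g1).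
  have Z := model_Z MS b%:C (val g1).
  have L' : \forall x \ae la, es (a%:C *: val f1 + b%:C *: val g1) x =
      a%:C * es (val f1) x + b%:C * es (val g1) x.
    by apply: filterS2 L Z => x -> ->.
  apply: filterS3 L' (modulusE MS f1) (modulusE MS g1) => x -> -> ->.
  by rewrite !rmorphD !rmorphM.
have sc (S : ordNormed R) d0 (U : measurableType d0) (la : {measure set U -> \bar R})
   (es : S -> U -> R[i]) (MS : Lp_model p la es) (f1 : positive_sphere S) :
   \forall x \ae la, es (l%:C *: val f1) x = (l * modulus es f1 x)%:C.
  by apply: filterS2 (model_Z MS l%:C (val f1)) (modulusE MS f1) => x -> ->; rewrite rmorphM.
apply: (model_inj N).
have := sc _ _ _ _ _ M h; rewrite H => sch.
have add : \forall x \ae mu, l * modulus ev h x = a * modulus ev f x + b * modulus ev g x.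
  by apply: filterS2 sch (comb _ _ _ _ _ M f g) => x -> [].
have := transport_add (modulus_meas M) (modulus_meas N) (modulus_ge0 ev)
  (modulus_ge0 ew) relP a0 b0 l0 add.
apply: filterS3 (sc _ _ _ _ _ N (D h)) (comb _ _ _ _ _ N (D f) (D g)) => y -> -> ->.
by [].
Qed.

(** Sends l f, for l >= 0 and f in the sphere, to l (D f); off the cone 0 is
    a default value. *)
Definition homog_ext (v : E) : F :=
  match pselect (positive_sphere E ((onv_norm v)^-1%:C *: v)) with
  | left H => (onv_norm v)%:C *: val (D (SigSub (mem_set H)))
  | right _ => 0
  end.

Lemma homog_extE (l : R) (f : positive_sphere E) : 0 <= l ->
  homog_ext (l%:C *: val f) = l%:C *: val (D f).
Proof.
move=> l0; have [Kf f1] := sphereP f.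
have nl : onv_norm (l%:C *: val f) = l by rewrite (model_normZ p1 M)// f1 mulr1.
rewrite /homog_ext nl.
have [->|lN0] := eqVneq l 0.
  case: pselect => H; last by rewrite scale0r.
  by rewrite !scale0r.
have -> : l^-1%:C *: (l%:C *: val f) = val f.
  by rewrite scalerA -rmorphM /= mulVf// scale1r.
case: pselect => [H|/(_ (set_mem (valP f)))//].
by congr (_ *: val (D _)); exact: val_inj.
Qed.

Lemma cone_sphere (v : E) : K v -> v = 0 \/ exists l f,
  0 < l /\ v = l%:C *: val (f : positive_sphere E).
Proof.
move=> Kv; have [v0|vN0] := eqVneq v 0; [by left|right].
have nv : 0 < onv_norm v.
  rewrite lt_neqAle (model_norm_ge0 M) andbT eq_sym; apply: contra vN0 => /eqP.
  by move/(model_norm_eq0 p1 M) ->.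
have [||f fE] := @sphere_of _ E ((onv_norm v)^-1%:C *: v).
- by apply: (model_coneZ M) => //; rewrite invr_ge0 ltW.
- by rewrite (model_normZ p1 M) ?invr_ge0 ?ltW// mulVf// gt_eqF.
exists (onv_norm v), f; split => //.
by rewrite fE scalerA -rmorphM /= mulfV ?scale1r// gt_eqF.
Qed.

Lemma homog_ext0 : homog_ext 0 = 0.
Proof.
rewrite /homog_ext; case: pselect => // H.
by move: (val (D _)) => w; rewrite (model_norm0 p1 M) scale0r.
Qed.

Lemma homog_extD u v : K u -> K v -> homog_ext (u + v) = homog_ext u + homog_ext v.
Proof.
move=> Ku Kv.
have [->|[a [f [a0 uE]]]] := cone_sphere Ku; first by rewrite homog_ext0 !add0r.
have [->|[b [g [b0 vE]]]] := cone_sphere Kv; first by rewrite homog_ext0 !addr0.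
have [w0|[l [h [l0 wE]]]] := cone_sphere (model_coneD M Ku Kv).
  have u0 := model_cone_add0 M Ku Kv w0.
  by move: w0; rewrite u0 add0r => ->; rewrite homog_ext0 add0r.
rewrite wE uE vE !homog_extE ?ltW//.
by apply: sphere_map_add; rewrite ?ltW// -uE -vE.
Qed.

Lemma homog_extZ (l : R) u : 0 <= l -> K u -> homog_ext (l%:C *: u) = l%:C *: homog_ext u.
Proof.
move=> l0 Ku.
have [->|[a [f [a0 ->]]]] := cone_sphere Ku; first by rewrite scaler0 homog_ext0 scaler0.
rewrite scalerA -rmorphM /= homog_extE ?(mulr_ge0 l0 (ltW a0))//.
by rewrite homog_extE ?(ltW a0)// scalerA -rmorphM.
Qed.

Lemma homog_ext_cone u : K u -> onv_cone (homog_ext u) /\ onv_norm (homog_ext u) = onv_norm u.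
Proof.
move=> Ku.
have [->|[a [f [a0 ->]]]] := cone_sphere Ku.
  rewrite homog_ext0 !(model_norm0 p1 M, model_norm0 p1 N); split => //.
  by apply/(model_cone N); apply: filterS (model_0 N) => x ->.
have [Kf f1] := sphereP f; have [KDf Df1] := sphereP (D f).
rewrite homog_extE ?ltW//; split; first by apply: (model_coneZ N) => //; exact: ltW.
by rewrite (model_normZ p1 M) ?(model_normZ p1 N) ?ltW// f1 Df1.
Qed.

End ExtendOneSide.

Lemma normc_triangle (R : realType) (z w : R[i]) : normc (z + w) <= normc z + normc w.
Proof. by rewrite -lecR rmorphD; exact: (ler_normD z w). Qed.

Lemma rational_near (R : realType) (a e : R) : 0 < e -> exists q : rat, `|ratr q - a| < e.
Proof.
move=> e0; have [q] := @rat_in_itvoo R a (a + e) ltac:(by rewrite ltrDl).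
rewrite in_itv /= => /andP[q1 q2]; exists q.
by rewrite ger0_norm ?subr_ge0 ?ltW// ltrBlDl.
Qed.

(** The modulus of z is the supremum of Re (conj w z) / |w|, and it is enough to
    let w run over a countable dense set: this turns a bound on moduli into
    countably many bounds that can each hold almost everywhere. *)
Lemma normc_le_support (R : realType) (z : R[i]) (s : R) : 0 <= s ->
  (forall x y : rat, ratr x * Re z + ratr y * Im z <= normc (ratr x +i* ratr y) * s) ->
  normc z <= s.
Proof.
move=> s0 H; set t := normc z.
have t0 : 0 <= t by exact: normc_ge0.
have zt : (Re z) ^+ 2 + (Im z) ^+ 2 = t ^+ 2.
  by rewrite /t; case: (z) => a b /=; rewrite sqr_sqrtr// addr_ge0 ?sqr_ge0.
have [rt it] : `|Re z| <= t /\ `|Im z| <= t by rewrite normr_Re_le normr_Im_le.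
have key (e : R) : 0 < e -> t ^+ 2 <= t * s + e * (2 * t + 2 * s).
  move=> e0; have [x xe] := rational_near (Re z) e0; have [y ye] := rational_near (Im z) e0.
  have := H x y; set X := ratr x in xe *; set Y := ratr y in ye *.
  have n1 : normc (X +i* Y) <= t + (`|X - Re z| + `|Y - Im z|).
    have -> : X +i* Y = z + ((X - Re z) +i* (Y - Im z)).
      by case: (z) => a b /=; simpc; congr (_ +i* _); ring.
    by apply: le_trans (normc_triangle _ _) _; rewrite lerD2l normc_le_ReIm.
  have n2 : normc (X +i* Y) * s <= (t + 2 * e) * s.
    by rewrite ler_wpM2r// (le_trans n1)// lerD2l mulr2n mulrDl !mul1r lerD// ltW.
  have h1 : (Re z - X) * Re z <= e * t.
    apply: le_trans (ler_norm _) _; rewrite normrM distrC.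
    by apply: ler_pM => //; exact: ltW.
  have h2 : (Im z - Y) * Im z <= e * t.
    apply: le_trans (ler_norm _) _; rewrite normrM distrC.
    by apply: ler_pM => //; exact: ltW.
  nra.
rewrite leNgt; apply/negP => st.
have tp : 0 < t by exact: le_lt_trans st.
have [] : t * (t - s) <= 0 \/ 0 < t * (t - s) by case: ltP; [right|left].
  by apply/negP; rewrite -ltNge mulr_gt0// subr_gt0.
move=> ts0.
have c0 : 0 < 4 * t + 4 * s by lra.
have := key (t * (t - s) / (4 * t + 4 * s)) (divr_gt0 ts0 c0).
have -> : t * (t - s) / (4 * t + 4 * s) * (2 * t + 2 * s) = t * (t - s) / 2.
  by field; rewrite gt_eqF.
by rewrite expr2; lra.
Qed.

Section Domination.
Context (R : realType) (p : \bar R) (p1 : (1 <= p)%E).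
Context d (T : measurableType d) d' (T' : measurableType d').
Variables (mu : {measure set T -> \bar R}) (nu : {measure set T' -> \bar R}).
Variables (E F : ordNormed R) (ev : E -> T -> R[i]) (ew : F -> T' -> R[i]).
Hypotheses (M : Lp_model p mu ev) (N : Lp_model p nu ew).
Variables (Phi : E -> F).
Hypothesis Phi_lin : linear Phi.
Hypothesis Phi_cone : forall u, onv_cone u -> onv_cone (Phi u).
Hypothesis Phi_norm : forall u, onv_cone u -> onv_norm (Phi u) = onv_norm u.

Let PB u v : Phi (u - v) = Phi u - Phi v.
Proof. exact: (linear_sub Phi_lin). Qed.
Let PZ c u : Phi (c *: u) = c *: Phi u.
Proof. exact: (linear_scale Phi_lin). Qed.

(** Let v = |u|.  For every complex w, |w| v - Re (conj w u) is in the cone, hence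
    so is its image |w| (Phi v) - Re (conj w (Phi u)).  Letting w run over a dense
    set gives |Phi u| <= Phi v, and the norm of Phi v is that of v. *)
Lemma positive_contraction u : onv_norm (Phi u) <= onv_norm u.
Proof.
have [a [b [c [e [Ka Kb Kc Ke uE]]]]] := model_cone_gen p1 M u.
have [v [Kv vE vn]] := model_modulus p1 M u.
rewrite -vn -(Phi_norm Kv).
have decomp (S : ordNormed R) d0 (U : measurableType d0) (la : {measure set U -> \bar R})
   (es : S -> U -> R[i]) (MS : Lp_model p la es) (a0 b0 c0 e0 w : S) (x y s : R) :
   onv_cone a0 -> onv_cone b0 -> onv_cone c0 -> onv_cone e0 -> onv_cone w ->
   \forall t \ae la, es (s%:C *: w - (x%:C *: (a0 - b0) + y%:C *: (c0 - e0))) t =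
     (s * normc (es w t) - (x * Re (es (a0 - b0 + 'i *: (c0 - e0)) t) +
      y * Im (es (a0 - b0 + 'i *: (c0 - e0)) t)))%:C.
  move=> Ka0 Kb0 Kc0 Ke0 Kw.
  have real (f g : S) : onv_cone f -> onv_cone g -> \forall t \ae la,
      Im (es (f - g) t) = 0.
    move=> /(model_cone MS) Kf /(model_cone MS) Kg.
    apply: filterS3 (model_B MS f g) Kf Kg => t ->.
    rewrite !lecE /= => /andP[/eqP + _] /andP[/eqP + _].
    by case: (es f t) (es g t) => ? ? [? ?] /= -> ->; rewrite subrr.
  have AB := real _ _ Ka0 Kb0; have CE := real _ _ Kc0 Ke0.
  set A := a0 - b0 in AB *; set C := c0 - e0 in CE *.
  have h1 : \forall t \ae la, es (A + 'i *: C) t = es A t + 'i * es C t.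
    by apply: filterS2 (model_D MS A ('i *: C)) (model_Z MS 'i C) => t -> ->.
  have h2 : \forall t \ae la, es (x%:C *: A + y%:C *: C) t = x%:C * es A t + y%:C * es C t.
    by apply: filterS2 (model_lin MS x%:C A (y%:C *: C)) (model_Z MS y%:C C) => t -> ->.
  have h3 : \forall t \ae la, es (s%:C *: w) t = (s * normc (es w t))%:C.
    apply: filterS2 (model_Z MS s%:C w) (model_cone_real MS Kw) => t -> {1}->.
    by rewrite rmorphM.
  have h4 := model_B MS (s%:C *: w) (x%:C *: A + y%:C *: C).
  have h5 : \forall t \ae la, Im (es A t) = 0 /\ Im (es C t) = 0 by apply: filterS2 AB CE.
  have h6 : \forall t \ae la,
     es (s%:C *: w - (x%:C *: A + y%:C *: C)) t =
     (s * normc (es w t))%:C - (x%:C * es A t + y%:C * es C t).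
    by apply: filterS3 h4 h3 h2 => t -> -> ->.
  apply: filterS3 h6 h1 h5 => t -> ->.
  by case: (es A t) (es C t) => a1 a2 [c1 c2] /= [-> ->]; simpc; congr (_ +i* _); ring.
apply: (model_le_norm p1 N).
have dom (x y : R) : \forall t \ae nu, x * Re (ew (Phi u) t) + y * Im (ew (Phi u) t) <=
    normc (x +i* y) * normc (ew (Phi v) t).
  set s := normc _.
  have Kd : onv_cone (s%:C *: v - (x%:C *: (a - b) + y%:C *: (c - e))).
    apply/(model_cone M).
    have := decomp _ _ _ _ _ M a b c e v x y s Ka Kb Kc Ke Kv; rewrite -uE => H.
    apply: filterS2 H vE => t -> ->; rewrite ler0c subr_ge0 normc_real.
    rewrite (ger0_norm (normc_ge0 _)) /s.
    rewrite -ComplexField.Normc.normcM.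
    have -> : x * Re (ev u t) + y * Im (ev u t) = Re ((x -i* y) * ev u t).
      by case: (ev u t) => ? ? /=; ring.
    apply: le_trans (ler_norm _) _; apply: le_trans (normr_Re_le _) _.
    by rewrite !ComplexField.Normc.normcM /= sqrrN.
  move/Phi_cone: Kd => /(model_cone N); rewrite PB PZ Phi_lin PZ !PB.
  have Kp := (Phi_cone Ka, Phi_cone Kb, Phi_cone Kc, Phi_cone Ke).
  have := decomp _ _ _ _ _ N (Phi a) (Phi b) (Phi c) (Phi e) (Phi v) x y s
     Kp.1.1.1 Kp.1.1.2 Kp.1.2 Kp.2 (Phi_cone Kv).
  have -> : Phi a - Phi b + 'i *: (Phi c - Phi e) = Phi u.
    by rewrite uE addrC -!PB -Phi_lin addrC.
  by apply: filterS2 => t ->; rewrite ler0c subr_ge0.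
pose q n : rat * rat := odflt (0, 0) (unpickle n : option (rat * rat)).
have := ae_foralln (fun n => dom (ratr (q n).1) (ratr (q n).2)).
apply: filterS => t H; apply: normc_le_support; first exact: normc_ge0.
by move=> x y; have := H (pickle (x, y)); rewrite /q pickleK.
Qed.

End Domination.

Section LinearOnSphere.
Context (R : realType) (p : \bar R) (p1 : (1 <= p)%E) d (T : measurableType d).
Variables (mu : {measure set T -> \bar R}) (E : ordNormed R) (ev : E -> T -> R[i]).
Hypothesis M : Lp_model p mu ev.

Lemma linear_eq_on_sphere (G : lmodType R[i]) (Phi Psi : E -> G) : linear Phi -> linear Psi ->
  (forall f : positive_sphere E, Phi (val f) = Psi (val f)) -> Phi = Psi.
Proof.
move=> lP lQ H; apply: (cone_linear_eq (model_cone_gen p1 M) lP lQ) => a Ka.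
have [->|[l [f [_ ->]]]] := cone_sphere p1 M Ka.
  by rewrite (linear_zero lP) (linear_zero lQ).
by rewrite (linear_scale lP) (linear_scale lQ) H.
Qed.

End LinearOnSphere.

Section Extension.
Context (R : realType) (p : \bar R) (p1 : (1 <= p)%E).
Context d (T : measurableType d) d' (T' : measurableType d').
Variables (mu : {measure set T -> \bar R}) (nu : {measure set T' -> \bar R}).
Hypotheses (mufin : (mu setT < +oo)%E) (nufin : (nu setT < +oo)%E).
Variables (E F : ordNormed R) (ev : E -> T -> R[i]) (ew : F -> T' -> R[i]).
Hypotheses (M : Lp_model p mu ev) (N : Lp_model p nu ew).
Variables (D : positive_sphere E -> positive_sphere F).
Hypothesis D_surj : forall g, exists f, D f = g.
Hypothesis iso : forall f g,
  onv_norm (val (D f) - val (D g)) = onv_norm (val f - val g).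

Lemma sphere_isometry_inj : injective D.
Proof.
move=> f g fg; apply: val_inj; apply/eqP; rewrite -subr_eq0; apply/eqP.
by apply: (model_norm_eq0 p1 M); rewrite -iso fg subrr (model_norm0 p1 N).
Qed.

(** The extensions of D and of its inverse are mutually inverse contractions,
    hence isometries. *)
Theorem sphere_isometry_extends : exists Phi : E -> F,
  [/\ isometric_order_iso Phi & forall f : positive_sphere E, Phi (val f) = val (D f)].
Proof.
pose D' g := projT1 (cid (D_surj g)).
have D'K : cancel D' D by move=> g; rewrite /D'; case: cid.
have DK : cancel D D' by move=> f; apply: sphere_isometry_inj; rewrite D'K.
have iso' f g : onv_norm (val (D' f) - val (D' g)) = onv_norm (val f - val g).
  by rewrite -iso !D'K.
have [Phi [Pl PE]] := @cone_extension R E F (@onv_cone R E) (model_coneD M)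
  (model_coneZ M) (model_cone_gen p1 M) (model_cone_ind M) (homog_ext D)
  (homog_extD p1 mufin nufin M N DK D'K iso)
  (fun l u => @homog_extZ R p p1 _ _ mu E F ev M D l u).
have [Psi [Ql QE]] := @cone_extension R F E (@onv_cone R F) (model_coneD N)
  (model_coneZ N) (model_cone_gen p1 N) (model_cone_ind N) (homog_ext D')
  (homog_extD p1 nufin mufin N M D'K DK iso')
  (fun l u => @homog_extZ R p p1 _ _ nu F E ew N D' l u).
have PD (f : positive_sphere E) : Phi (val f) = val (D f).
  have [Kf _] := sphereP f.
  rewrite PE// -[val f]scale1r -[1]/(1%:C) (homog_extE p1 M) ?ler01//.
  by rewrite scale1r.
have QD (f : positive_sphere F) : Psi (val f) = val (D' f).
  have [Kf _] := sphereP f.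
  rewrite QE// -[val f]scale1r -[1]/(1%:C) (homog_extE p1 N) ?ler01//.
  by rewrite scale1r.
have PB u v : Phi (u - v) = Phi u - Phi v.
  exact: (linear_sub Pl).
have PK u : onv_cone u -> onv_cone (Phi u).
  by move=> Ku; rewrite PE//; have [] := homog_ext_cone p1 M N D Ku.
have QK u : onv_cone u -> onv_cone (Psi u).
  by move=> Ku; rewrite QE//; have [] := homog_ext_cone p1 N M D' Ku.
have Pn u : onv_cone u -> onv_norm (Phi u) = onv_norm u.
  by move=> Ku; rewrite PE//; have [] := homog_ext_cone p1 M N D Ku.
have Qn u : onv_cone u -> onv_norm (Psi u) = onv_norm u.
  by move=> Ku; rewrite QE//; have [] := homog_ext_cone p1 N M D' Ku.
have QP : Psi \o Phi = id.
  apply: (linear_eq_on_sphere p1 M) => [c u v|//|f /=]; first by rewrite /= Pl Ql.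
  by rewrite PD QD DK.
have PQ : Phi \o Psi = id.
  apply: (linear_eq_on_sphere p1 N) => [c u v|//|f /=]; first by rewrite /= Ql Pl.
  by rewrite QD PD D'K.
have {}QP u : Psi (Phi u) = u by rewrite -[LHS]/((Psi \o Phi) u) QP.
have {}PQ u : Phi (Psi u) = u by rewrite -[LHS]/((Phi \o Psi) u) PQ.
exists Phi; split => //; split => //.
- by move=> v; exists (Psi v).
- move=> u v; rewrite -PB; apply/eqP; rewrite eq_le (positive_contraction p1 M N Pl PK Pn).
  by rewrite -{1}(QP (u - v)) (positive_contraction p1 N M Ql QK Qn).
- apply/seteqP; split=> [_ [u Ku <-]|v Kv]; first exact: PK.
  by exists (Psi v); [exact: QK|exact: PQ].
- apply/seteqP; split=> [u Ku|u Ku]; last exact: PK.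
  by rewrite -(QP u); exact: QK.
Qed.

End Extension.

(** * Primitives and integration by parts *)

Section Primitive.
Context (R : realType).
Notation leb := (@lebesgue_measure R).

Definition primitive (w : R -> R) (x : R) : R := \int[leb]_(t in `]-oo, x]) w t.

Variable w : R -> R.
Hypothesis iw : leb.-integrable setT (EFin \o w).

Lemma integrable_sub (A : set R) : measurable A -> leb.-integrable A (EFin \o w).
Proof. by move=> mA; apply: integrableS iw. Qed.

Lemma primitiveB x y : x <= y ->
  primitive w y - primitive w x = \int[leb]_(t in `]x, y]) w t.
Proof.
by move=> xy; rewrite /primitive Rintegral_itvB// ?bnd_simp//; exact: integrable_sub.
Qed.

Lemma primitiveB_cc x y : x <= y ->
  primitive w y - primitive w x = \int[leb]_(t in `[x, y]) w t.
Proof.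
by move=> xy; rewrite primitiveB// Rintegral_itv_obnd_cbnd//; exact: integrable_sub.
Qed.

Lemma primitiveB_oo x y : x <= y ->
  primitive w y - primitive w x = \int[leb]_(t in `]x, y[) w t.
Proof.
by move=> xy; rewrite primitiveB// -Rintegral_itv_bndo_bndc//; exact: integrable_sub.
Qed.

Lemma primitive_abs_continuous (e : R) : 0 < e -> exists2 d : R, 0 < d &
  forall n (l r : 'I_n -> R), (forall i, l i <= r i) ->
    trivIset setT (fun i => `]l i, r i[%classic) ->
    \sum_(i < n) (r i - l i) < d ->
    \sum_(i < n) `|primitive w (r i) - primitive w (l i)| < e.
Proof.
move=> e0; have [d [d0 dP]] := integral_normr_continuous iw e0.
exists d => // n l r lr tI sd.
pose A i : set R := `]l i, r i[%classic.
have mA i : measurable (A i) by exact: measurable_itv.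
pose B := \big[setU/set0]_(i < n) A i.
have mB : measurable B by apply: bigsetU_measurable.
have muB : (leb B < d%:E)%E.
  rewrite /B measure_bigsetU_ord//.
  rewrite (eq_bigr (fun i => (r i - l i)%:E)); first by rewrite sumEFin lte_fin.
  move=> i _; rewrite [LHS]lebesgue_measure_itv/= lte_fin.
  case: ltP => [_|]; first by rewrite EFinD EFinN.
  by move=> rl; have -> : r i = l i by [apply/eqP; rewrite eq_le rl lr]; rewrite subrr.
apply: le_lt_trans (dP _ mB muB).
have inw A' : measurable A' -> leb.-integrable A' (EFin \o (fun x => `|w x|)).
  by move=> mA'; have /integrable_abse := integrable_sub mA'.
have -> : \int[leb]_(x in B) `|w x| = \sum_(i < n) \int[leb]_(x in A i) `|w x|.
  rewrite /Rintegral /B ge0_integral_bigsetU//=.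
  - rewrite sum_fine//= => i _; apply: integrable_fin_num => //.
      exact: mA.
    exact: (inw _ (mA i)).
  - exact: index_enum_uniq.
  - exact: sub_trivIset tI.
  - exact: measurable_int (inw _ mB).
apply: ler_sum => i _; rewrite primitiveB_oo//.
by apply: le_normr_Rintegral => //; exact: integrable_sub.
Qed.

Lemma primitive_continuous : continuous (primitive w).
Proof.
move=> x; apply/cvgrPdist_lt => e e0.
have [d d0 dP] := primitive_abs_continuous e0.
near=> y.
have xyd : `|x - y| < d by near: y; apply: cvgr_dist_lt.
have [xy|/ltW yx] := leP x y.
  have := dP 1%N (fun=> x) (fun=> y) (fun=> xy).
  rewrite !big_ord1 distrC; apply; last by rewrite distrC ger0_norm ?subr_ge0 in xyd.
  by move=> i j _ _ _; rewrite !ord1.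
have := dP 1%N (fun=> y) (fun=> x) (fun=> yx).
rewrite !big_ord1; apply; last by rewrite ger0_norm ?subr_ge0 in xyd.
by move=> i j _ _ _; rewrite !ord1.
Unshelve. all: by end_near. Qed.

Lemma primitive_derivative : {ae leb, forall x, derivable (primitive w) x 1 /\
  derive1 (primitive w) x = w x}.
Proof.
apply: FTC1Ny; first by move=> y; exact: integrable_sub.
by apply: open_integrable_locally => //; exact: openT.
Qed.

End Primitive.

Section ByParts.
Context (R : realType).
Notation leb := (@lebesgue_measure R).
Variable w : R -> R.
Hypothesis iw : leb.-integrable setT (EFin \o w).
Variables (F F' : R -> R).
Hypothesis dF : forall x : R, is_derive x (1 : R) F (F' x).
Hypothesis cF' : continuous F'.

Let cF : continuous F.
Proof.
by move=> x; apply/differentiable_continuous/derivable1_diffP; case: (dF x).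
Qed.

Lemma continuous_integrable_itv (f : R -> R) c d : continuous f ->
  leb.-integrable `[c, d] (EFin \o f).
Proof.
move=> cf; apply: continuous_compact_integrable; first exact: segment_compact.
exact: continuous_subspaceT.
Qed.

Lemma continuous_bounded_itv (f : R -> R) c d : continuous f ->
  [bounded f x | x in `[c, d]].
Proof.
move=> cf; have := @continuous_compact _ _ f `[c, d] _ (@segment_compact R c d).
move=> /(_ (continuous_subspaceT cf)) /compact_bounded[M [_ mrt]].
by exists M; split; rewrite ?num_real // => ? ? ? ?; exact: mrt.
Qed.

Lemma FTC2_cc c d : c <= d -> \int[leb]_(x in `[c, d]) F' x = F d - F c.
Proof.
rewrite le_eqVlt => /predU1P[->|cd].
  by rewrite set_itv1 Rintegral_set1 subrr.
rewrite /Rintegral (@continuous_FTC2 _ F' F)//.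
- exact: continuous_subspaceT.
- split.
  + by move=> x _; case: (dF x).
  + by apply: cvg_at_right_filter; exact: cF.
  + by apply: cvg_at_left_filter; exact: cF.
by move=> x _; rewrite derive1E; apply: (derive_val (is_derive:=dF x)).
Qed.

Lemma continuous_mul_integrable (f : R -> R) c d : continuous f ->
  leb.-integrable `[c, d] (EFin \o (fun x => f x * w x)).
Proof.
move=> cf; rewrite (_ : _ \o _ = ((EFin \o f) \* (EFin \o w))%E)//.
apply: integrableMr => //; last exact: integrable_sub.
  by apply: measurable_funTS; exact: continuous_measurable_fun.
exact: continuous_bounded_itv.
Qed.

(** Both sides are the integral of F'(x) w(y) over c <= y <= x <= d. *)
Lemma primitive_Fubini c d : c <= d ->
  \int[leb]_(x in `[c, d]) (F' x * (primitive w x - primitive w c)) =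
  \int[leb]_(t in `[c, d]) ((F d - F t) * w t).
Proof.
move=> cd.
pose I : R -> R := \1_`[c, d].
pose g (z : R * R) : R := (F' z.1 * I z.1) * (w z.2 * I z.2) * \1_[set z | z.2 <= z.1] z.
pose A x := F' x * I x; pose B t := w t * I t.
have mI : measurable_fun setT I by exact: measurable_indic.
have mw : measurable_fun setT w by apply/measurable_EFinP; exact: (measurable_int leb iw).
have mA : measurable_fun setT A.
  by apply: measurable_funM => //; exact: continuous_measurable_fun.
have mB : measurable_fun setT B by apply: measurable_funM.
have mg : measurable_fun setT g.
  apply: measurable_funM; first apply: measurable_funM.
  - exact: (measurableT_comp mA measurable_fst).
  - exact: (measurableT_comp mB measurable_snd).
  apply: measurable_indic.
  rewrite (_ : [set z | _] = (fun z : R * R => z.2 <= z.1) @^-1` [set true]).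
    rewrite -[X in measurable X]setTI.
    by apply: (measurable_fun_ler measurable_snd measurable_fst).
  by apply/seteqP; split.
have cutE (f : R -> R) : (EFin \o f) \_ `[c, d] = EFin \o (fun x => f x * I x).
  apply/funext => x; rewrite /I patchE /= indicE.
  by case: (_ \in _); rewrite /= ?mulr1 ?mulr0.
have cut (f : R -> R) : leb.-integrable `[c, d] (EFin \o f) ->
    leb.-integrable setT (EFin \o (fun x => f x * I x)).
  move=> fi; rewrite -cutE; apply: (iffLR (integrable_mkcond _ _)) fi.
  exact: measurable_itv.
have iA : leb.-integrable setT (EFin \o A) by apply: cut; exact: continuous_integrable_itv.
have iB : leb.-integrable setT (EFin \o B) by apply: cut; exact: integrable_sub.
have mF (f : R * R -> \bar R) : measurable_fun setT f -> (forall z, 0 <= f z)%E ->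
    measurable_fun setT (fun x => \int[leb]_y f (x, y))%E.
  by move=> mf f0; exact: (@measurable_fun_fubini_tonelli_F _ _ _ _ R leb f mf f0).
have ig : (leb \x leb)%E.-integrable setT (EFin \o g).
  apply/integrable12ltyP; first exact/measurable_EFinP.
  apply: (@le_lt_trans _ _ (\int[leb]_x \int[leb]_y (`|A x|%:E * `|B y|%:E)))%E.
    apply: ge0_le_integral => //.
    - by move=> x _; apply: integral_ge0.
    - apply: (mF (fun z => `|(EFin \o g) z|)%E) => //.
      by apply: measurableT_comp => //; exact/measurable_EFinP.
    - apply: (mF (fun z => `|A z.1|%:E * `|B z.2|%:E)%E); last first.
        by move=> z; rewrite mule_ge0// lee_fin.
      apply: emeasurable_funM; apply/measurable_EFinP.
        by apply: measurableT_comp => //; exact: (measurableT_comp mA measurable_fst).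
      by apply: measurableT_comp => //; exact: (measurableT_comp mB measurable_snd).
    move=> x _; apply: ge0_le_integral => //.
    - apply: measurableT_comp => //; apply/measurable_EFinP.
      exact: (measurableT_comp mg (measurable_pair1 x)).
    - apply: measurable_funeM; apply/measurable_EFinP; exact: measurableT_comp.
    move=> y _; rewrite /= /g -EFinM lee_fin normrM -/(A x) -/(B y) normrM.
    by rewrite ler_piMr// indicE; case: (_ \in _); rewrite /= ?normr1 ?normr0.
  have mnB : measurable_fun setT (fun y => `|B y|%:E : \bar R).
    by apply/measurable_EFinP; exact: measurableT_comp.
  have mnA : measurable_fun setT (fun y => `|A y|%:E : \bar R).
    by apply/measurable_EFinP; exact: measurableT_comp.
  have E x : (\int[leb]_y (`|A x|%:E * `|B y|%:E) = `|A x|%:E * \int[leb]_y `|B y|%:E)%E.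
    by apply: ge0_integralZl_EFin => // y _; rewrite lee_fin.
  under eq_integral do rewrite E.
  rewrite ge0_integralZr//; last exact: integral_ge0.
  apply: lte_mul_pinfty; first exact: integral_ge0.
    by apply: integrable_fin_num => //; have /integrable_abse := iA.
  by have /integrableP[] := iB.
have := Fubini ig.
have -> : (\int[leb]_x \int[leb]_y (EFin \o g) (x, y) =
    \int[leb]_(x in `[c, d]) (F' x * (primitive w x - primitive w c))%:E)%E.
  rewrite [RHS]integral_mkcond; apply: eq_integral => x _.
  rewrite patchE; case: ifPn => [|xcd]; last first.
    apply: integral0_eq => y _; rewrite /= /g /I indicE (negbTE xcd).
    by rewrite mulr0 !mul0r.
  rewrite inE /= in_itv /= => /andP[cx xd].
  rewrite primitiveB_cc// EFinM /Rintegral fineK; last first.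
    by apply: integrable_fin_num => //; exact: integrable_sub.
  rewrite -integralZl//; last exact: integrable_sub.
  rewrite [RHS]integral_mkcond; apply: eq_integral => y _.
  rewrite patchE /= /g /= /I !indicE.
  have -> : (x \in `[c, d]%classic) = true by apply: mem_set; rewrite /= in_itv /= cx xd.
  case: ifPn; rewrite ?inE /= ?notin_setE /= in_itv /=.
    move=> /andP[cy yx]; rewrite !mem_set//= ?in_itv /= ?cy ?(le_trans yx xd)//.
    by rewrite !mulr1 EFinM.
  move=> nyx; have [yx|yx] := boolP (y <= x).
    rewrite (@memNset _ `[c, d]%classic y); first by rewrite !mulr0 mul0r.
    by rewrite /= in_itv/= => /andP[cy _]; apply: nyx; rewrite cy.
  by rewrite (@memNset _ [set z | z.2 <= z.1] (x, y)) ?mulr0//=; exact/negP.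
have -> : (\int[leb]_y \int[leb]_x (EFin \o g) (x, y) =
    \int[leb]_(t in `[c, d]) ((F d - F t) * w t)%:E)%E.
  rewrite [RHS]integral_mkcond; apply: eq_integral => y _.
  rewrite patchE; case: ifPn => [|xcd]; last first.
    apply: integral0_eq => x _; rewrite /= /g /I !indicE /= (negbTE xcd).
    by rewrite !mulr0 !mul0r.
  rewrite inE /= in_itv /= => /andP[cy yd].
  rewrite -FTC2_cc// mulrC EFinM /Rintegral fineK; last first.
    by apply: integrable_fin_num => //; exact: continuous_integrable_itv.
  rewrite -integralZl//; last exact: continuous_integrable_itv.
  rewrite [RHS]integral_mkcond; apply: eq_integral => x _.
  rewrite patchE /= /g /= /I !indicE.
  have -> : (y \in `[c, d]%classic) = true by apply: mem_set; rewrite /= in_itv /= cy yd.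
  case: ifPn; rewrite ?inE /= ?notin_setE /= in_itv /=.
    move=> /andP[yx xd]; rewrite !mem_set//= ?in_itv /= ?xd ?(le_trans cy yx)//.
    by rewrite !mulr1 mulrC EFinM.
  move=> nyx; have [yx|yx] := boolP (y <= x).
    rewrite (@memNset _ `[c, d]%classic x); first by rewrite !mulr0 !mul0r.
    by rewrite /= in_itv/= => /andP[_ xd]; apply: nyx; rewrite yx.
  by rewrite (@memNset _ [set z | z.2 <= z.1] (x, y)) ?mulr0//=; exact/negP.
by rewrite /Rintegral => ->.
Qed.

Lemma primitive_by_parts c d : c <= d ->
  \int[leb]_(x in `[c, d]) (F' x * primitive w x) =
  F d * primitive w d - F c * primitive w c - \int[leb]_(x in `[c, d]) (F x * w x).
Proof.
move=> cd; have := primitive_Fubini cd.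
have cW := primitive_continuous iw.
have iFW : leb.-integrable `[c, d] (EFin \o (fun x => F' x * primitive w x)).
  by apply: continuous_integrable_itv => x; apply: cvgM; [exact: cF'|exact: cW].
have iF : leb.-integrable `[c, d] (EFin \o F') by exact: continuous_integrable_itv.
have iFw : leb.-integrable `[c, d] (EFin \o (fun x => F x * w x)) by exact: continuous_mul_integrable.
have iww : leb.-integrable `[c, d] (EFin \o w) by exact: integrable_sub.
have -> : \int[leb]_(x in `[c, d]) (F' x * (primitive w x - primitive w c)) =
    \int[leb]_(x in `[c, d]) (F' x * primitive w x) - primitive w c * (F d - F c).
  rewrite -(FTC2_cc cd) -RintegralZl// -RintegralB//.
    by apply: eq_Rintegral => x _; ring.
  exact: (integrableZl _ (primitive w c) iF).
have -> : \int[leb]_(t in `[c, d]) ((F d - F t) * w t) =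
    F d * (primitive w d - primitive w c) - \int[leb]_(x in `[c, d]) (F x * w x).
  rewrite primitiveB_cc// -RintegralZl// -RintegralB//.
    by apply: eq_Rintegral => x _; ring.
  exact: (integrableZl _ (F d) iww).
lra.
Qed.

End ByParts.

(** * Bump functions *)

Section Bump.
Context (R : realType).
Variables (c d s : R).
Hypothesis s0 : 0 < s.

Let q (x : R) : R := (x - c) * (d - x).

(** The family P(x) / q(x)^m exp (- 1 / (s q(x))), extended by 0 where q <= 0, is
    stable under derivation; this reduces smoothness to a single derivative. *)
Definition bump (P : {poly R}) (m : nat) (x : R) : R :=
  if 0 < q x then P.[x] / q x ^+ m * expR (- (s * q x)^-1) else 0.

Definition bump_quad : {poly R} := ('X - c%:P) * (d%:P - 'X).

Definition bump_step (P : {poly R}) (m : nat) : {poly R} :=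
  P^`() * bump_quad ^+ 2 - m%:R *: (P * bump_quad^`() * bump_quad) +
  s^-1 *: (P * bump_quad^`()).

Let qE x : bump_quad.[x] = q x.
Proof. by rewrite /bump_quad !hornerE. Qed.

Let is_derive_q x : is_derive x (1 : R) q (bump_quad^`()).[x].
Proof.
rewrite (_ : q = horner bump_quad); first exact: is_derive_poly.
by apply/funext => y; rewrite qE.
Qed.

Lemma bump_derive_inside P m (x : R) : 0 < q x ->
  is_derive x (1 : R) (bump P m) (bump (bump_step P m) m.+2 x).
Proof.
move=> qx.
have qN0 : q x != 0 by rewrite gt_eqF.
have dq := is_derive_q x.
have [Q QE] : exists Q, Q = bump_quad by exists bump_quad.
have Qx : Q.[x] = q x by rewrite QE qE.
rewrite /bump_step -QE; rewrite -QE in dq; set dq' := (_^`()).[x] in dq.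
have dP := is_derive_poly P x.
have qc : {for x, continuous q}.
  by apply/differentiable_continuous/derivable1_diffP; case: dq.
have H : is_derive x (1 : R) (fun y => P.[y] * (q y ^+ m)^-1 * expR (- (s * q y)^-1))
   (bump (P^`() * Q ^+ 2 - m%:R *: (P * Q^`() * Q) + s^-1 *: (P * Q^`())) m.+2 x).
  pose v : R -> R := fun y => (q y)^-1.
  have dv : is_derive x (1 : R) v (- (q x ^- 2) * dq').
    exact: is_deriveV.
  have dw : is_derive x (1 : R) (expR \o (- s^-1 \*: v))
      (expR (- s^-1 * v x) * (- s^-1 * (- (q x ^- 2) * dq'))).
    by apply: is_derive1_comp; exact: is_deriveZ.
  have dm := is_deriveX m dv.
  have d1 := is_deriveM (is_deriveM dP dm) dw.
  have -> : (fun y => P.[y] * (q y ^+ m)^-1 * expR (- (s * q y)^-1)) =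
      horner P * v ^+ m * (expR \o (- s^-1 \*: v)).
    apply/funext => y.
    have -> : - (s * q y)^-1 = - s^-1 * (q y)^-1 by rewrite invfM mulNr.
    by rewrite !fctE /v /= exprVn.
  apply: is_derive_eq d1 _.
  rewrite /bump qx !hornerE -/dq' Qx /= !fctE.
  have -> : - (s * (x - c) * (d - x))^-1 = - s^-1 * (q x)^-1.
    by rewrite -mulrA invfM mulNr.
  rewrite /v /GRing.scale /=; set e := expR _.
  have sN0 : s != 0 by rewrite gt_eqF.
  move: (q x) qN0 => t tN0; move: (P.[x]) (P^`().[x]) => a b.
  case: (m) => [|n] /=.
    by rewrite !expr0 !mulr0n; field; rewrite ?tN0 ?sN0.
  rewrite !exprS !exprVn; move: (t ^+ n) (expf_neq0 n tN0) => u uN0.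
  by field; rewrite ?tN0 ?sN0 ?uN0.
have E : \near x, P.[x] * (q x ^+ m)^-1 * expR (- (s * q x)^-1) = bump P m x.
  have := qc; move=> /cvgrPdist_lt /(_ _ qx); apply: filterS => y.
  by rewrite ltr_distlC subrr => /andP[qy _]; rewrite /bump qy.
apply: near_eq_is_derive H; exact: filterS E.
Qed.

(** From exp (- 1 / y) <= (m + 2)! y^(m+2), the bump is O(q^2), and q(x) is at most
    a multiple of |x - x0| when q(x0) <= 0. *)
Lemma bump_bound P m x0 : q x0 <= 0 -> exists2 K : R, 0 <= K &
  forall x, `|x - x0| <= 1 -> `|bump P m x| <= K * `|x - x0| ^+ 2.
Proof.
move=> qx0.
have [B [B0 BP]] : exists B, 0 <= B /\ forall x, `|x - x0| <= 1 -> `|P.[x]| <= B.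
  have := @continuous_bounded_itv _ (horner P) (x0 - 1) (x0 + 1) (@continuous_horner _ P).
  move=> [M [_ HM]]; exists (`|M| + 1); split; first by rewrite addr_ge0.
  move=> x xx0; apply: (HM (`|M| + 1)); first by rewrite (le_lt_trans (ler_norm M))// ltrDl.
  by rewrite /= in_itv /=; move: xx0; rewrite ler_norml => /andP[]; lra.
pose L := `|c| + `|d| + 2 * `|x0| + 1.
have L0 : 0 <= L by rewrite /L !addr_ge0// mulr_ge0.
pose C := (m.+2)`!%:R * s ^+ m.+2.
have C0 : 0 <= C by rewrite /C mulr_ge0// exprn_ge0// ltW.
exists (B * C * L ^+ 2); first exact: mulr_ge0 (mulr_ge0 B0 C0) (exprn_ge0 _ L0).
move=> x xx0; rewrite /bump; case: ifPn => qx; last first.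
  by rewrite normr0; exact: mulr_ge0 (mulr_ge0 (mulr_ge0 B0 C0) (exprn_ge0 _ L0))
    (exprn_ge0 _ (normr_ge0 _)).
have qL : q x <= L * `|x - x0|.
  apply: (@le_trans _ _ (q x - q x0)); first by rewrite lerBrDl; lra.
  apply: le_trans (ler_norm _) _.
  have -> : q x - q x0 = (c + d - 2 * x0 - (x - x0)) * (x - x0) by rewrite /q; ring.
  rewrite normrM ler_wpM2r//.
  apply: le_trans (ler_normB _ _) _; rewrite /L lerD//.
  apply: le_trans (ler_normB _ _) _; rewrite normrM ger0_norm// lerD2r.
  exact: ler_normD.
have sq : 0 < s * q x by rewrite mulr_gt0.
have ex : expR (- (s * q x)^-1) <= (m.+2)`!%:R * (s * q x) ^+ m.+2.
  have N0 : 0 < (m.+2)`!%:R :> R by rewrite ltr0n fact_gt0.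
  move: (s * q x) sq => y y0.
  have yi : 0 <= y^-1 by rewrite invr_ge0 ltW.
  have zk : 0 < y^-1 ^+ m.+2 / (m.+2)`!%:R by rewrite divr_gt0// exprn_gt0// invr_gt0.
  have -> : (m.+2)`!%:R * y ^+ m.+2 = (y^-1 ^+ m.+2 / (m.+2)`!%:R)^-1.
    by rewrite invf_div exprVn invrK.
  rewrite expRN lef_pV2 ?posrE ?expR_gt0//.
  by apply: le_trans (expR_ge1Dxn m.+1 yi); rewrite lerDr.
rewrite !normrM (ger0_norm (expR_ge0 _)) normfV (ger0_norm (exprn_ge0 m (ltW qx))).
have qm : 0 < q x ^+ m by rewrite exprn_gt0.
apply: (@le_trans _ _ (B / q x ^+ m * ((m.+2)`!%:R * (s * q x) ^+ m.+2))).
  apply: ler_pM => //; first by rewrite mulr_ge0// invr_ge0 ltW.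
  by rewrite ler_wpM2r ?invr_ge0 ?(ltW qm)// BP.
have -> : B / q x ^+ m * ((m.+2)`!%:R * (s * q x) ^+ m.+2) = B * C * q x ^+ 2.
  have -> : (s * q x) ^+ m.+2 = s ^+ m.+2 * (q x ^+ m * q x ^+ 2).
    by rewrite -exprD addn2; exact: exprMn.
  rewrite /C; move: (q x ^+ m) qm => u u0; field.
  by rewrite gt_eqF.
rewrite -[leRHS]mulrA; apply: ler_wpM2l; first exact: mulr_ge0.
rewrite -exprMn; apply: lerXn2r; rewrite ?nnegrE ?(ltW qx)//.
exact: mulr_ge0.
Qed.

Lemma bump_derive_outside P m (x : R) : q x <= 0 ->
  is_derive x (1 : R) (bump P m) 0.
Proof.
move=> qx; have [K K0 HK] := bump_bound P m qx.
have bx : bump P m x = 0 by rewrite /bump ltNge qx.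
have H : h^-1 *: (bump P m (h *: (1 : R) + x) - bump P m x) @[h --> (0 : R)^'] --> (0 : R).
  apply/cvgrPdist_le => e e0.  have K1 : 0 < K + 1 by rewrite ltr_pwDr.
  near=> h;
  have hN0 : h != 0 by near: h; exact: nbhs_dnbhs_neq.
  rewrite sub0r normrN bx subr0 normrM normfV.
  have hp : 0 < `|h| by rewrite normr_gt0.
  rewrite ler_pdivrMl// [h *: _]mulr1.
  have h1 : `|h| <= 1 by near: h; exact: dnbhs0_le.
  have he : `|h| <= e / (K + 1) by near: h; apply: dnbhs0_le; rewrite divr_gt0.
  have := HK (h + x); rewrite addrK => /(_ h1) /le_trans; apply.
  rewrite expr2 mulrCA ler_wpM2l//.
  have := ler_wpM2l (ltW K1) he; rewrite mulrCA mulfV ?mulr1 ?gt_eqF//.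
  by apply: le_trans; rewrite ler_wpM2r// lerDl.
apply: DeriveDef; last exact/cvg_lim.
by apply/cvg_ex; exists 0.
Unshelve. all: by end_near. Qed.

Lemma bump_is_derive P m (x : R) :
  is_derive x (1 : R) (bump P m) (bump (bump_step P m) m.+2 x).
Proof.
have [qx|qx] := ltP 0 (q x); first exact: bump_derive_inside.
by rewrite {2}/bump ltNge qx /=; exact: bump_derive_outside.
Qed.

End Bump.

(** * Test functions and the du Bois-Reymond lemma *)

Section Smooth.
Context (R : realType).
Notation leb := (@lebesgue_measure R).
Implicit Types f g phi : R -> R.

Lemma closure_sub_closed (T : topologicalType) (A F : set T) :
  closed F -> A `<=` F -> closure A `<=` F.
Proof. by move=> cF /closure_subset; rewrite -(proj1 (closure_id F) cF). Qed.

Lemma is_derive_derive1 f (f' : R -> R) : (forall x : R, is_derive x (1 : R) f (f' x)) ->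
  derive1 f = f'.
Proof. by move=> H; apply/funext => x; rewrite derive1E; case: (H x). Qed.

Lemma bump_derive1n c d s (s0 : 0 < s) n (P : {poly R}) m :
  exists P' m', derive1n n (bump c d s P m) = bump c d s P' m'.
Proof.
elim: n P m => [|n IH] P m; first by exists P, m.
by rewrite derive1Sn (is_derive_derive1 (fun x => bump_is_derive c d s0 P m x)).
Qed.

Lemma bump_test a b c d s (P : {poly R}) m : 0 < s -> a < c -> c < d -> d < b ->
  test_function `]a, b[ (bump c d s P m).
Proof.
move=> s0 ac cd db.
have cl : closure [set x | bump c d s P m x != 0] `<=` `[c, d].
  apply: closure_sub_closed; first exact: itv_closed.
  move=> x /=; rewrite /bump; case: ifPn => [qx _|]; last by rewrite eqxx.
  by rewrite in_itv /=; apply/andP; split; rewrite leNgt; apply/negP => h; nra.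
split.
- move=> n x; have [P' [m' ->]] := bump_derive1n c d s0 n P m.
  by case: (bump_is_derive c d s0 P' m' x).
- apply: (subclosed_compact _ (@segment_compact _ c d)) => //.
  exact: closed_closure.
- by move=> x /cl /=; rewrite !in_itv /= => /andP[cx xd]; rewrite (lt_le_trans ac cx) (le_lt_trans xd db).
Qed.

Definition smooth f := forall n x, derivable (derive1n n f) x 1.

Lemma smooth_is_derive f n (x : R) : smooth f ->
  is_derive x (1 : R) (derive1n n f) (derive1n n.+1 f x).
Proof.
by move=> sf; rewrite derive1nS derive1E; apply: DeriveDef => //; exact: sf.
Qed.

Lemma smooth_continuous f n : smooth f -> continuous (derive1n n f).
Proof.
by move=> sf x; apply/differentiable_continuous/derivable1_diffP; exact: sf.
Qed.

Lemma derive1n_lin n f g (k : R) : smooth f -> smooth g ->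
  derive1n n (fun x => f x + k * g x) = fun x => derive1n n f x + k * derive1n n g x.
Proof.
move=> sf sg; elim: n => [//|n IH].
rewrite derive1nS IH; apply: is_derive_derive1 => x.
have := is_deriveD (smooth_is_derive n x sf) (is_deriveZ k (smooth_is_derive n x sg)).
by [].
Qed.

Lemma smooth_lin f g (k : R) : smooth f -> smooth g ->
  smooth (fun x => f x + k * g x).
Proof.
move=> sf sg n x; rewrite derive1n_lin//.
have [] := is_deriveD (smooth_is_derive n x sf) (is_deriveZ k (smooth_is_derive n x sg)).
by [].
Qed.

Lemma test_lin D f g (k : R) : test_function D f -> test_function D g ->
  test_function D (fun x => f x + k * g x).
Proof.
move=> [sf cf fD] [sg cg gD].
have sub : closure [set x | f x + k * g x != 0] `<=`
    closure [set x | f x != 0] `|` closure [set x | g x != 0].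
  rewrite -closureU; apply: closure_subset => x /= H.
  have [fx|fx] := eqVneq (f x) 0; [right|by left].
  by apply: contra H => /eqP gx; rewrite fx gx mulr0 addr0.
split; first exact: smooth_lin.
- apply: (subclosed_compact _ (compactU cf cg)) => //; exact: closed_closure.
- by move=> x /sub[/fD|/gD].
Qed.

Lemma test_derive D f : test_function D f -> test_function D (derive1 f).
Proof.
move=> [sf cf fD].
have sub : closure [set x | derive1 f x != 0] `<=` closure [set x | f x != 0].
  apply: closure_sub_closed; first exact: closed_closure.
  move=> x; apply: contraPP => /= Kx; apply/negP; rewrite negbK; apply/eqP.
  have oK : open (~` closure [set x | f x != 0]) by rewrite openC; exact: closed_closure.
  rewrite derive1E (@near_eq_derive _ _ _ f (cst 0)) ?derive_cst//.
  have : \near x, (~` closure [set x | f x != 0]) x by exact: open_nbhs_nbhs.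
  apply: filterS => y Ky; apply: contrapT => /eqP fy; apply: Ky.
  exact: subset_closure.
split; first by move=> n x; rewrite -derive1Sn; exact: sf.
- by apply: (subclosed_compact _ cf) => //; exact: closed_closure.
- by move=> x /sub/fD.
Qed.

Lemma test_support (a b : R) f : a < b -> test_function `]a, b[ f -> exists c d,
  [/\ a < c, c < d, d < b & forall x, x <= c \/ d <= x -> f x = 0].
Proof.
move=> ab [_ cK KD]; set K := closure _ in cK KD.
have zero x : ~ K x -> f x = 0.
  by move=> Kx; apply: contrapT => /eqP fx; apply: Kx; exact: subset_closure.
have [K0|Kn] := pselect (K !=set0); last first.
  have mab := midf_lt ab.
  exists ((a + (a + b) / 2) / 2), ((b + (a + b) / 2) / 2); split; try lra.
  by move=> x _; apply: zero => Kx; apply: Kn; exists x.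
have idc : {within K, continuous (@id R)} by apply: continuous_subspaceT => x; exact: cvg_id.
have [u /set_mem uK umin] := compact_EVT_min K0 cK idc.
have [v /set_mem vK vmax] := compact_EVT_max K0 cK idc.
have := KD _ uK; have := KD _ vK; rewrite /= !in_itv /= => /andP[av vb] /andP[au ub].
have uv : u <= v by apply: umin; exact: mem_set.
exists ((a + u) / 2), ((v + b) / 2); split; try lra.
move=> x xcd; apply: zero => Kx.
have := umin _ (mem_set Kx); have := vmax _ (mem_set Kx); case: xcd; lra.
Qed.

Lemma support_integral a b f (u : R -> R) c d : a < c -> d < b ->
  (forall x, x <= c \/ d <= x -> f x = 0) ->
  \int[leb]_x (f x * u x) = \int[leb]_(x in `[c, d]) (f x * u x).
Proof.
move=> ac db f0; rewrite [RHS]Rintegral_mkcond; apply: eq_Rintegral => x _.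
rewrite patchE; case: ifPn => // /negP; rewrite inE /= in_itv /= => /negP.
by rewrite negb_and -!ltNge => /orP H; rewrite f0 ?mul0r//; case: H => /ltW; [left|right].
Qed.

Lemma test_mul_integrable D f n (u : R -> R) : test_function D f ->
  leb.-integrable setT (EFin \o u) ->
  leb.-integrable setT (EFin \o (fun x => derive1n n f x * u x)).
Proof.
move=> tf iu; rewrite (_ : _ \o _ = ((EFin \o derive1n n f) \* (EFin \o u))%E)//.
apply: integrableMr => //; first exact: (test_function_measurable n tf).
exact: (test_function_bounded n tf).
Qed.

Lemma primitive_weak a b phi (w : R -> R) : a < b ->
  leb.-integrable setT (EFin \o w) -> test_function `]a, b[ phi ->
  \int[leb]_x (derive1 phi x * primitive w x) = - \int[leb]_x (phi x * w x).
Proof.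
move=> ab iw tf; have [c [d [ac cd db f0]]] := test_support ab tf.
have [sf _ _] := tf.
have f'0 x : x <= (a + c) / 2 \/ (d + b) / 2 <= x -> derive1 phi x = 0.
  move=> H; rewrite derive1E (@near_eq_derive _ _ _ phi (cst 0)) ?derive_cst//.
  case: H => H.
    have : \near x, x < c by apply: lt_nbhsl; lra.
    by apply: filterS => y yc; rewrite f0//; left; exact: ltW.
  have : \near x, d < x by apply: lt_nbhsr; lra.
  by apply: filterS => y yc; rewrite f0//; right; exact: ltW.
have f0' x : x <= (a + c) / 2 \/ (d + b) / 2 <= x -> phi x = 0.
  by move=> H; apply: f0; case: H => H; [left|right]; lra.
have h1 : a < (a + c) / 2 by lra.
have h2 : (d + b) / 2 < b by lra.
rewrite (support_integral _ h1 h2 f'0) (support_integral _ h1 h2 f0').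
have dp x : is_derive x (1 : R) phi (derive1 phi x) := smooth_is_derive 0 x sf.
have cp : continuous (derive1 phi) := @smooth_continuous phi 1%N sf.
rewrite (primitive_by_parts iw dp cp); last by lra.
by rewrite f0' ?[phi ((a + c) / 2)]f0' ?mul0r ?subrr ?sub0r//; [left|right].
Qed.

Lemma hump_bounds (c d s x : R) : 0 < s -> 0 <= bump c d s 1 0 x <= 1.
Proof.
move=> s0; rewrite /bump; case: ifPn => qx; last by rewrite lexx ler01.
rewrite hornerC expr0 divr1 mul1r expR_ge0 /= expR_le1 oppr_le0 invr_ge0.
by rewrite mulr_ge0// ltW.
Qed.

(** The hump exp (- 1 / (n q)) tends to 1 wherever q > 0, so test functions
    approximate the indicators of intervals. *)
Lemma hump_cvg (c d x : R) : c < d ->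
  bump c d n.+1%:R 1 0 x @[n --> \oo] --> (\1_`]c, d[ x : R).
Proof.
move=> cd; rewrite /bump indicE.
have -> : (x \in `]c, d[%classic) = (0 < (x - c) * (d - x)).
  apply/idP/idP; rewrite ?inE /= in_itv /=.
    by move=> /andP[? ?]; rewrite mulr_gt0 ?subr_gt0.
  by move=> qx; apply/andP; split; rewrite ltNge; apply/negP => h; nra.
case: (boolP (0 < (x - c) * (d - x))) => qx; last exact: cvg_cst.
rewrite (_ : (fun n => _) = fun n => expR (- (((x - c) * (d - x))^-1 * n.+1%:R^-1))); last first.
  by apply/funext => n; rewrite hornerC expr0 divr1 mul1r invfM mulrC.
rewrite [X in _ --> X](_ : _ = expR (- (((x - c) * (d - x))^-1 * 0))); last first.
  by rewrite mulr0 oppr0 expR0.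
apply: continuous_cvg; first exact: continuous_expR.
by apply: cvgN; apply: cvgM; [exact: cvg_cst|exact: cvg_harmonic].
Qed.

(** Testing against humps shows that the integral of u vanishes on every interval
    inside ]a, b[.  So the primitive of u is constant on ]a, b[, and u is almost
    everywhere the derivative of its primitive. *)
Lemma fundamental_lemma (a b : R) (u : R -> R) : leb.-integrable setT (EFin \o u) ->
  (forall phi, test_function `]a, b[ phi -> \int[leb]_x (phi x * u x) = 0) ->
  {ae leb, forall x, a < x < b -> u x = 0}.
Proof.
move=> iu H.
have mu_ : measurable_fun setT u by apply/measurable_EFinP; exact: (measurable_int leb iu).
have z c d : a < c -> c < d -> d < b -> \int[leb]_(x in `]c, d[) u x = 0.
  move=> ac cd db; pose h n := bump c d n.+1%:R 1 0.
  have th n : test_function `]a, b[ (h n) by apply: bump_test.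
  have mh n : measurable_fun setT (h n) by exact: (test_function_measurable 0 (th n)).
  pose f_ n x : \bar R := (h n x * u x)%:E.
  pose f x : \bar R := (\1_`]c, d[ x * u x)%:E.
  have mf_ n : measurable_fun setT (f_ n).
    by apply/measurable_EFinP; exact: measurable_funM.
  have mf : measurable_fun setT f.
    by apply/measurable_EFinP; apply: measurable_funM => //; exact: measurable_indic.
  have ff : {ae leb, forall x, setT x -> f_ n x @[n --> \oo] --> f x}.
    apply: nearW => x _; apply: cvg_EFin; first exact: nearW.
    by apply: cvgMl; exact: hump_cvg.
  have ig : leb.-integrable setT (abse \o (EFin \o u)) by exact: integrable_abse.
  have fg : {ae leb, forall x n, setT x -> (`|f_ n x| <= (abse \o (EFin \o u)) x)%E}.
    apply: nearW => x n _; rewrite /f_ /= lee_fin normrM ler_piMl//.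
    by have /andP[h0 h1] := hump_bounds c d x (ltr0Sn R n); rewrite ger0_norm.
  have [_ _] := @dominated_convergence _ _ R leb setT measurableT f_ f _ mf_ mf ff ig fg.
  have -> : (fun n => \int[leb]_x f_ n x)%E = cst 0%E.
    apply/funext => n; have := H _ (th n); rewrite /Rintegral => H0.
    rewrite -[LHS]fineK; first by rewrite H0.
    by apply: integrable_fin_num => //; exact: (@test_mul_integrable _ (h n) 0%N u (th n) iu).
  move=> cv; have E0 : (\int[leb]_x f x = 0)%E.
    by rewrite -(cvg_lim _ cv)// lim_cst.
  rewrite Rintegral_mkcond /Rintegral -[RHS]/(fine 0%E) -E0; congr fine.
  apply: eq_integral => x _; rewrite /f patchE indicE.
  by case: (_ \in _); rewrite ?mul1r ?mul0r.
have := primitive_derivative iu; apply: filterS; first exact: (ae_filter_ringOfSetsType leb).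
move=> x [_ <-] /andP[ax xb].
rewrite derive1E (@near_eq_derive _ _ _ _ (cst (primitive u x))) ?derive_cst//.
have : \near x, a < x < b.
  by have := @near_in_itvoo R a b x; rewrite in_itv /= ax xb => /(_ isT).
apply: filterS => y /andP[ay yb] /=.
have [xy|yx|->//] := ltgtP x y; apply/eqP; rewrite -subr_eq0; apply/eqP.
  by rewrite primitiveB_oo ?ltW// z.
by rewrite -opprB primitiveB_oo ?ltW// z// oppr0.
Qed.

(** The primitive of psi vanishes beyond the support of psi on the right because
    the total integral does. *)
Lemma test_antiderivative (a b : R) psi : a < b -> test_function `]a, b[ psi ->
  \int[leb]_x psi x = 0 ->
  exists2 phi, test_function `]a, b[ phi & derive1 phi = psi.
Proof.
move=> ab tp I0; have [c [d [ac cd db p0]]] := test_support ab tp.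
have [sp _ _] := tp.
have cp : continuous psi := @smooth_continuous psi 0%N sp.
have ip : leb.-integrable setT (EFin \o psi).
  have : leb.-integrable setT ((EFin \o psi) \_ `[c, d]).
    apply: (iffLR (integrable_mkcond _ _)); first exact: measurable_itv.
    exact: continuous_integrable_itv.
  rewrite (_ : _ \_ _ = EFin \o psi)//; apply/funext => x.
  rewrite patchE; case: ifPn => // /negP; rewrite inE /= in_itv /= => /negP.
  by rewrite negb_and -!ltNge => /orP H; rewrite p0//; case: H => /ltW; [left|right].
pose phi := primitive psi.
have dphi x : is_derive x (1 : R) phi (psi x).
  have ipx : leb.-integrable [set` Interval -oo%O (BRight (x + 1))] (EFin \o psi).
    exact: integrable_sub.
  have xu : x < x + 1 by rewrite ltrDl.
  have bx : (-oo%O < BRight x)%E by first [done|rewrite ltNyr].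
  have [] := @continuous_FTC1 R psi -oo%O x (x + 1) xu ipx bx (cp x).
  move=> h1 h2; have h3 : 'D_1 phi x = psi x by rewrite -derive1E; exact: h2.
  exact: (DeriveDef h1 h3).
have d1 : derive1 phi = psi by exact: is_derive_derive1.
have phi0 x : x <= c \/ d <= x -> phi x = 0.
  have left y : y <= c -> phi y = 0.
    move=> yc; rewrite /phi /primitive /Rintegral integral0_eq// => t.
    rewrite /= in_itv /= => ty.
    by rewrite p0//; left; exact: le_trans yc.
  case=> [|dx]; first exact: left.
  rewrite /phi /primitive -[RHS]I0 Rintegral_mkcond; apply: eq_Rintegral => t _.
  rewrite patchE; case: ifPn => // /negP; rewrite inE /= in_itv /= => /negP.
  by rewrite -ltNge => xt; rewrite p0//; right; exact: le_trans (ltW xt).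
have cl : closure [set x | phi x != 0] `<=` `[c, d].
  apply: closure_sub_closed; first exact: itv_closed.
  move=> x /= /eqP px; rewrite in_itv /=; apply/andP; split; rewrite leNgt; apply/negP => h.
    by apply: px; apply: phi0; left; exact: ltW.
  by apply: px; apply: phi0; right; exact: ltW.
exists phi; last exact: d1.
split.
- move=> [|n] x; first by case: (dphi x).
  by rewrite derive1Sn d1; exact: sp.
- apply: (subclosed_compact _ (@segment_compact _ c d)) => //.
  exact: closed_closure.
- move=> x /cl /=; rewrite !in_itv /= => /andP[cx xd].
  by rewrite (lt_le_trans ac cx) (le_lt_trans xd db).
Qed.

Lemma hump_integral_gt0 (c d s : R) : 0 < s -> c < d ->
  \int[leb]_x bump c d s 1 0 x != 0.
Proof.
move=> s0 cd; set h := bump c d s 1 0.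
have th : test_function `](c - 1), (d + 1)[ h by apply: bump_test => //; lra.
have h0 x : 0 <= h x by have /andP[] := hump_bounds c d x s0.
have mh : measurable_fun setT h by exact: (test_function_measurable 0 th).
have i1 : leb.-integrable setT (EFin \o h).
  have : leb.-integrable setT (EFin \o (\1_`[c, d] : R -> R)).
    by apply: integrable_indic_itv.
  apply: le_integrable => //; first exact/measurable_EFinP.
  move=> x _ /=; rewrite lee_fin ger0_norm// ger0_norm//.
  have [xcd|xcd] := boolP (x \in `[c, d]%classic).
    by rewrite indicE xcd; have /andP[] := hump_bounds c d x s0.
  rewrite indicE (negbTE xcd) /h /bump; case: ifPn => // qx.
  case/negP: xcd; apply: mem_set; rewrite /= in_itv /=.
  by apply/andP; split; rewrite leNgt; apply/negP => ?; nra.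
apply/negP => /eqP H.
have I0 : (\int[leb]_x `|(EFin \o h) x| = 0)%E.
  rewrite -[RHS]/((0 : R)%:E) -H /Rintegral fineK; last exact: integrable_fin_num.
  by apply: eq_integral => x _; rewrite gee0_abs//= lee_fin.
have /ae_eq_integral_abs := I0; move=> /(_ measurableT) [].
  exact/measurable_EFinP.
move=> A [mA A0 HA].
have cdA : `]c, d[%classic `<=` A.
  move=> x /=; rewrite in_itv /= => /andP[cx xd]; apply: HA => /= /(_ I) [].
  apply/eqP; rewrite gt_eqF// /h /bump ifT; last by rewrite mulr_gt0 ?subr_gt0.
  by rewrite hornerC expr0 divr1 mul1r expR_gt0.
have : (leb `]c, d[%classic <= leb A)%E by apply: le_measure; rewrite ?inE.
have -> : leb A = 0%E by exact: A0.
rewrite lebesgue_measure_itv/= lte_fin cd.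
by rewrite -EFinD lee_fin subr_le0 leNgt cd.
Qed.

(** Fix a test function h of nonzero integral.  Every test function is the
    derivative of one plus a multiple of h, so w - k is orthogonal to all test
    functions as soon as the constant k makes it orthogonal to h. *)
Lemma du_bois_reymond (a b : R) (w : R -> R) : a < b ->
  leb.-integrable setT (EFin \o w) ->
  (forall phi, test_function `]a, b[ phi -> \int[leb]_x (derive1 phi x * w x) = 0) ->
  exists k, {ae leb, forall x, a < x < b -> w x = k}.
Proof.
move=> ab iw H.
pose c := (2 * a + b) / 3; pose d := (a + 2 * b) / 3.
have [ac cd db] : [/\ a < c, c < d & d < b] by rewrite /c /d; split; lra.
pose h := bump c d 1 1 0.
have th : test_function `]a, b[ h by apply: bump_test.
have hI : \int[leb]_x h x != 0 by exact: hump_integral_gt0.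
set I := \int[leb]_x h x in hI.
pose k := \int[leb]_x (h x * w x) / I.
exists k.
pose one : R -> R := \1_`]a, b[.
have i1 : leb.-integrable setT (EFin \o one) by exact: integrable_indic_itv.
have iu : leb.-integrable setT (EFin \o (fun x => w x - k * one x)).
  exact: (integrableB measurableT iw (integrableZl measurableT k i1)).
have one1 f x : test_function `]a, b[ f -> f x * one x = f x.
  move=> [_ _ fab]; rewrite /one indicE.
  have [xab|/negP xab] := boolP (x \in `]a, b[%classic); first by rewrite mulr1.
  have -> : f x = 0; last by rewrite mul0r.
  apply: contrapT => /eqP fx; apply: xab; apply: mem_set; apply: fab.
  exact: subset_closure.
have itest f : test_function `]a, b[ f -> leb.-integrable setT (EFin \o f).
  move=> tf; have := @test_mul_integrable _ f 0%N one tf i1.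
  by congr (leb.-integrable _ _); apply/funext => x /=; rewrite one1.
have wk : {ae leb, forall x, a < x < b -> w x - k * one x = 0}.
  apply: fundamental_lemma => // psi tpsi.
  have ipsi := itest _ tpsi; have ih := itest _ th.
  pose r := - (\int[leb]_x psi x / I).
  have [phi tphi dphi] : exists2 phi, test_function `]a, b[ phi &
      derive1 phi = fun x => psi x + r * h x.
    apply: test_antiderivative => //; first exact: test_lin.
    rewrite RintegralD//; last exact: (integrableZl measurableT r ih).
    by rewrite RintegralZl// /r mulNr divfK// subrr.
  have := H phi tphi; rewrite dphi.
  have ipw : leb.-integrable setT (EFin \o (fun x => psi x * w x)).
    exact: (@test_mul_integrable _ psi 0%N w tpsi iw).
  have ihw : leb.-integrable setT (EFin \o (fun x => h x * w x)).
    exact: (@test_mul_integrable _ h 0%N w th iw).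
  have -> : \int[leb]_x ((psi x + r * h x) * w x) =
      \int[leb]_x (psi x * w x) + r * \int[leb]_x (h x * w x).
    rewrite -RintegralZl// -RintegralD//; last exact: (integrableZl measurableT r ihw).
    by apply: eq_Rintegral => x _; ring.
  have -> : \int[leb]_x (psi x * (w x - k * one x)) =
      \int[leb]_x (psi x * w x) - k * \int[leb]_x psi x.
    rewrite -RintegralZl// -RintegralB//; last exact: (integrableZl measurableT k ipsi).
    apply: eq_Rintegral => x _; rewrite -{3}(one1 psi x tpsi); ring.
  rewrite /r /k => <-; field.
  by [].
move: wk; apply: filterS; first exact: (ae_filter_ringOfSetsType leb).
move=> x + xab => /(_ xab) /eqP; rewrite subr_eq0 => /eqP ->.
by rewrite /one indicE mem_set ?mulr1//= in_itv.
Qed.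

End Smooth.

(** * Lebesgue measure on an interval and absolute continuity *)

Section IntervalMeasure.
Context (R : realType) (a b : R).
Notation leb := (@lebesgue_measure R).
Local Notation mu := (itv_measure a b).

Lemma itv_measureE A : itv_measure a b A = leb (A `&` `]a, b[).
Proof. by []. Qed.

Lemma ae_itv (P : R -> Prop) :
  (\forall x \ae mu, P x) <-> {ae leb, forall x, a < x < b -> P x}.
Proof.
split=> [[A [mA A0 PA]]|[A [mA A0 PA]]].
  exists (A `&` `]a, b[%classic); split => //.
    by apply: measurableI => //; exact: measurable_itv.
  move=> x /= /not_implyP[xab nP]; split; first exact: PA.
  by rewrite /= in_itv.
exists (A `|` ~` `]a, b[%classic); split => //.
- by apply: measurableU => //; apply: measurableC; exact: measurable_itv.
- apply/eqP; rewrite eq_le measure_ge0 andbT itv_measureE setIUl setICl setU0.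
  rewrite -[leRHS]A0 le_measure ?inE//.
  by apply: measurableI => //; exact: measurable_itv.
move=> x /= nP; have [xab|] := pselect (`]a, b[%classic x); last by right.
by left; apply: PA => /= H; apply: nP; apply: H; rewrite /= in_itv /= in xab.
Qed.

(** Extension by zero from ]a, b[, to pass from [itv_measure] to Lebesgue measure
    on the line. *)
Definition zext (f : R -> R) : R -> R := f \_ `]a, b[.

Lemma zextE f x : a < x < b -> zext f x = f x.
Proof. by move=> xab; rewrite /zext patchE mem_set//= in_itv. Qed.

Lemma zext_out f x : ~~ (a < x < b) -> zext f x = 0.
Proof.
by move=> xab; rewrite /zext patchE memNset//= in_itv/=; exact/negP.
Qed.

Let mab : measurable (`]a, b[%classic : set R). Proof. exact: measurable_itv. Qed.

Let mu_sub A : measurable A -> A `<=` `]a, b[%classic -> mu A = leb A.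
Proof. by move=> mA AB; rewrite itv_measureE setIidl. Qed.

Let mu_out : mu (~` `]a, b[%classic) = 0%E.
Proof. by rewrite itv_measureE setICl measure0. Qed.

Lemma integrable_zext (f : R -> R) : mu.-integrable setT (EFin \o f) ->
  leb.-integrable setT (EFin \o zext f).
Proof.
move=> mif.
have mf : measurable_fun setT f by apply/measurable_EFinP; exact: (measurable_int mu mif).
have -> : EFin \o zext f = (EFin \o f) \_ `]a, b[.
  by apply/funext => x /=; rewrite /zext !patchE; case: ifP.
apply: (iffLR (integrable_mkcond _ _)); first exact: mab.
apply/integrableP; split; first by apply/measurable_EFinP; exact: measurable_funTS.
have /integrableP[_] := mif; apply: le_lt_trans.
have -> : (\int[mu]_x `|(EFin \o f) x| = \int[leb]_(x in `]a, b[) `|(EFin \o f) x|)%E.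
  rewrite (@ge0_negligible_integral _ _ _ mu setT (~` `]a, b[%classic))//.
  - by rewrite setTD setCK; apply: eq_measure_integral => A mA AB; exact: mu_sub.
  - exact: measurableC.
  - by apply: measurableT_comp => //; exact/measurable_EFinP.
by [].
Qed.

Lemma Rintegral_zext (f : R -> R) : mu.-integrable setT (EFin \o f) ->
  \int[mu]_x f x = \int[leb]_x zext f x.
Proof.
move=> mif; rewrite /zext -Rintegral_mkcond /Rintegral; congr fine.
rewrite (@negligible_integral _ _ _ mu setT (~` `]a, b[%classic))//.
  rewrite setTD setCK; apply: eq_measure_integral => A mA AB; exact: mu_sub.
exact: measurableC.
Qed.

Lemma itv_integrable_bounded (f : R -> R) (B : R) : measurable_fun setT f ->
  (forall x, `|f x| <= B) -> mu.-integrable setT (EFin \o f).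
Proof.
move=> mf fB; apply: measurable_bounded_integrable => //.
  by have := @itv_measure_fin R a b; rewrite ge0_fin_numE.
exists B; split; first exact: num_real.
by move=> M BM x _; exact: le_trans (fB x) (ltW BM).
Qed.

Lemma ae_itv_dense (P : R -> Prop) c d : a <= c -> c < d -> d <= b ->
  (\forall x \ae mu, P x) -> exists2 x, c < x < d & P x.
Proof.
move=> ac cd db [A [mA A0 PA]]; apply: contrapT => H.
have cdA : `]c, d[%classic `<=` A `&` `]a, b[%classic.
  move=> x; rewrite /= in_itv /= => xcd; split.
    by apply: PA => /= Px; apply: H; exists x.
  by move: xcd => /andP[cx xd]; rewrite in_itv /= (le_lt_trans ac cx) (lt_le_trans xd db).
have : (leb `]c, d[%classic <= leb (A `&` `]a, b[%classic))%E.
  by apply: le_measure; rewrite ?inE//; exact: measurableI.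
have -> : leb (A `&` `]a, b[%classic) = 0%E by exact: A0.
rewrite lebesgue_measure_itv/= lte_fin cd.
by rewrite -EFinD lee_fin subr_le0 leNgt cd.
Qed.

End IntervalMeasure.

Section ACFunctions.
Context (R : realType) (a b : R).
Notation leb := (@lebesgue_measure R).
Local Notation mu := (itv_measure a b).

Lemma abs_continuous_uniform (h : R -> R[i]) : abs_continuous `]a, b[ h ->
  forall e : R, 0 < e -> exists2 d : R, 0 < d & forall x y, a < x < b -> a < y < b ->
    `|x - y| < d -> normc (h x - h y) < e.
Proof.
move=> ac e e0; have [d d0 dP] := ac e e0; exists d => // x y xab yab xyd.
have triv (l r : 'I_1 -> R) : trivIset setT (fun i => `]l i, r i[%classic).
  by move=> i j _ _ _; rewrite !ord1.
have [xy|/ltW yx] := leP x y.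
  have := dP 1%N (fun=> x) (fun=> y); rewrite !big_ord1 => H.
  rewrite -normcN opprB.
  apply: H; last by rewrite distrC ger0_norm ?subr_ge0 in xyd.
    by move=> _; split => //; rewrite /= in_itv.
  exact: (triv (fun=> x) (fun=> y)).
have := dP 1%N (fun=> y) (fun=> x); rewrite !big_ord1 => H.
apply: H; last by rewrite ger0_norm ?subr_ge0 in xyd.
  by move=> _; split => //; rewrite /= in_itv.
exact: (triv (fun=> y) (fun=> x)).
Qed.

(** Every point of ]a, b[ is a limit of points where g and h agree. *)
Lemma abs_continuous_ae_eq (g h : R -> R[i]) : abs_continuous `]a, b[ g ->
  abs_continuous `]a, b[ h -> (\forall x \ae mu, g x = h x) ->
  forall x, a < x < b -> g x = h x.
Proof.
move=> /abs_continuous_uniform acg /abs_continuous_uniform ach gh x xab.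
apply/eqP; rewrite -subr_eq0; apply/eqP; apply: eq0_normc.
apply/eqP; rewrite eq_le normc_ge0 andbT leNgt; apply/negP => n0.
set e := normc _ in n0; have e2 : 0 < e / 2 by lra.
have [d1 d10 D1] := acg _ e2; have [d2 d20 D2] := ach _ e2.
have /andP[ax xb] := xab.
pose y1 := Num.min b (x + Num.min d1 d2).
have xy1 : x < y1 by rewrite /y1 lt_min xb ltrDl lt_min d10.
have y1b : y1 <= b by rewrite /y1 ge_min lexx.
have [y /andP[xy yy1] gy] := ae_itv_dense (ltW ax) xy1 y1b gh.
have yab : a < y < b by rewrite (lt_trans ax xy) (lt_le_trans yy1 y1b).
have yd : `|x - y| < Num.min d1 d2.
  rewrite distrC gtr0_norm ?subr_gt0// ltrBlDl.
  by apply: lt_le_trans yy1 _; rewrite /y1 ge_min lexx orbT.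
move: yd; rewrite lt_min => /andP[yd1 yd2].
have H1 := D1 _ _ xab yab yd1; have H2 := D2 _ _ xab yab yd2.
have : e <= normc (g x - g y) + normc (h x - h y).
  rewrite -[normc (h x - h y)]normcN -/e /e.
  have -> : g x - h x = (g x - g y) + - (h x - h y) by rewrite gy; ring.
  exact: normc_triangle.
lra.
Qed.

End ACFunctions.

(** * Weak derivatives *)

Section WeakDerivatives.
Context (R : realType) (a b : R) (p : \bar R) (p1 : (1 <= p)%E).
Notation leb := (@lebesgue_measure R).
Local Notation mu := (itv_measure a b).
Local Notation Lp := (clspace mu p1).
Implicit Types (u v w : Lp) (i : bool).

(** Real and imaginary parts as one family, so that each real-variable argument
    is made once. *)
Definition part i (z : R[i]) : R := if i then Im z else Re z.

Lemma part_inj (z z' : R[i]) : (forall i, part i z = part i z') -> z = z'.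
Proof.
move=> H; have := H true; have := H false.
by case: z z' {H} => x y [x' y'] /= -> ->.
Qed.

Lemma partD i z z' : part i (z + z') = part i z + part i z'.
Proof. by case: i; case: z z' => ? ? []. Qed.

Lemma partB i z z' : part i (z - z') = part i z - part i z'.
Proof. by case: i; case: z z' => ? ? []. Qed.

Lemma partN i z : part i (- z) = - part i z.
Proof. by case: i; case: z. Qed.

Lemma partM i (r : R) z : part i (r%:C * z) = r * part i z.
Proof. by case: i; case: z => x y /=; ring. Qed.

Lemma part_sum i (I : Type) (s : seq I) (F : I -> R[i]) :
  part i (\sum_(j <- s) F j) = \sum_(j <- s) part i (F j).
Proof.
by elim/big_rec2: _ => [|j y1 y2 _ <-]; [case: i | rewrite partD].
Qed.

Lemma normc_part_le (z : R[i]) : normc z <= `|part false z| + `|part true z|.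
Proof. exact: normc_le_ReIm. Qed.

Definition lpart i (u : Lp) : R -> R := zext a b (part i \o u).

Lemma clspace_ext u v : (\forall x \ae mu, u x = v x) -> u = v.
Proof. by move=> H; rewrite -[u]reprK -[v]reprK; apply/clspace_eqP. Qed.

Lemma part_mul_integrable i (phi : R -> R) u : measurable_fun setT phi ->
  [bounded phi x | x in setT] ->
  mu.-integrable setT (EFin \o (fun x => phi x * part i (u x))).
Proof. by move=> mphi bphi; case: i; case: (clspace_integrable u mphi bphi). Qed.

Lemma part_integrable i u : mu.-integrable setT (EFin \o (part i \o u)).
Proof.
have -> : part i \o u = fun x => cst 1 x * part i (u x).
  by apply/funext => x /=; rewrite mul1r.
apply: part_mul_integrable; first exact: measurable_cst.
by exists 1; split; [exact: num_real | move=> M M1 x _ /=; rewrite normr1 ltW].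
Qed.

Lemma lpart_integrable i u : leb.-integrable setT (EFin \o lpart i u).
Proof. exact/integrable_zext/part_integrable. Qed.

Lemma part_cintegral i (D : set R) (m : {measure set (measurableTypeR R) -> \bar R})
  (f : R -> R[i]) :
  part i (cintegral m D f) = \int[m]_(x in D) part i (f x).
Proof. by case: i. Qed.

Lemma part_test_integral i phi n u : test_function `]a, b[ phi ->
  part i (cintegral mu setT (fun x => (derive1n n phi x)%:C * u x)) =
  \int[leb]_x (derive1n n phi x * lpart i u x).
Proof.
move=> tf; rewrite part_cintegral.
transitivity (\int[mu]_x (derive1n n phi x * part i (u x))).
  by apply: eq_Rintegral => x _; rewrite partM.
rewrite Rintegral_zext; last first.
  apply: part_mul_integrable; first exact: test_function_measurable tf.
  exact: test_function_bounded tf.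
apply: eq_Rintegral => x _; rewrite /lpart /zext !patchE.
by case: ifP => //; rewrite mulr0.
Qed.

Lemma weak_derivativeP j u v : weak_derivative j u v <->
  forall i phi, test_function `]a, b[ phi ->
    \int[leb]_x (derive1n j phi x * lpart i u x) =
    (-1) ^+ j * \int[leb]_x (phi x * lpart i v x).
Proof.
have sgnE : (-1) ^+ j = ((-1) ^+ j : R)%:C by rewrite rmorphXn rmorphN1.
split=> [H i phi tf|H phi tf].
  have := congr1 (part i) (H phi tf).
  by rewrite sgnE partM part_test_integral// (part_test_integral i 0 v tf).
apply: part_inj => i.
by rewrite sgnE partM part_test_integral// (part_test_integral i 0 v tf) H.
Qed.

Lemma weak_derivative_refl u : weak_derivative 0 u u.
Proof. by move=> phi tf; rewrite expr0 mul1r. Qed.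

Lemma weak_derivative_unique j u v w :
  weak_derivative j u v -> weak_derivative j u w -> v = w.
Proof.
move=> /weak_derivativeP uv /weak_derivativeP uw.
apply: clspace_ext; apply/ae_itv.
have H i : {ae leb, forall x, a < x < b -> lpart i v x - lpart i w x = 0}.
  have iv := lpart_integrable i v; have iw := lpart_integrable i w.
  apply: fundamental_lemma => [|phi tf]; first exact: (integrableB measurableT iv iw).
  have jv := @test_mul_integrable _ _ _ 0%N _ tf iv.
  have jw := @test_mul_integrable _ _ _ 0%N _ tf iw.
  have -> : \int[leb]_x (phi x * (lpart i v x - lpart i w x)) =
      \int[leb]_x (phi x * lpart i v x - phi x * lpart i w x).
    by apply: eq_Rintegral => x _; rewrite mulrBr.
  rewrite RintegralB//; apply/eqP; rewrite subr_eq0; apply/eqP.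
  have : (-1) ^+ j != 0 :> R by rewrite signr_eq0.
  by move=> /mulfI; apply; rewrite -uv// -uw.
have H0 := H false; have H1 := H true.
move: H0 H1; apply: filterS2; first exact: (ae_filter_ringOfSetsType leb).
move=> x h0 h1 xab; apply: part_inj => i.
have : lpart i v x - lpart i w x = 0 by case: i; [exact: h1 | exact: h0].
by rewrite /lpart !zextE// => /eqP; rewrite subr_eq0 => /eqP.
Qed.

(** Test with the derivative of phi, which is again a test function. *)
Lemma weak_derivative_step j u v w :
  weak_derivative j u v -> weak_derivative j.+1 u w -> weak_derivative 1 v w.
Proof.
move=> /weak_derivativeP uv /weak_derivativeP uw; apply/weak_derivativeP => i phi tf.
have := uv i _ (test_derive tf); rewrite -derive1Sn uw// exprS expr1 => /esym H.
have s2 : (-1) ^+ j * (-1) ^+ j = 1 :> R by rewrite -exprMn mulrNN mulr1 expr1n.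
have -> : \int[leb]_x (derive1n 1 phi x * lpart i v x) =
    \int[leb]_x (derive1 phi x * lpart i v x) by [].
have/(congr1 ( *%R ((-1) ^+ j))) := H.
by rewrite !mulrA s2 mul1r => ->; rewrite (mulrAC _ (-1)) s2 mul1r.
Qed.

Lemma weak_derivative_comp j u v w :
  weak_derivative j u v -> weak_derivative 1 v w -> weak_derivative j.+1 u w.
Proof.
move=> /weak_derivativeP uv /weak_derivativeP vw; apply/weak_derivativeP => i phi tf.
rewrite derive1Sn uv//; last exact: test_derive.
have -> : \int[leb]_x (derive1 phi x * lpart i v x) =
    -1 * \int[leb]_x (phi x * lpart i w x) by rewrite -[in RHS](expr1 (-1)) -vw.
by rewrite exprS mulrCA mulrA.
Qed.

Definition cprim (v : Lp) (x : R) : R[i] :=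
  primitive (lpart false v) x +i* primitive (lpart true v) x.

Lemma part_cprim i v x : part i (cprim v x) = primitive (lpart i v) x.
Proof. by case: i. Qed.

Lemma cprim_ac (k : R[i]) v : abs_continuous `]a, b[ (fun x => k + cprim v x).
Proof.
move=> e e0; have e2 : 0 < e / 2 by lra.
have [d0 d00 D0] := primitive_abs_continuous (lpart_integrable false v) e2.
have [d1 d10 D1] := primitive_abs_continuous (lpart_integrable true v) e2.
exists (Num.min d0 d1); first by rewrite lt_min d00.
move=> n l r lr triv; rewrite lt_min => /andP[s0 s1].
have lr' j : l j <= r j by have [] := lr j.
have S0 := D0 _ _ _ lr' triv s0; have S1 := D1 _ _ _ lr' triv s1.
apply: (@le_lt_trans _ _ (\sum_(j < n)
  (`|primitive (lpart false v) (r j) - primitive (lpart false v) (l j)| +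
   `|primitive (lpart true v) (r j) - primitive (lpart true v) (l j)|))).
  apply: ler_sum => j _; rewrite opprD addrACA subrr add0r.
  by apply: le_trans (normc_part_le _) _; rewrite !partB !part_cprim.
by rewrite big_split /=; lra.
Qed.

Lemma abs_continuous_lin (c : R[i]) (g h : R -> R[i]) : abs_continuous `]a, b[ g ->
  abs_continuous `]a, b[ h -> abs_continuous `]a, b[ (fun x => c * g x + h x).
Proof.
move=> acg ach e e0.
have c1 : 0 < normc c + 1 by have := normc_ge0 c; lra.
have e1 : 0 < e / 2 / (normc c + 1) by apply: divr_gt0 => //; lra.
have e2 : 0 < e / 2 by lra.
have [d0 d00 D0] := acg _ e1; have [d1 d10 D1] := ach _ e2.
exists (Num.min d0 d1); first by rewrite lt_min d00.
move=> n l r lr triv; rewrite lt_min => /andP[s0 s1].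
have S0 := D0 _ _ _ lr triv s0; have S1 := D1 _ _ _ lr triv s1.
apply: (@le_lt_trans _ _ (\sum_(j < n)
  (normc c * normc (g (r j) - g (l j)) + normc (h (r j) - h (l j))))).
  apply: ler_sum => j _; rewrite opprD addrACA -mulrBr -normcM.
  exact: normc_triangle.
rewrite big_split /= -mulr_sumr.
move: S0; rewrite ltr_pdivlMr// => S0.
set s := \sum_(_ < n) _ in S0 *.
have s_ge0 : 0 <= s by apply: sumr_ge0 => j _; exact: normc_ge0.
have : normc c * s <= s * (normc c + 1) by nra.
lra.
Qed.

Lemma ac_reprE u h x : abs_continuous `]a, b[ h -> (\forall x \ae mu, u x = h x) ->
  a < x < b -> ac_repr u x = h x.
Proof.
move=> ach uh xab.
have [ac' uh'] : [set h | abs_continuous `]a, b[ h /\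
    \forall x \ae mu, u x = h x] (ac_repr u).
  by apply: xgetPex; exists h.
by apply: (abs_continuous_ae_eq ac' ach) => //; apply: filterS2 uh' uh => y -> ->.
Qed.

End WeakDerivatives.

(** * Weak derivatives and primitives *)

Section PrimitiveChain.
Context (R : realType) (a b : R) (p : \bar R) (p1 : (1 <= p)%E) (ab : a < b).
Notation leb := (@lebesgue_measure R).
Local Notation mu := (itv_measure a b).
Local Notation Lp := (clspace mu p1).
Implicit Types (u v w : Lp) (i : bool).

Lemma primitive_bounded (w : R -> R) x : leb.-integrable setT (EFin \o w) ->
  `|primitive w x| <= \int[leb]_t `|w t|.
Proof.
move=> iw; have mt : measurable (`]-oo, x]%classic : set R) by exact: measurable_itv.
rewrite /primitive; apply: (@le_trans _ _ (\int[leb]_(t in `]-oo, x]) `|w t|)).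
  exact: (@le_normr_Rintegral _ _ R leb _ w mt (integrable_sub iw mt)).
rewrite Rintegral_mkcond; apply: le_Rintegral => //.
- rewrite -restrict_EFin; apply: (iffLR (integrable_mkcond _ _)); first exact: mt.
  by have := integrable_norm (integrable_sub iw mt).
- by have := integrable_norm iw.
- by move=> t _; rewrite patchE; case: ifP => _; [exact: lexx | exact: normr_ge0].
Qed.

Lemma primitive_measurable (w : R -> R) : leb.-integrable setT (EFin \o w) ->
  measurable_fun setT (primitive w).
Proof. by move=> iw; apply: continuous_measurable_fun; exact: primitive_continuous. Qed.

Lemma primitive_zext_integrable (w : R -> R) : leb.-integrable setT (EFin \o w) ->
  leb.-integrable setT (EFin \o zext a b (primitive w)).
Proof.
move=> iw; apply: integrable_zext.
apply: (@itv_integrable_bounded _ _ _ _ (\int[leb]_t `|w t|)).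
  exact: primitive_measurable.
by move=> x; exact: primitive_bounded.
Qed.

Lemma test_zext n phi (f : R -> R) x : test_function `]a, b[ phi ->
  derive1n n phi x * zext a b f x = derive1n n phi x * f x.
Proof.
move=> tf; have tn : test_function `]a, b[ (derive1n n phi).
  by elim: n => [//|n IH]; rewrite derive1nS; exact: test_derive.
have [c [d [ac cd db H]]] := test_support ab tn.
have [xab|xab] := boolP (a < x < b); first by rewrite zextE.
rewrite H ?mul0r// ; move: xab; rewrite negb_and -!leNgt => /orP[xa|bx]; [left|right].
  exact: le_trans xa (ltW ac).
exact: le_trans (ltW db) bx.
Qed.

Lemma test_derive_integral phi (k : R) : test_function `]a, b[ phi ->
  \int[leb]_x (derive1 phi x * k) = 0.
Proof.
move=> tf; have [c [d [ac cd db H]]] := test_support ab (test_derive tf).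
have [c' [d' [ac' cd' db' H']]] := test_support ab tf.
have [sphi _ _] := tf.
have cl : Num.min c c' <= Num.max d d' by rewrite ge_min !le_max (ltW cd).
rewrite (@support_integral _ a b _ (cst k) (Num.min c c') (Num.max d d')); first last.
- move=> x; rewrite le_min ge_max => -[/andP[xc _]|/andP[dx _]]; apply: H; first by left.
  by right.
- by rewrite gt_max db.
- by rewrite lt_min ac.
have dphi x : is_derive x (1 : R) phi (derive1 phi x).
  by have := smooth_is_derive 0 x sphi; rewrite derive1n1.
have cphi : continuous (derive1 phi).
  by have := @smooth_continuous _ phi 1 sphi; rewrite derive1n1.
rewrite RintegralZr//; last exact: continuous_integrable_itv.
rewrite (FTC2_cc dphi cphi cl) !H' ?subrr ?mul0r//; first by left; rewrite ge_min lexx orbT.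
by right; rewrite le_max lexx orbT.
Qed.

(** By the du Bois-Reymond lemma u minus the primitive of v is constant. *)
Lemma weak_derivative1P u v : weak_derivative 1 u v <->
  exists k : R[i], \forall x \ae mu, u x = k + cprim v x.
Proof.
split=> [/weak_derivativeP uv|[k uk]].
  have H i : exists k, {ae leb, forall x, a < x < b ->
      lpart i u x - zext a b (primitive (lpart i v)) x = k}.
    have iu := lpart_integrable i u.
    have iv := lpart_integrable i v.
    have iP := primitive_zext_integrable iv.
    apply: du_bois_reymond => // [|phi tf]; first exact: (integrableB measurableT iu iP).
    have ju := @test_mul_integrable _ _ _ 1%N _ tf iu.
    have jP := @test_mul_integrable _ _ _ 1%N _ tf iP.
    transitivity (\int[leb]_x (derive1n 1 phi x * lpart i u x -
        derive1n 1 phi x * zext a b (primitive (lpart i v)) x)).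
      by apply: eq_Rintegral => x _; rewrite derive1n1 mulrBr.
    rewrite RintegralB// uv// expr1 mulN1r.
    have -> : \int[leb]_x (derive1n 1 phi x * zext a b (primitive (lpart i v)) x) =
        \int[leb]_x (derive1 phi x * primitive (lpart i v) x).
      by apply: eq_Rintegral => x _; rewrite test_zext// derive1n1.
    by rewrite (primitive_weak ab iv tf) opprK addNr.
  have [k0 H0] := H false; have [k1 H1] := H true.
  exists (k0 +i* k1); apply/ae_itv.
  move: H0 H1; apply: filterS2; first exact: (ae_filter_ringOfSetsType leb).
  move=> x h0 h1 xab; apply: part_inj => i; rewrite partD part_cprim.
  have : lpart i u x - zext a b (primitive (lpart i v)) x = part i (k0 +i* k1).
    by case: i; [exact: h1 | exact: h0].
  by rewrite /lpart !zextE// => /eqP; rewrite subr_eq => /eqP.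
apply/weak_derivativeP => i phi tf; rewrite expr1 mulN1r.
have iv := lpart_integrable i v.
have iP := primitive_zext_integrable iv.
have jP := @test_mul_integrable _ _ _ 1%N _ tf iP.
have ik : leb.-integrable setT (EFin \o zext a b (cst (part i k))).
  apply: integrable_zext; apply: (@itv_integrable_bounded _ _ _ _ `|part i k|) => //.
have jk := @test_mul_integrable _ _ _ 1%N _ tf ik.
have iu := lpart_integrable i u.
have ju := @test_mul_integrable _ _ _ 1%N _ tf iu.
transitivity (\int[leb]_x (derive1n 1 phi x * zext a b (cst (part i k)) x +
  derive1n 1 phi x * zext a b (primitive (lpart i v)) x)).
  congr fine; apply: ae_eq_integral => //.
  - exact: (measurable_int leb ju).
  - exact: (measurable_int leb (integrableD measurableT jk jP)).
  have /ae_itv := uk; apply: filterS; first exact: (ae_filter_ringOfSetsType leb).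
  move=> x xab _ /=; rewrite -mulrDr; congr (_ * _)%:E.
  rewrite /lpart; have [xx|nx] := boolP (a < x < b); last by rewrite !zext_out// addr0.
  by rewrite !zextE//= xab// partD part_cprim.
rewrite RintegralD//.
have -> : \int[leb]_x (derive1n 1 phi x * zext a b (primitive (lpart i v)) x) =
    \int[leb]_x (derive1 phi x * primitive (lpart i v) x).
  by apply: eq_Rintegral => x _; rewrite test_zext// derive1n1.
have -> : \int[leb]_x (derive1n 1 phi x * zext a b (cst (part i k)) x) =
    \int[leb]_x (derive1 phi x * part i k).
  by apply: eq_Rintegral => x _; rewrite test_zext// derive1n1.
by rewrite test_derive_integral// add0r (primitive_weak ab iv tf).
Qed.

End PrimitiveChain.

(** * Oriented integrals and the Taylor remainder *)

Section OrientedIntegral.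
Context (R : realType).
Notation leb := (@lebesgue_measure R).

(** The real counterpart of [oint]. *)
Definition rint (s x : R) (f : R -> R) : R :=
  if s <= x then \int[leb]_(t in `[s, x]) f t else - \int[leb]_(t in `[x, s]) f t.

Lemma part_oint i s x (f : R -> R[i]) : part i (oint s x f) = rint s x (part i \o f).
Proof.
by rewrite /oint /rint; case: ifP => _; rewrite ?partN part_cintegral.
Qed.

Lemma rint_primitive (w : R -> R) s x : leb.-integrable setT (EFin \o w) ->
  rint s x w = primitive w x - primitive w s.
Proof.
move=> iw; rewrite /rint; case: (leP s x) => [sx|/ltW xs].
  by rewrite primitiveB_cc.
by rewrite -primitiveB_cc// opprB.
Qed.

Definition between (s x t : R) := (s <= t <= x) || (x <= t <= s).

Lemma eq_rint s x (f g : R -> R) : (forall t, between s x t -> f t = g t) ->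
  rint s x f = rint s x g.
Proof.
move=> H; rewrite /rint; case: ifP => _; [|congr (- _)]; apply: eq_Rintegral => t;
  by rewrite inE /= in_itv /= => h; apply: H; rewrite /between h ?orbT.
Qed.

Lemma ae_eq_rint s x (f g : R -> R) : measurable_fun setT f -> measurable_fun setT g ->
  {ae leb, forall t, between s x t -> f t = g t} -> rint s x f = rint s x g.
Proof.
move=> mf mg H; rewrite /rint; case: ifP => _; [|congr (- _)]; congr fine;
  (apply: ae_eq_integral => //; first [exact: measurable_itv
    | by apply/measurable_EFinP; exact: measurable_funTS
    | move: H; apply: filterS; first exact: (ae_filter_ringOfSetsType leb)]);
  by move=> t h; rewrite /= in_itv /= => st /=; rewrite h// /between st ?orbT.
Qed.

Lemma rint_by_parts (w : R -> R) (F F' : R -> R) s x :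
  leb.-integrable setT (EFin \o w) ->
  (forall t : R, is_derive t (1 : R) F (F' t)) -> continuous F' ->
  rint s x (fun t => F' t * primitive w t) =
  F x * primitive w x - F s * primitive w s - rint s x (fun t => F t * w t).
Proof.
move=> iw dF cF'; rewrite /rint; case: (leP s x) => [sx|/ltW xs].
  exact: primitive_by_parts.
by rewrite (primitive_by_parts iw dF cF' xs); ring.
Qed.

Lemma rint_FTC (F F' : R -> R) s x :
  (forall t : R, is_derive t (1 : R) F (F' t)) -> continuous F' ->
  rint s x F' = F x - F s.
Proof.
move=> dF cF'; rewrite /rint; case: (leP s x) => [sx|/ltW xs]; first exact: FTC2_cc.
by rewrite (FTC2_cc dF cF' xs) opprB.
Qed.

Lemma rintD s x (f g : R -> R) : continuous f -> continuous g ->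
  rint s x (fun t => f t + g t) = rint s x f + rint s x g.
Proof.
move=> cf cg; rewrite /rint; case: ifP => _; rewrite RintegralD//; try exact: continuous_integrable_itv.
by rewrite opprD.
Qed.

Lemma rintZ s x (k : R) (f : R -> R) : 
  leb.-integrable `[s, x] (EFin \o f) -> leb.-integrable `[x, s] (EFin \o f) ->
  rint s x (fun t => k * f t) = k * rint s x f.
Proof.
by move=> i1 i2; rewrite /rint; case: ifP => _; rewrite RintegralZl// mulrN.
Qed.

(** Integration by parts against - (x - t)^(m+1) / (m + 1), the antiderivative of
    (x - t)^m that vanishes at t = x. *)
Lemma rint_taylor_step (w : R -> R) s x (k : R) m : leb.-integrable setT (EFin \o w) ->
  rint s x (fun t => (x - t) ^+ m * (k + primitive w t)) =
  (k + primitive w s) * ((x - s) ^+ m.+1 / m.+1%:R) +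
  m.+1%:R^-1 * rint s x (fun t => (x - t) ^+ m.+1 * w t).
Proof.
move=> iw; pose F t : R := - (x - t) ^+ m.+1 / m.+1%:R; pose F' t : R := (x - t) ^+ m.
have m0 : m.+1%:R != 0 :> R by rewrite pnatr_eq0.
have h (t : R) : is_derive t (1 : R) (fun t : R => x - t) (- 1).
  have := is_deriveB (is_derive_cst x t (1 : R)) (is_derive_id t (1 : R)).
  by rewrite sub0r.
have cpow n : continuous (fun t : R => (x - t) ^+ n).
  move=> t; apply/differentiable_continuous/derivable1_diffP.
  have [H _] := is_deriveX n (h t).
  by rewrite (_ : (fun t : R => (x - t) ^+ n) = (fun t : R => x - t) ^+ n)//;
    apply/funext => y; rewrite exprfctE.
have dF (t : R) : is_derive t (1 : R) F (F' t).
  have FE : (fun y : R => (- m.+1%:R^-1) *: ((fun t : R => x - t) ^+ m.+1) y) = F.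
    by apply/funext => y; rewrite /F exprfctE /GRing.scale /=; field.
  have H := is_deriveZ (- m.+1%:R^-1) (is_deriveX m.+1 (h t)).
  rewrite -FE; apply: is_derive_eq H _.
  by rewrite /F' /GRing.scale /=; field.
have cF' : continuous F' by exact: cpow.
transitivity (rint s x (fun t => F' t * k + F' t * primitive w t)).
  by apply: eq_rint => t _; rewrite mulrDr.
have cW := primitive_continuous iw.
rewrite rintD; first last.
- by move=> t; apply: cvgM; [exact: cF' | exact: cW].
- by move=> t; apply: cvgM; [exact: cF' | exact: cvg_cst].
rewrite (rint_by_parts s x iw dF cF').
have -> : rint s x (fun t => F' t * k) = k * (F x - F s).
  rewrite -(rint_FTC s x dF cF') -rintZ; first by apply: eq_rint => t _; rewrite mulrC.
  - exact: continuous_integrable_itv.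
  - exact: continuous_integrable_itv.
have Fx : F x = 0 by rewrite /F subrr expr0n /= oppr0 mul0r.
have -> : rint s x (fun t => F t * w t) =
    - m.+1%:R^-1 * rint s x (fun t => (x - t) ^+ m.+1 * w t).
  rewrite -rintZ; first by apply: eq_rint => t _; rewrite /F; field.
  - exact: continuous_mul_integrable.
  - exact: continuous_mul_integrable.
by rewrite Fx /F; field.
Qed.

End OrientedIntegral.

(** * Sobolev functions and their data *)

Lemma bounded_clfun (R : realType) (p : \bar R) (p1 : (1 <= p)%E) d
    (T : measurableType d) (mu : {measure set T -> \bar R}) (f : T -> R[i]) (B : R) :
  (mu setT < +oo)%E -> measurable_fun setT (@Re R \o f) ->
  measurable_fun setT (@Im R \o f) -> (forall x, normc (f x) <= B) ->
  f \in clfun mu p.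
Proof.
move=> mufin mr mi fB; have p0 : (0 <= p)%E by exact: le_trans p1.
apply/asboolP; split => //.
apply: (@le_lt_trans _ _ ('N[mu]_p[EFin \o cst B])%E).
  apply: le_Lnorm => //; first exact: measurable_normc.
  move=> x /=; rewrite ger0_norm ?normc_ge0//.
  by apply: le_trans (fB x) (ler_norm _).
rewrite unlock; case: p p1 p0 => [r| |] //= _ _; last first.
  by case: ifPn => // mu0; rewrite (@ess_sup_cst _ _ _ _ `|B|%:E)// ltry.
apply: poweR_lty.
rewrite (_ : (fun x => _) = cst (`|B| `^ r)%:E); last by apply/funext => x.
by rewrite integral_cst//; apply: lte_mul_pinfty; rewrite ?lee_fin ?powR_ge0.
Qed.

Section SobolevData.
Context (R : realType) (a b x0 : R) (p : \bar R) (p1 : (1 <= p)%E).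
Hypothesis x0ab : a < x0 < b.
Notation leb := (@lebesgue_measure R).
Local Notation mu := (itv_measure a b).
Local Notation Lp := (clspace mu p1).
Local Notation W := (sobolev a b p1).

Let ab : a < b. Proof. by case/andP: x0ab; exact: lt_trans. Qed.

Lemma weak_derivP k (f : W k) j : (j <= k)%N -> weak_derivative j f (weak_deriv j f).
Proof.
case: j => [_|j jk]; first exact: weak_derivative_refl.
by apply: (@xgetPex _ 0 [set g | weak_derivative j.+1 f g]);
  case: f => f /= /asboolP; apply.
Qed.

Lemma weak_derivE (f : Lp) j v : weak_derivative j f v -> weak_deriv j f = v.
Proof.
move=> fv; case: j fv => [|j] fv /=.
  exact: (weak_derivative_unique (weak_derivative_refl f) fv).
apply: (weak_derivative_unique _ fv).
by apply: (@xgetPex _ 0 [set g | weak_derivative j.+1 f g]); exists v.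
Qed.

Lemma weak_deriv_step k (f : W k) j : (j < k)%N ->
  weak_derivative 1 (weak_deriv j f) (weak_deriv j.+1 f).
Proof.
by move=> jk; apply: weak_derivative_step (weak_derivP f (ltnW jk)) (weak_derivP f jk).
Qed.

Lemma deriv_at_repr k (f : W k) j : (j < k)%N -> exists c : R[i],
  (forall x, a < x < b -> deriv_at j f x = c + cprim (weak_deriv j.+1 f) x) /\
  (\forall x \ae mu, weak_deriv j f x = c + cprim (weak_deriv j.+1 f) x).
Proof.
move=> jk; have [c H] := (weak_derivative1P ab _ _).1 (weak_deriv_step f jk).
by exists c; split => // x xab; apply: (ac_reprE (cprim_ac c _)).
Qed.

Lemma deriv_at_cprim k (f : W k) j x : (j < k)%N -> a < x < b ->
  deriv_at j f x = deriv_at j f x0 +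
    (cprim (weak_deriv j.+1 f) x - cprim (weak_deriv j.+1 f) x0).
Proof.
by move=> jk xab; have [c [H _]] := deriv_at_repr f jk; rewrite !H//; ring.
Qed.

Lemma weak_deriv_ae k (f : W k) j : (j < k)%N ->
  \forall x \ae mu, weak_deriv j f x = deriv_at j f x.
Proof.
move=> jk; have [c [H1 H2]] := deriv_at_repr f jk.
move/ae_itv: H2 => H2; apply/ae_itv; move: H2.
apply: filterS; first exact: (ae_filter_ringOfSetsType leb).
by move=> x H xab; rewrite H// H1.
Qed.

Lemma weak_deriv_lin k (c : R[i]) (f g : W k) j : (j <= k)%N ->
  weak_deriv j (c *: f + g : W k) = c *: weak_deriv j f + weak_deriv j g.
Proof.
by move=> jk; apply: weak_derivE; apply: weak_derivative_lin; exact: weak_derivP.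
Qed.

Lemma deriv_at_lin k (c : R[i]) (f g : W k) j x : (j < k)%N -> a < x < b ->
  deriv_at j (c *: f + g : W k) x = c * deriv_at j f x + deriv_at j g x.
Proof.
move=> jk xab; rewrite {1}/deriv_at weak_deriv_lin 1?ltnW//.
have [cf [Hf Hf']] := deriv_at_repr f jk; have [cg [Hg Hg']] := deriv_at_repr g jk.
rewrite Hf// Hg//.
apply: (ac_reprE (abs_continuous_lin c (cprim_ac cf _) (cprim_ac cg _))) => //.
by apply: filterS3 (clspace_linE c (weak_deriv j f) (weak_deriv j g)) Hf' Hg' => y -> -> ->.
Qed.

Lemma between_itv x t : a < x < b -> between x0 x t -> a < t < b.
Proof.
move=> /andP[ax xb]; have /andP[ax0 x0b] := x0ab.
move=> /orP[] /andP[h1 h2]; first by rewrite (lt_le_trans ax0 h1) (le_lt_trans h2 xb).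
by rewrite (lt_le_trans ax h1) (le_lt_trans h2 x0b).
Qed.

(** Induction on m: f^(m+1) is a primitive of f^(m+2), and integrating the
    remainder by parts splits off the next Taylor term. *)
Lemma taylor_part i k (f : W k) m x : (m < k)%N -> a < x < b ->
  part i (deriv_at 0 f x) =
  \sum_(j < m.+1) part i (deriv_at j f x0) * ((x - x0) ^+ j / j`!%:R) +
  m`!%:R^-1 * rint x0 x (fun t => (x - t) ^+ m * lpart i (weak_deriv m.+1 f) t).
Proof.
move=> + xab; elim: m => [k0|m IH mk].
  rewrite big_ord1 expr0 fact0 divr1 mulr1 invr1 mul1r (deriv_at_cprim f k0 xab).
  rewrite partD partB !part_cprim -rint_primitive; last exact: lpart_integrable.
  by congr (_ + _); apply: eq_rint => t _; rewrite expr0 mul1r.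
rewrite (IH (ltnW mk)) [in RHS]big_ord_recr /= -addrA; congr (_ + _).
set w := lpart i (weak_deriv m.+2 f).
have iw : leb.-integrable setT (EFin \o w) by exact: lpart_integrable.
have mw : measurable_fun setT w by apply/measurable_EFinP; exact: (measurable_int leb iw).
pose c := part i (deriv_at m.+1 f x0) - primitive w x0.
have mpow n : measurable_fun setT (fun t : R => (x - t) ^+ n).
  by apply: measurable_funX; exact: measurable_funB.
have il := lpart_integrable i (weak_deriv m.+1 f).
have -> : rint x0 x (fun t => (x - t) ^+ m * lpart i (weak_deriv m.+1 f) t) =
    rint x0 x (fun t => (x - t) ^+ m * (c + primitive w t)).
  apply: ae_eq_rint.
  - apply: measurable_funM => //; apply/measurable_EFinP; exact: (measurable_int leb il).
  - apply: measurable_funM => //; apply: measurable_funD => //; exact: primitive_measurable.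
  have /ae_itv := weak_deriv_ae f mk; apply: filterS; first exact: (ae_filter_ringOfSetsType leb).
  move=> t tab bt; have tab' := between_itv xab bt.
  rewrite /lpart zextE//= tab// (deriv_at_cprim f mk tab') partD partB !part_cprim /c.
  by congr (_ * _); rewrite addrCA addrC -/w; ring.
rewrite rint_taylor_step// /c subrK factS natrM.
by rewrite !invfM; ring.
Qed.

Lemma sobolev_taylor k (f : W k) x : (0 < k)%N -> a < x < b ->
  deriv_at 0 f x =
  \sum_(j < k) deriv_at j f x0 * ((x - x0) ^+ j / j`!%:R)%:C +
  (k.-1`!%:R^-1)%:C *
    oint x0 x (fun t => ((x - t) ^+ k.-1)%:C * (weak_deriv k f : Lp) t).
Proof.
case: k f => [//|k] f _ xab /=; apply: part_inj => i.
rewrite (taylor_part i f (ltnSn k) xab) partD part_sum partM part_oint.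
congr (_ + _ * _); first by apply: eq_bigr => j _; rewrite [in RHS]mulrC partM mulrC.
apply: eq_rint => t bt; rewrite /= partM /lpart zextE//.
exact: between_itv xab bt.
Qed.

Lemma sobolev_eq_values k (f g : W k) : (0 < k)%N ->
  (forall x, a < x < b -> deriv_at 0 f x = deriv_at 0 g x) -> f = g.
Proof.
move=> k0 fg; apply: val_inj => /=; apply: clspace_ext; apply/ae_itv.
have /ae_itv H1 := weak_deriv_ae f k0; have /ae_itv H2 := weak_deriv_ae g k0.
move: H1 H2; apply: filterS2; first exact: (ae_filter_ringOfSetsType leb).
move=> x h1 h2 xab; apply: etrans (h1 xab) _; apply: etrans _ (esym (h2 xab)).
exact: fg.
Qed.

Lemma sobolev_data_inj k (f g : W k) : (0 < k)%N ->
  (forall j, (j < k)%N -> deriv_at j f x0 = deriv_at j g x0) ->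
  weak_deriv k f = weak_deriv k g -> f = g.
Proof.
move=> k0 fg fgk; apply: (sobolev_eq_values k0) => x xab.
apply: etrans (sobolev_taylor f k0 xab) _.
apply: etrans _ (esym (sobolev_taylor g k0 xab)).
apply: f_equal2; last by rewrite fgk.
by apply: eq_bigr => j _; rewrite (fg j (ltn_ord j)).
Qed.

Lemma sobolev_antiderivative (c : R[i]) (v : Lp) :
  exists u : Lp, weak_derivative 1 u v /\ ac_repr u x0 = c.
Proof.
pose h x := c - cprim v x0 + cprim v x.
have mfin : (mu setT < +oo)%E by have := @itv_measure_fin R a b; rewrite ge0_fin_numE.
pose B i := `|part i (c - cprim v x0)| + \int[leb]_t `|lpart i v t|.
have mh i : measurable_fun setT (part i \o h).
  rewrite (_ : _ \o _ = fun x => part i (c - cprim v x0) + primitive (lpart i v) x).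
    by apply: measurable_funD => //; apply: primitive_measurable; exact: lpart_integrable.
  by apply/funext => x; rewrite /h /= partD part_cprim.
have hB x : normc (h x) <= B false + B true.
  apply: le_trans (normc_part_le _) _.
  apply: lerD; rewrite /h partD part_cprim; apply: le_trans (ler_normD _ _) _;
    apply: lerD => //; apply: primitive_bounded; exact: lpart_integrable.
have hc : h \in clfun mu p by exact: (bounded_clfun p1 mfin (mh false) (mh true) hB).
pose h' : clfunType mu p1 := CLfun p1 hc.
exists (\pi_(clspace mu p1) h'); have uh : \forall x \ae mu, (\pi_(clspace mu p1) h' : Lp) x = h x.
  exact: clspace_piE.
split; first by apply/(weak_derivative1P ab); exists (c - cprim v x0).
by rewrite (ac_reprE (cprim_ac (c - cprim v x0) v))// subrK.
Qed.

(** Integrate v k times, the constants of integration being the c j. *)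
Lemma sobolev_data_surj k (c : nat -> R[i]) (v : Lp) : exists f : W k,
  weak_deriv k f = v /\ forall j, (j < k)%N -> deriv_at j f x0 = c j.
Proof.
have [g [gk gP]] : exists g : nat -> Lp, g k = v /\ forall j, (j < k)%N ->
    weak_derivative 1 (g j) (g j.+1) /\ ac_repr (g j) x0 = c j.
  elim: k c => [|k IH] c; first by exists (fun=> v).
  have [g [gk gP]] := IH (fun j => c j.+1).
  have [u [u1 u2]] := sobolev_antiderivative (c 0%N) (g 0%N).
  exists (fun j => if j is j'.+1 then g j' else u); split => // -[//|j] jk.
  exact: gP.
have gj j : (j <= k)%N -> weak_derivative j (g 0%N) (g j).
  elim: j => [_|j IH jk]; first exact: weak_derivative_refl.
  exact: weak_derivative_comp (IH (ltnW jk)) (gP j jk).1.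
have g0 : g 0%N \in sobolev_pred k.
  by apply/asboolP => j /andP[_ jk]; exists (g j); exact: gj.
exists (Sobolev g0); split; first by rewrite (weak_derivE (gj k (leqnn k))).
by move=> j jk; rewrite /deriv_at (weak_derivE (gj j (ltnW jk))); exact: (gP j jk).2.
Qed.

End SobolevData.

(** * Lebesgue measure with added atoms *)

Section MixedMeasure.
Context (R : realType) (a b : R) (k : nat).
Notation leb := (@lebesgue_measure R).
Local Notation mu := (itv_measure a b).

(** One point to the right of ]a, b[ for each anchored derivative. *)
Definition atom (j : nat) : R := b + 1 + j%:R.

Definition atoms (j : nat) : {measure set (measurableTypeR R) -> \bar R} :=
  @dirac _ (measurableTypeR R) (atom j) R.

Definition mixed : {measure set (measurableTypeR R) -> \bar R} :=
  @measure_add _ (measurableTypeR R) R mu (@msum _ (measurableTypeR R) R atoms k).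

Lemma mixedE A : mixed A = (mu A + \sum_(j < k) (\1_A (atom j))%:E)%E.
Proof. by rewrite [LHS]measure_addE. Qed.

Lemma atom_out j : ~~ (a < atom j < b).
Proof.
apply/negP => /andP[_]; rewrite /atom ltNge => /negP; apply.
by rewrite -addrA lerDl addr_ge0// ler0n.
Qed.

Lemma atom_eq i j : (atom i == atom j) = (i == j).
Proof. by rewrite /atom (inj_eq (addrI _)) eqr_nat. Qed.

Lemma mixed_fin : (mixed setT < +oo)%E.
Proof.
rewrite mixedE; apply: lte_add_pinfty.
  by have := @itv_measure_fin R a b; rewrite ge0_fin_numE.
by apply: lte_sum_pinfty => j _; rewrite ltry.
Qed.

Lemma ae_mixed (P : R -> Prop) : (\forall x \ae mixed, P x) <->
  (\forall x \ae mu, P x) /\ forall j, (j < k)%N -> P (atom j).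
Proof.
split=> [[A [mA A0 PA]]|[[A [mA A0 PA]] H]].
  have s0 : (0 <= \sum_(j < k) (\1_A (atom j) : R)%:E)%E.
    by apply: sume_ge0 => j _; rewrite lee_fin.
  have := A0; rewrite mixedE => /eqP; rewrite padde_eq0//.
  move=> /andP[/eqP mA0 /eqP sA0]; split; first by exists A.
  move=> j jk; apply: contrapT => nP.
  have Aj : A (atom j) by exact: PA.
  move: sA0; rewrite (bigD1 (Ordinal jk))//= indicE mem_set// => /eqP.
  rewrite padde_eq0 ?lee_fin//; first by rewrite eqe oner_eq0.
  by apply: sume_ge0 => i _; rewrite lee_fin.
have mat (D : set R) : D `<=` range atom -> measurable D.
  move=> DA; have cD : countable D.
    apply: sub_countable (card_le_trans (subset_card_le DA) (card_image_le _ _)) _.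
    exact: countableP.
  exact: countable_measurable.
pose B := range atom `&` ~` [set x | exists2 j, (j < k)%N & x = atom j].
have mB : measurable B by apply: mat; exact: subIsetl.
pose A' := (A `\` range atom) `|` ~` `]a, b[%classic `&` ~` [set x | exists2 j, (j < k)%N & x = atom j].
have mK : measurable [set x | exists2 j, (j < k)%N & x = atom j].
  by apply: mat => x /= [j _ ->]; exists j.
exists A'; split.
- apply: measurableU; first by apply: measurableD => //; exact: mat.
  by apply: measurableI; apply: measurableC => //; exact: measurable_itv.
- rewrite mixedE; apply/eqP; rewrite padde_eq0//; last first.
    by apply: sume_ge0 => j _; rewrite lee_fin.
  apply/andP; split; last first.
    rewrite big1// => j _; rewrite indicE memNset// => -[[_]|[_]] /=.
      by apply; exists j.
    by apply; exists j => //; exact: ltn_ord.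
  rewrite eq_le measure_ge0 andbT -A0 !itv_measureE; apply: le_measure; rewrite ?inE.
  + apply: measurableI; last exact: measurable_itv.
    apply: measurableU; first by apply: measurableD => //; exact: mat.
    by apply: measurableI; apply: measurableC => //; exact: measurable_itv.
  + by apply: measurableI => //; exact: measurable_itv.
  + by move=> x [[[Ax _]|[nx _]] xab].
move=> x /= nP.
have [[j jk xj]|nx] := pselect (exists2 j, (j < k)%N & x = atom j).
  by exfalso; apply: nP; rewrite xj; exact: H.
have [xab|xab] := pselect (`]a, b[%classic x); last by right.
left; split; first exact: PA.
move=> [j _ xj]; move: xab; rewrite /= in_itv /= -xj => h.
by move: (atom_out j); rewrite h.
Qed.

Lemma ge0_integral_mixed (h : R -> \bar R) : measurable_fun setT h ->
  (forall x, 0 <= h x)%E ->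
  (\int[mixed]_x h x = \int[mu]_x h x + \sum_(j < k) h (atom j))%E.
Proof.
move=> mh h0; rewrite ge0_integral_measure_add//; congr (_ + _)%E.
rewrite ge0_integral_measure_sum//; apply: eq_bigr => j _.
by rewrite integral_dirac// diracT mul1e.
Qed.

Lemma Lnorm_mixed (r : R) (h : R -> R) : measurable_fun setT h ->
  ('N[mixed]_r%:E[EFin \o h] =
   (\int[mu]_x (`|h x| `^ r)%:E + \sum_(j < k) (`|h (atom j)| `^ r)%:E) `^ r^-1)%E.
Proof.
move=> mh; rewrite unlock; congr (_ `^ _)%E.
rewrite (_ : (fun x => _) = fun x => (`|h x| `^ r)%:E); last by apply/funext => x.
rewrite ge0_integral_mixed//.
apply/measurable_EFinP/(@measurableT_comp _ _ _ _ _ _ (@powR R ^~ r)) => //.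
exact: measurableT_comp.
Qed.

End MixedMeasure.

(** * The Sobolev space as an L^p space *)

Definition anchored_value (R : realType) (p : \bar R) k (d : nat -> R) (c : R) : R :=
  match p with
  | r%:E => (\sum_(j < k) d j `^ r + c `^ r) `^ r^-1
  | +oo%E => Num.max (\big[Num.max/0]_(j < k) d j) c
  | -oo%E => 0
  end.

Section SobolevModel.
Context (R : realType) (a b x0 : R) (p : \bar R) (p1 : (1 <= p)%E) (k : nat).
Hypotheses (x0ab : a < x0 < b) (k_gt0 : (0 < k)%N).
Notation leb := (@lebesgue_measure R).
Local Notation mu := (itv_measure a b).
Local Notation Lp := (clspace mu p1).
Local Notation W := (sobolev a b p1 k).
Local Notation atom := (atom b).
Local Notation mixed := (mixed a b k).

Let p0 : (0 <= p)%E. Proof. exact: le_trans p1. Qed.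
Let ab : a < b. Proof. by case/andP: x0ab; exact: lt_trans. Qed.

Lemma clspace_clfun (u : Lp) : clspace_fun u \in clfun mu p.
Proof. by rewrite /clspace_fun; case: (generic_quotient.repr u). Qed.

Lemma clspace_norm (u : Lp) : ('N[mu]_p[EFin \o (@normc R \o u)])%E = (clnorm u)%:E.
Proof.
rewrite /clnorm fineK// ge0_fin_numE ?Lnorm_ge0//.
by have /asboolP[] := clspace_clfun u.
Qed.

Lemma clspace_meas (u : Lp) : measurable_fun setT (@normc R \o u).
Proof. by have /asboolP[mr mi _] := clspace_clfun u; exact: measurable_normc. Qed.

Lemma Lnorm_le_mixed (h : R -> R) : measurable_fun setT h ->
  ('N[mu]_p[EFin \o h] <= 'N[mixed]_p[EFin \o h])%E.
Proof.
move=> mh; case: (p) p0 => [r| |] //.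
  rewrite lee_fin => r0; rewrite Lnorm_mixed// unlock.
  rewrite (_ : (fun x => _) = fun x => (`|h x| `^ r)%:E)%E; last by apply/funext => x.
  have i0 : (0 <= \int[mu]_x (`|h x| `^ r)%:E)%E.
    by apply: integral_ge0 => x _; rewrite lee_fin powR_ge0.
  have s0 : (0 <= \sum_(j < k) (`|h (atom j)| `^ r)%:E)%E.
    by apply: sume_ge0 => j _; rewrite lee_fin powR_ge0.
  rewrite gt0_ler_poweR ?invr_ge0//.
  - by rewrite in_itv/= leey andbT.
  - by rewrite in_itv/= leey andbT adde_ge0.
  - by rewrite leeDl.
move=> _; rewrite unlock.
have le_mu A : (mu A <= mixed A)%E.
  by rewrite mixedE leeDl// sume_ge0// => j _; rewrite lee_fin.
case: ifPn => [mu0|_].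
  rewrite (lt_le_trans mu0 (le_mu _)); apply/ess_supP.
  have := ess_sup_ge mixed (abse \o (EFin \o h)).
  by move=> /ae_mixed[].
case: ifPn => // m0; apply: le_trans (ess_sup_gee m0 _); first exact: lexx.
by apply: nearW => x /=; rewrite lee_fin normr_ge0.
Qed.

(** f^(k) on the interval and f^(j)(x0) at the j-th atom. *)
Definition sobolev_eval (f : W) (x : R) : R[i] :=
  (if a < x < b then (weak_deriv k f : Lp) x else 0) +
  \sum_(j < k) (if x == atom j then deriv_at j f x0 else 0).
Local Notation ev := sobolev_eval.

Lemma sobolev_eval_in f x : a < x < b -> ev f x = (weak_deriv k f : Lp) x.
Proof.
move=> xab; rewrite /ev xab big1 ?addr0// => j _; case: eqP => // xj.
by move: (atom_out a b j); rewrite -xj xab.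
Qed.

Lemma sobolev_eval_atom f j : (j < k)%N -> ev f (atom j) = deriv_at j f x0.
Proof.
move=> jk; rewrite /ev (negbTE (atom_out a b j)) add0r (bigD1 (Ordinal jk))//= eqxx.
rewrite big1 ?addr0// => i ij; rewrite atom_eq; case: eqP => // ji.
by move: ij; rewrite -val_eqE /= ji eqxx.
Qed.

Lemma sobolev_eval_ae f : \forall x \ae mu, ev f x = (weak_deriv k f : Lp) x.
Proof. by apply/ae_itv; apply: nearW => x; exact: sobolev_eval_in. Qed.

Lemma sobolev_eval_part_meas i f : measurable_fun setT (part i \o ev f).
Proof.
rewrite (_ : _ \o _ = fun x => lpart i (weak_deriv k f) x +
    \sum_(j < k) \1_[set atom j] x * part i (deriv_at j f x0)).
  apply: measurable_funD.
    by apply/measurable_EFinP; exact: (measurable_int leb (lpart_integrable i _)).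
  by apply: measurable_sum => j; apply: measurable_funM.
apply/funext => x; rewrite /ev /= partD part_sum; congr (_ + _).
  rewrite /lpart; case: ifPn => [xab|xab]; first by rewrite zextE.
  by rewrite zext_out//; case: i.
apply: eq_bigr => j _; rewrite indicE in_set1; case: ifP => _; first by rewrite mul1r.
by rewrite mul0r; case: i.
Qed.

Lemma sobolev_eval_meas f : measurable_fun setT (@normc R \o ev f).
Proof.
exact: measurable_normc (sobolev_eval_part_meas false f) (sobolev_eval_part_meas true f).
Qed.

Lemma mixed_norm (e g : R -> R[i]) (d : nat -> R[i]) (c : R) :
  measurable_fun setT (@normc R \o e) -> measurable_fun setT (@normc R \o g) ->
  (\forall x \ae mu, e x = g x) -> (forall j, (j < k)%N -> e (atom j) = d j) ->
  ('N[mu]_p[EFin \o (@normc R \o g)] = c%:E)%E ->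
  ('N[mixed]_p[EFin \o (@normc R \o e)])%E =
    (anchored_value p k (fun j => normc (d j)) c)%:E.
Proof.
move=> mE mD ED dE; rewrite /anchored_value.
case: (p) p1 p0 => [r| |] //.
  rewrite !lee_fin => r1 r0 ND; have r_neq0 : r != 0 by rewrite gt_eqF// (lt_le_trans ltr01).
  have c0 : 0 <= c by rewrite -lee_fin -ND Lnorm_ge0.
  rewrite Lnorm_mixed//.
  have -> : (\int[mu]_x (`|(@normc R \o e) x| `^ r)%:E)%E = (c `^ r)%:E.
    rewrite -poweR_EFin -ND (poweR_Lnorm _ _ r_neq0); apply: ae_eq_integral.
    - exact: measurableT.
    - apply/measurable_EFinP/(@measurableT_comp _ _ _ _ _ _ (@powR R ^~ r)) => //.
      exact: measurableT_comp.
    - rewrite (_ : (fun x => _) = fun x => (`|normc (g x)| `^ r)%:E)%E; last by apply/funext => x.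
      apply/measurable_EFinP/(@measurableT_comp _ _ _ _ _ _ (@powR R ^~ r)) => //.
      exact: measurableT_comp.
    - move: ED; apply: filterS; first exact: (ae_filter_ringOfSetsType mu).
      by move=> x /= -> _.
  rewrite sumEFin -EFinD poweR_EFin; congr (_ `^ _)%:E; rewrite addrC; congr (_ + _).
  by apply: eq_bigr => j _; rewrite /= dE// ger0_norm ?normc_ge0.
move=> _ _; rewrite unlock.
have mu0 : (0 < mu setT)%E.
  rewrite itv_measureE setTI lebesgue_measure_itv/= lte_fin ab -EFinD lte_fin.
  by rewrite subr_gt0.
have mi0 : (0 < mixed setT)%E.
  apply: lt_le_trans mu0 _.
  by rewrite mixedE leeDl// sume_ge0// => j _; rewrite lee_fin.
rewrite mu0 mi0 => ND; apply/eqP; rewrite eq_le; apply/andP; split.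
  apply/ess_supP/ae_mixed; split.
    have := ess_sup_ge mu (abse \o (EFin \o (@normc R \o g))); rewrite ND.
    move: ED; apply: filterS2; first exact: (ae_filter_ringOfSetsType mu).
    move=> x /= -> H; apply: le_trans H _.
    by rewrite lee_fin le_max lexx orbT.
  move=> j jk /=; rewrite dE// lee_fin ger0_norm ?normc_ge0// le_max.
  apply/orP; left.
  exact: (le_bigmax _ (fun j : 'I_k => normc (d j)) (Ordinal jk)).
have := ess_sup_ge mixed (abse \o (EFin \o (@normc R \o e))).
move: (ess_sup _ _) => s /ae_mixed[H1 H2].
have H3 j : (j < k)%N -> ((normc (d j))%:E <= s)%E.
  move=> jk; rewrite -dE//; apply: le_trans (H2 j jk).
  by rewrite lee_fin ler_norm.
rewrite EFin_max ge_max; apply/andP; split.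
  elim/big_ind: _ => [|x y xs ys|j _]; last exact: H3.
  - by apply: le_trans (H3 _ k_gt0); rewrite lee_fin normc_ge0.
  - by rewrite EFin_max ge_max xs.
rewrite -ND; apply/ess_supP; move: ED H1.
apply: filterS2; first exact: (ae_filter_ringOfSetsType mu).
by move=> x /= ->.
Qed.

Lemma sobolev_eval_norm f :
  ('N[mixed]_p[EFin \o (@normc R \o ev f)])%E = (sobolev_norm x0 f)%:E.
Proof.
apply: (@mixed_norm _ (clspace_fun (weak_deriv k f)) (fun j => deriv_at j f x0)).
- exact: sobolev_eval_meas.
- exact: clspace_meas.
- exact: sobolev_eval_ae.
- by move=> j; exact: sobolev_eval_atom.
- exact: clspace_norm.
Qed.

(** All terms in the imaginary part of Taylor's formula vanish. *)
Lemma sobolev_cone_real (f : W) :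
  (\forall x \ae mu, 0 <= (weak_deriv k f : Lp) x) ->
  (forall j, (j < k)%N -> 0 <= deriv_at j f x0) -> \forall x \ae mu, Im (f x) = 0.
Proof.
have im0 (z : R[i]) : 0 <= z -> part true z = 0 by move=> /ge0_normc ->.
move=> D0 d0; have := weak_deriv_ae x0ab f k_gt0; rewrite /= => /ae_itv H; apply/ae_itv.
move: H; apply: filterS; first exact: (ae_filter_ringOfSetsType leb).
move=> x h xab; rewrite (h xab : f x = deriv_at 0 f x) -/(part true _).
have kk : (k.-1 < k)%N by rewrite prednK.
rewrite (taylor_part x0ab true f kk xab) big1 ?add0r => [|j _]; last first.
  by rewrite im0 ?mul0r// d0// (leq_trans (ltn_ord j)) // prednK.
have -> : rint x0 x (fun t => (x - t) ^+ k.-1 * lpart true (weak_deriv k.-1.+1 f) t) =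
    rint x0 x (fun=> 0).
  apply: ae_eq_rint => //.
    apply: measurable_funM; first by apply: measurable_funX; exact: measurable_funB.
    by apply/measurable_EFinP; exact: (measurable_int leb (lpart_integrable true _)).
  rewrite prednK//; move/ae_itv: D0; apply: filterS; first exact: (ae_filter_ringOfSetsType leb).
  move=> t ht bt; have tab := between_itv x0ab xab bt.
  by rewrite /lpart zextE// [X in _ * X](im0 _ (ht tab)) mulr0.
have -> : rint x0 x (fun=> 0 : R) = 0.
  by rewrite /rint; case: ifP => _; rewrite /Rintegral integral0_eq ?oppr0.
by rewrite mulr0.
Qed.

(** For finite p the atoms add the |f^(j)(x0)|^p to the p-th power of the norm;
    for p = oo they add the |f^(j)(x0)| to the values under the supremum. *)
Theorem sobolev_model : Lp_model p mixed (sobolev_eval : W_space k a b x0 p1 -> R -> R[i]).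
Proof.
split.
- move=> c u v; apply/ae_mixed; split.
    have L : \forall x \ae mu, (weak_deriv k (c *: (u : W) + v : W) : Lp) x =
        c * ev u x + ev v x.
      rewrite weak_deriv_lin//.
      by apply: filterS3 (clspace_linE c (weak_deriv k u) (weak_deriv k v : Lp))
        (sobolev_eval_ae u) (sobolev_eval_ae v) => x -> -> ->.
    move: (sobolev_eval_ae (c *: (u : W) + v)) L.
    apply: filterS2; first exact: (ae_filter_ringOfSetsType mu).
    by move=> x ->.
  by move=> j jk; rewrite !sobolev_eval_atom// (deriv_at_lin x0ab).
- move=> u v /ae_mixed[H1 H2]; apply: (sobolev_data_inj x0ab k_gt0) => [j jk|].
    by have := H2 j jk; rewrite !sobolev_eval_atom.
  apply: clspace_ext; move: (sobolev_eval_ae u) (sobolev_eval_ae v) H1.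
  by apply: filterS3; [exact: (ae_filter_ringOfSetsType mu) | move=> x -> ->].
- move=> u; apply/asboolP; split; [exact: (sobolev_eval_part_meas false) |
    exact: (sobolev_eval_part_meas true) |].
  by rewrite sobolev_eval_norm ltry.
- move=> h /asboolP[mr mi hfin].
  have hc : h \in clfun mu p.
    apply/asboolP; split => //; apply: le_lt_trans hfin; apply: Lnorm_le_mixed.
    exact: measurable_normc.
  pose h' : clfunType mu p1 := CLfun p1 hc.
  have [f [fk fj]] := sobolev_data_surj x0ab k (fun j => h (atom j)) (\pi_(clspace mu p1) h').
  exists f; apply/ae_mixed; split; last by move=> j jk; rewrite sobolev_eval_atom// fj.
  move: (sobolev_eval_ae f) (clspace_piE h'); apply: filterS2; first exact: (ae_filter_ringOfSetsType mu).
  by move=> x -> hx; rewrite fk; exact: hx.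
- by move=> u; rewrite sobolev_eval_norm.
- move=> u; split=> [[_ H1 H2]|/ae_mixed[H1 H2]].
    apply/ae_mixed; split; last by move=> j jk; rewrite sobolev_eval_atom// H2.
    by move: (sobolev_eval_ae u) H1; apply: filterS2; [exact: (ae_filter_ringOfSetsType mu) | move=> x ->].
  have D0 : \forall x \ae mu, 0 <= (weak_deriv k u : Lp) x.
    by move: (sobolev_eval_ae u) H1; apply: filterS2; [exact: (ae_filter_ringOfSetsType mu) | move=> x ->].
  have d0 j : (j < k)%N -> 0 <= deriv_at j u x0 by move=> jk; have := H2 j jk; rewrite sobolev_eval_atom.
  split => //; exact: sobolev_cone_real.
Qed.

End SobolevModel.

(** * Coordinates of a Sobolev function *)

Lemma Lp_space_model (R : realType) (a b : R) (p : \bar R) (p1 : (1 <= p)%E) :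
  Lp_model p (itv_measure a b)
    (@clspace_fun _ _ _ _ _ _ : Lp_space a b p1 -> R -> R[i]).
Proof.
split.
- by move=> c u v; exact: clspace_linE.
- by move=> u v; exact: clspace_ext.
- by move=> u; exact: clspace_clfun.
- move=> h hc; exists (\pi_(clspace (itv_measure a b) p1) (CLfun p1 hc)).
  exact: (clspace_piE (CLfun p1 hc)).
- by [].
- by [].
Qed.

Lemma anchored_value_top (R : realType) (p : \bar R) k (d : nat -> R) (c : R) :
  (1 <= p)%E -> 0 <= c -> (forall j, (j < k)%N -> d j = 0) -> anchored_value p k d c = c.
Proof.
rewrite /anchored_value; case: p => [r| |] // r1 c0 d0; last first.
  rewrite max_r//; apply/bigmax_leP; split=> // j _; by rewrite d0.
have r_neq0 : r != 0 by rewrite gt_eqF// (lt_le_trans ltr01).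
rewrite big1 ?add0r => [|j _]; last by rewrite d0// powR0.
by rewrite -powRrM mulfV// powRr1.
Qed.

Lemma anchored_value_mono (R : realType) (p : \bar R) k (d : nat -> R) i :
  (1 <= p)%E -> (i < k)%N -> (forall j, (j < k)%N -> d j = (j == i)%:R) ->
  anchored_value p k d 0 = 1.
Proof.
rewrite /anchored_value; case: p => [r| |] // r1 ik dE; last first.
  apply/eqP; rewrite eq_le ge_max ler01 andbT le_max; apply/andP; split.
    by apply/bigmax_leP; split=> [|j _]; rewrite ?ler01// dE//; case: eqP.
  apply/orP; left; have := le_bigmax 0 (fun j : 'I_k => d j) (Ordinal ik).
  by rewrite /= dE// eqxx.
have r_neq0 : r != 0 by rewrite gt_eqF// (lt_le_trans ltr01).
rewrite (bigD1 (Ordinal ik))//= dE// eqxx powR1 big1 => [|j]; last first.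
  by rewrite -val_eqE /= dE// => /negbTE ->; rewrite powR0.
by rewrite powR0// !addr0 powR1.
Qed.

Section DataLevel.
Context (R : realType) (a b x0 : R) (p : \bar R) (p1 : (1 <= p)%E) (k : nat).
Hypotheses (x0ab : a < x0 < b) (k_gt0 : (0 < k)%N).
Local Notation mu := (itv_measure a b).
Local Notation Lp := (clspace mu p1).
Local Notation W := (sobolev a b p1 k).
Local Notation E := (W_space k a b x0 p1).

Definition anchor (j : nat) (f : W) : R[i] := deriv_at j f x0.
Definition top_deriv (f : W) : Lp := weak_deriv k f.

Lemma anchor_lin j : (j < k)%N -> forall (c : R[i]) (f g : W),
  anchor j (c *: f + g) = c * anchor j f + anchor j g.
Proof. by move=> jk c f g; rewrite /anchor (deriv_at_lin x0ab). Qed.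

Lemma top_deriv_lin : linear top_deriv.
Proof. by move=> c f g; rewrite /top_deriv weak_deriv_lin. Qed.

Lemma top_derivD (f g : W) : top_deriv (f + g) = top_deriv f + top_deriv g.
Proof. exact: (linear_add top_deriv_lin). Qed.

Lemma top_derivZ c (f : W) : top_deriv (c *: f) = c *: top_deriv f.
Proof. exact: (linear_scale top_deriv_lin). Qed.

Lemma top_derivB (f g : W) : top_deriv (f - g) = top_deriv f - top_deriv g.
Proof. exact: (linear_sub top_deriv_lin). Qed.

Lemma anchorD j f g : (j < k)%N -> anchor j (f + g) = anchor j f + anchor j g.
Proof. by move=> jk; have := anchor_lin jk 1 f g; rewrite scale1r mul1r. Qed.

Lemma anchor0 j : (j < k)%N -> anchor j 0 = 0.
Proof. by move=> jk; have := anchor_lin jk (-1) 0 0; rewrite scaler0 addr0 mulN1r addNr. Qed.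

Lemma anchorZ j c f : (j < k)%N -> anchor j (c *: f) = c * anchor j f.
Proof. by move=> jk; have := anchor_lin jk c f 0; rewrite !addr0 anchor0// addr0. Qed.

Lemma anchorB j f g : (j < k)%N -> anchor j (f - g) = anchor j f - anchor j g.
Proof. by move=> jk; rewrite anchorD// -scaleN1r anchorZ// mulN1r. Qed.

Lemma anchor_sum j (F : 'I_k -> W) : (j < k)%N ->
  anchor j (\sum_(i < k) F i) = \sum_(i < k) anchor j (F i).
Proof.
by move=> jk; apply: (big_morph (anchor j)) => [f g|]; [exact: anchorD | exact: anchor0].
Qed.

Lemma data_inj (f g : W) : (forall j, (j < k)%N -> anchor j f = anchor j g) ->
  top_deriv f = top_deriv g -> f = g.
Proof. exact: (sobolev_data_inj x0ab k_gt0). Qed.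

Definition of_data (c : nat -> R[i]) (v : Lp) : W :=
  sval (cid (sobolev_data_surj x0ab k c v)).

Lemma top_of_data c v : top_deriv (of_data c v) = v.
Proof. by rewrite /of_data; case: cid => f []. Qed.

Lemma anchor_of_data c v j : (j < k)%N -> anchor j (of_data c v) = c j.
Proof. by move=> jk; have [_ H] := svalP (cid (sobolev_data_surj x0ab k c v)); exact: H. Qed.

(** The k-fold iterated integral of v based at x0. *)
Definition iter_int (v : Lp) : W := of_data (fun=> 0) v.
(** The data of (x - x0)^j / j!. *)
Definition taylor_mono (j : nat) : W := of_data (fun i => (i == j)%:R) 0.

Lemma iter_int_lin : linear iter_int.
Proof.
move=> c u v; apply: data_inj => [j jk|].
  by rewrite anchor_lin// !anchor_of_data// mulr0 addr0.
by rewrite top_deriv_lin !top_of_data.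
Qed.

Lemma iter_int0 : iter_int 0 = 0.
Proof. exact: (linear_zero iter_int_lin). Qed.

Lemma iter_intB u v : iter_int (u - v) = iter_int u - iter_int v.
Proof. exact: (linear_sub iter_int_lin). Qed.

Lemma iter_int_top f : (forall j, (j < k)%N -> anchor j f = 0) -> f = iter_int (top_deriv f).
Proof.
move=> f0; apply: data_inj => [j jk|]; last by rewrite top_of_data.
by rewrite f0// /iter_int anchor_of_data.
Qed.

Lemma data_decomposition f : f = \sum_(j < k) anchor j f *: taylor_mono j + iter_int (top_deriv f).
Proof.
apply: data_inj => [j jk|].
  rewrite anchorD// anchor_sum// anchor_of_data// addr0 (bigD1 (Ordinal jk))//=.
  rewrite anchorZ// anchor_of_data// eqxx mulr1 big1 ?addr0// => i ij.
  rewrite anchorZ// anchor_of_data//; move: ij; rewrite -val_eqE /= eq_sym => /negbTE ->.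
  by rewrite mulr0.
rewrite top_derivD (linear_bigsum top_deriv_lin) top_of_data big1 ?add0r// => j _.
by rewrite top_derivZ top_of_data scaler0.
Qed.

Lemma cone_data (f : E) : onv_cone f <->
  (\forall x \ae mu, 0 <= top_deriv f x) /\ forall j, (j < k)%N -> 0 <= anchor j f.
Proof.
split=> [[_ H1 H2]|[H1 H2]]; first by [].
split; [exact: (sobolev_cone_real x0ab k_gt0 H1 H2) | exact: H1 | exact: H2].
Qed.

Lemma cone_iter_int v : onv_cone (iter_int v : E) <-> onv_cone (v : Lp_space a b p1).
Proof.
split=> [/cone_data[]|v0]; first by rewrite top_of_data.
apply/cone_data; split=> [|j jk]; first by rewrite top_of_data.
by rewrite anchor_of_data.
Qed.

Lemma cone_taylor_mono j : onv_cone (taylor_mono j : E).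
Proof.
apply/cone_data; split=> [|i ik]; last by rewrite anchor_of_data// ler0n.
rewrite top_of_data; have := model_0 (Lp_space_model a b p1).
by apply: filterS => x /= ->.
Qed.

Lemma clnorm0 : clnorm (0 : Lp) = 0.
Proof. exact: (model_norm0 p1 (Lp_space_model a b p1)). Qed.

Lemma norm_iter_int v : onv_norm (iter_int v : E) = clnorm v.
Proof.
transitivity (anchored_value p k (fun j => normc (anchor j (iter_int v))) (clnorm (top_deriv (iter_int v)))).
  by [].
rewrite top_of_data; apply: anchored_value_top p1 _ _.
  exact: (model_norm_ge0 (Lp_space_model a b p1) v).
by move=> j jk; rewrite anchor_of_data// normc0.
Qed.

Lemma norm_mono j : (j < k)%N -> onv_norm (taylor_mono j : E) = 1.
Proof.
move=> jk; transitivity (anchored_value p k (fun i => normc (anchor i (taylor_mono j))) (clnorm (top_deriv (taylor_mono j)))).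
  by [].
rewrite top_of_data clnorm0; apply: (anchored_value_mono p1 jk) => i ik.
by rewrite anchor_of_data//; case: (i == j); rewrite ?normc0 ?normc1.
Qed.

End DataLevel.

(** * Extremal rays of the Sobolev cone *)

Definition extremal (A : pzRingType) (V : lmodType A) (K : set V) (e : V) :=
  [/\ K e, e <> 0 & forall g, K g -> K (e - g) -> exists c : A, g = c *: e].

Section ExtremalRays.
Context (R : realType) (a b x0 : R) (p : \bar R) (p1 : (1 <= p)%E) (k : nat).
Hypotheses (x0ab : a < x0 < b) (k_gt0 : (0 < k)%N).
Notation leb := (@lebesgue_measure R).
Local Notation mu := (itv_measure a b).
Local Notation Lp := (clspace mu p1).
Local Notation W := (sobolev a b p1 k).
Local Notation K := (@sobolev_cone _ _ _ _ p1 k x0 : set W).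
Local Notation anchor := (anchor x0).
Local Notation taylor_mono := (taylor_mono p1 k x0ab).
Local Notation iter_int := (iter_int k x0ab).

Let ab : a < b. Proof. by case/andP: x0ab; exact: lt_trans. Qed.

Let Rint0 (D : set R) : \int[leb]_(x in D) 0 = 0.
Proof. by rewrite /Rintegral integral0. Qed.

Lemma coneP (f : W) : K f <->
  (\forall x \ae mu, 0 <= top_deriv f x) /\ forall j, (j < k)%N -> 0 <= anchor j f.
Proof. exact: (cone_data x0ab k_gt0). Qed.

Lemma ge0_Re (z : R[i]) : 0 <= z -> z = (Re z)%:C.
Proof. by move=> /ge0_normc ->. Qed.

Lemma ge0_opp_eq0 (z : R[i]) : 0 <= z -> 0 <= - z -> z = 0.
Proof. by move=> z0; rewrite oppr_ge0 => z1; apply/eqP; rewrite eq_le z1. Qed.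

Lemma mono_extremal j : (j < k)%N -> extremal K (taylor_mono j).
Proof.
move=> jk; split; first exact: (cone_taylor_mono p1 x0ab k_gt0 j).
  move=> m0; have := @anchor_of_data _ _ _ _ _ p1 k x0ab (fun i => (i == j)%:R) 0 j jk.
  rewrite -/(taylor_mono j) m0 anchor0// eqxx => /esym/eqP.
  by rewrite oner_eq0.
move=> g /coneP[g0 gc] /coneP[h0 hc]; exists (anchor j g).
apply: (data_inj x0ab k_gt0) => [i ik|].
  rewrite anchorZ// anchor_of_data//.
  have := hc i ik; rewrite anchorB// anchor_of_data//.
  case: eqP => [->|_]; first by rewrite mulr1.
  by rewrite sub0r mulr0 => h; apply: ge0_opp_eq0 => //; exact: gc.
rewrite top_derivZ top_of_data scaler0.
have M := Lp_space_model a b p1.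
have := h0; rewrite top_derivB top_of_data sub0r => h0'.
exact: (@model_cone_add0 _ _ _ _ _ _ _ M (top_deriv g) (- top_deriv g) g0 h0' (subrr _)).
Qed.

Lemma Lp_cut (v : Lp) t : exists u : Lp,
  \forall x \ae mu, u x = if x <= t then (Re (v x))%:C else 0.
Proof.
have M := Lp_space_model a b p1.
have mRe : measurable_fun setT (@Re R \o v) by have [] := model_meas M v.
have [||u H] := @model_surj_dom _ _ p1 _ _ _ _ _ M
  (fun x => \1_`]-oo, t] x * Re (v x)) v.
- by apply: measurable_funM => //; exact: measurable_indic.
- move=> x; rewrite indicE; case: (x \in _); rewrite ?mul1r ?mul0r ?normr0 ?normc_ge0//.
  exact: normr_Re_le.
exists u; apply: filterS H => x ->; rewrite indicE mem_setE in_itv /=.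
by case: ifP; rewrite ?mul1r ?mul0r.
Qed.

(** Cut v >= 0 at the point t that halves its integral.  The left part gives an
    element below the iterated integral of v; if it is a multiple c v of v, then
    v vanishes on the left of t when c = 0 and on the right of t otherwise, so
    half of the integral, hence v, is zero. *)
Lemma iter_int_not_extremal (v : Lp) : ~ extremal K (iter_int v).
Proof.
have M := Lp_space_model a b p1.
move=> [/coneP[] + _ lv0 ext]; rewrite top_of_data => v0; apply: lv0.
suff -> : v = 0 by rewrite (iter_int0 p1 x0ab k_gt0).
pose w x := `|lpart false v x|.
have iv := lpart_integrable false v.
have iw : leb.-integrable setT (EFin \o w) by have := integrable_norm iv.
have mw : measurable_fun setT w by apply/measurable_EFinP; exact: (measurable_int leb iw).
have w_out x : ~~ (a < x < b) -> w x = 0 by move=> h; rewrite /w /lpart zext_out// normr0.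
have Pa : primitive w a = 0.
  rewrite /primitive -[RHS](Rint0 `]-oo, a]); apply: eq_Rintegral => x.
  by rewrite inE /= in_itv /= => xa; rewrite w_out// negb_and -leNgt xa.
have Pge0 : 0 <= primitive w b by apply: Rintegral_ge0 => x _; exact: normr_ge0.
have [t tab Pt] : exists2 t, t \in `[a, b]%R & primitive w t = primitive w b / 2.
  apply: (IVT (ltW ab)).
    by apply: continuous_subspaceT; exact: primitive_continuous.
  by rewrite Pa min_l// max_r//; lra.
move: tab; rewrite in_itv /= => /andP[ta tb].
have [u uE] := Lp_cut v t.
have Ku : K (iter_int u).
  apply/(cone_iter_int x0ab k_gt0).
  rewrite /= /clcone /=; apply: filterS2 uE v0 => x -> vx; case: ifP => // _.
  by rewrite -(ge0_Re vx).
have Kvu : K (iter_int v - iter_int u).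
  rewrite -(iter_intB x0ab k_gt0); apply/(cone_iter_int x0ab k_gt0).
  have H := model_B M v u; rewrite /= /clcone /=; apply: filterS3 H uE v0 => x -> -> vx.
  by case: ifP => _; rewrite ?subr0// -(ge0_Re vx) subrr.
have [c uc] := ext _ Ku Kvu.
have {}uc : u = c *: v.
  by have := congr1 (@top_deriv _ _ _ _ p1 k) uc; rewrite top_derivZ !top_of_data.
have ucE : {ae leb, forall x, a < x < b -> (if x <= t then v x else 0) = c * v x}.
  apply/ae_itv; have H := model_Z M c v; rewrite -uc in H.
  by apply: filterS3 H uE v0 => x <- -> vx; rewrite -(ge0_Re vx).
have Pb : primitive w b = 0.
  have [c0|/eqP c0] := eqVneq c 0.
    have : primitive w t = 0.
      rewrite /primitive -[RHS](Rint0 `]-oo, t]); congr fine.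
      apply: ae_eq_integral; [by [] | by apply/measurable_EFinP; exact: measurable_funTS | by [] |].
      move: ucE; apply: filterS; first exact: (ae_filter_ringOfSetsType leb).
      move=> x H; rewrite /= in_itv /= => xt; congr (_%:E).
      have [xab|/w_out//] := boolP (a < x < b).
      by rewrite /w /lpart zextE//=; move: (H xab); rewrite xt c0 mul0r => ->; rewrite normr0.
    lra.
  have : primitive w b - primitive w t = 0.
    rewrite primitiveB//.
    rewrite -[RHS](Rint0 `]t, b]); congr fine.
    apply: ae_eq_integral; [by [] | by apply/measurable_EFinP; exact: measurable_funTS | by [] |].
    move: ucE; apply: filterS; first exact: (ae_filter_ringOfSetsType leb).
    move=> x H; rewrite /= in_itv /= => /andP[tx xb]; congr (_%:E).
    have [xab|/w_out//] := boolP (a < x < b).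
    rewrite /w /lpart zextE//=; move: (H xab); rewrite leNgt tx /= => /esym/eqP.
    by rewrite mulf_eq0 => /orP[/eqP//|/eqP ->]; rewrite normr0.
  lra.
have mb : measurable (`]-oo, b]%classic : set R) by exact: measurable_itv.
have w0 : {ae leb, forall x, x <= b -> w x = 0}.
  have : (\int[leb]_(x in `]-oo, b]) `|(w x)%:E| = 0)%E.
    transitivity (primitive w b)%:E; last by rewrite Pb.
    rewrite /primitive fineK; first by apply: eq_integral => x _; rewrite /= normr_id.
    exact: (@integrable_fin_num _ _ R leb _ mb _ (integrable_sub iw mb)).
  have mwE : measurable_fun `]-oo, b] (EFin \o w) by apply/measurable_EFinP; exact: measurable_funTS.
  move=> /(ae_eq_integral_abs leb mb mwE) w0.
  apply: (@filterS _ _ (ae_filter_ringOfSetsType leb) _ _ _ w0).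
  by move=> x H xb; have := H; rewrite /= in_itv /= => /(_ xb) [].
apply: (model_inj M); apply/ae_itv; have /ae_itv v0' := v0.
have /ae_itv z0 := model_0 M.
move: w0 v0' z0; apply: filterS3; first exact: (ae_filter_ringOfSetsType leb).
move=> x wx vx zx xab; rewrite (zx xab) (ge0_Re (vx xab)).
have /andP[_ /ltW xb] := xab.
by move: (wx xb); rewrite /w /lpart zextE// => /eqP; rewrite normr_eq0 => /eqP /= ->.
Qed.

Lemma cone_sub_mono e j : (j < k)%N -> K e ->
  K (anchor j e *: taylor_mono j) /\ K (e - anchor j e *: taylor_mono j).
Proof.
move=> jk /coneP[e0 ec]; split; apply/coneP; split.
- rewrite top_derivZ top_of_data scaler0.
  by apply: filterS (model_0 (Lp_space_model a b p1)) => x /= ->.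
- by move=> i ik; rewrite anchorZ// anchor_of_data//; apply: mulr_ge0; [exact: ec | exact: ler0n].
- by rewrite top_derivB top_derivZ top_of_data scaler0 subr0.
- move=> i ik; rewrite anchorB// anchorZ// anchor_of_data//.
  by case: eqP => [->|_]; rewrite ?mulr1 ?subrr ?mulr0 ?subr0//; exact: ec.
Qed.

(** By [iter_int_not_extremal] some anchored value of e is nonzero, and the
    corresponding multiple of a Taylor monomial lies below e. *)
Lemma extremal_mono e : extremal K e -> exists j c,
  [/\ (j < k)%N, 0 <= c, c != 0 & e = c *: taylor_mono j].
Proof.
move=> He; have [Ke en ext] := He; have /coneP[e0 ec] := Ke.
have [[j jk cj]|H] := pselect (exists2 j, (j < k)%N & anchor j e != 0); last first.
  exfalso; apply: (@iter_int_not_extremal (top_deriv e)).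
  rewrite -iter_int_top// => j jk; apply: contrapT => /eqP cj; apply: H; by exists j.
exists j, (anchor j e); split => //; first exact: ec.
have [Kg Kd] := cone_sub_mono jk Ke.
have [c gc] := ext _ Kg Kd.
have := congr1 (anchor j) gc; rewrite !anchorZ// anchor_of_data// eqxx mulr1 => cc.
have c1 : c = 1 by apply: (mulIf cj); rewrite -cc mul1r.
by rewrite gc c1 scale1r.
Qed.

End ExtremalRays.

(** * Isomorphisms in coordinates *)

Section Rigidity.
Context (R : realType) (a1 b1 x1 a2 b2 x2 : R) (p : \bar R) (p1 : (1 <= p)%E) (k : nat).
Hypotheses (x1ab : a1 < x1 < b1) (x2ab : a2 < x2 < b2) (k_gt0 : (0 < k)%N).
Local Notation W1 := (sobolev a1 b1 p1 k).
Local Notation W2 := (sobolev a2 b2 p1 k).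
Local Notation E1 := (W_space k a1 b1 x1 p1).
Local Notation E2 := (W_space k a2 b2 x2 p1).
Local Notation L1 := (Lp_space a1 b1 p1).
Local Notation L2 := (Lp_space a2 b2 p1).
Local Notation K1 := (@sobolev_cone _ _ _ _ p1 k x1 : set W1).
Local Notation K2 := (@sobolev_cone _ _ _ _ p1 k x2 : set W2).
Local Notation mono1 := (taylor_mono p1 k x1ab).
Local Notation mono2 := (taylor_mono p1 k x2ab).
Local Notation iter_int1 := (iter_int k x1ab).
Local Notation iter_int2 := (iter_int k x2ab).

Let M1 := sobolev_model p1 x1ab k_gt0.
Let M2 := sobolev_model p1 x2ab k_gt0.

Section OneIso.
Variable Phi : W1 -> W2.
Hypothesis iso : @isometric_order_iso R E1 E2 Phi.

Let lin : linear Phi. Proof. by case: iso. Qed.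
Let surj g : exists f, Phi f = g. Proof. by case: iso => _ + _ _ _; apply. Qed.

Let normP (f : W1) : onv_norm (Phi f : E2) = onv_norm (f : E1).
Proof.
have [_ _ H _ _] := iso; have := H f 0.
have -> : Phi 0 = 0 by exact: (linear_zero lin).
by rewrite !subr0.
Qed.

Let coneE (f : W1) : K2 (Phi f) <-> K1 f.
Proof.
have [_ _ _ _ H] := iso; have := congr1 (fun A : set W1 => A f) H.
by rewrite /preimage /= => ->.
Qed.

Let Phi_inj : injective Phi.
Proof.
move=> f g fg; apply/eqP; rewrite -subr_eq0; apply/eqP; apply: (model_norm_eq0 p1 M1).
rewrite -normP (linear_sub lin) fg subrr; exact: (model_norm0 p1 M2).
Qed.

Lemma iso_extremal e : extremal K1 e -> extremal K2 (Phi e).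
Proof.
move=> [Ke en ext]; split; first exact/coneE.
  by rewrite -(linear_zero lin) => /Phi_inj.
move=> g; have [f <-] := surj g; move=> /coneE Kf.
rewrite -(linear_sub lin) => /coneE Kef.
by have [c ->] := ext _ Kf Kef; exists c; rewrite (linear_scale lin).
Qed.

(** The image is a positive multiple of a monomial, and monomials have norm 1. *)
Lemma iso_mono (j : 'I_k) : exists i : 'I_k, Phi (mono1 j) = mono2 i.
Proof.
have [i [c [ik c0 cn Ec]]] := extremal_mono x2ab k_gt0 (iso_extremal (mono_extremal p1 x1ab k_gt0 (ltn_ord j))).
exists (Ordinal ik); rewrite Ec /=.
have cE := ge0_normc c0.
suff c1 : normc c = 1 by rewrite cE c1 scale1r.
have := normP (mono1 j); rewrite Ec norm_mono// {1}cE => <-.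
by rewrite (model_normZ p1 M2) ?normc_ge0// norm_mono// mulr1.
Qed.

(** The permutation is the action on the monomials.  The isometry L of L^p comes
    from the fact that Phi preserves the iterated integrals, on which norm and
    cone are those of the top derivative. *)
Lemma iso_data : exists (s : 'S_k) (L : L1 -> L2), isometric_order_iso L /\
  forall f, (forall j : 'I_k, anchor x2 j (Phi f) = anchor x1 (s j) f) /\
    top_deriv (Phi f) = L (top_deriv f).
Proof.
have [t tP] := choice iso_mono.
have t_inj : injective t.
  move=> i j tij; have mij : mono1 i = mono1 j by apply: Phi_inj; rewrite !tP tij.
  have := congr1 (anchor x1 i) mij; rewrite !anchor_of_data// eqxx => /eqP.
  by rewrite eq_sym pnatr_eq1 eqb1 => /eqP/val_inj.
pose s := ((perm t_inj)^-1)%g.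
have Phis (j : 'I_k) : Phi (mono1 (s j)) = mono2 j.
  by rewrite tP -(permE t_inj) permKV.
(* A nonzero j-th anchored value of the image would put a multiple of the j-th
   monomial below it, hence one of a monomial below the iterated integral. *)
have anchor_ge0 v (j : 'I_k) : onv_cone (v : L1) -> anchor x2 j (Phi (iter_int1 v)) = 0.
  move=> v0; set h := Phi _; have Kh : K2 h by apply/coneE/(cone_iter_int x1ab k_gt0).
  have [_] := cone_sub_mono x2ab k_gt0 (ltn_ord j) Kh.
  have /(coneP x2ab k_gt0)[_ /(_ j (ltn_ord j))] := Kh.
  set c := anchor x2 j h => c0.
  rewrite -Phis -(linear_scale lin) -(linear_sub lin) => /coneE/(coneP x1ab k_gt0)[_].
  move=> /(_ _ (ltn_ord (s j))); rewrite anchorB// anchorZ// !anchor_of_data// eqxx mulr1 sub0r.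
  exact: ge0_opp_eq0.
have anchor_int v (j : 'I_k) : anchor x2 j (Phi (iter_int1 v)) = 0.
  have [a [b [c [d [Ka Kb Kc Kd ->]]]]] := model_cone_gen p1 (Lp_space_model a1 b1 p1) v.
  rewrite (linear_add (iter_int_lin x1ab k_gt0)) (linear_scale (iter_int_lin x1ab k_gt0)).
  rewrite !(iter_intB x1ab k_gt0) (linear_add lin) (linear_scale lin) !(linear_sub lin).
  by rewrite anchorD// anchorZ// !anchorB// !anchor_ge0// !subrr mulr0 addr0.
pose L (v : L1) : L2 := top_deriv (Phi (iter_int1 v)).
have PhiL v : Phi (iter_int1 v) = iter_int2 (L v).
  apply: (iter_int_top x2ab k_gt0) => j jk; exact: (anchor_int v (Ordinal jk)).
have decomp f : Phi f = \sum_(j < k) anchor x1 j f *: mono2 (t j) + iter_int2 (L (top_deriv f)).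
  rewrite {1}(data_decomposition x1ab k_gt0 f) (linear_add lin) (linear_bigsum lin) PhiL.
  by congr (_ + _); apply: eq_bigr => j _; rewrite (linear_scale lin) tP.
have anchorPhi f (j : 'I_k) : anchor x2 j (Phi f) = anchor x1 (s j) f.
  rewrite decomp anchorD// anchor_sum// anchor_of_data// addr0 (bigD1 (s j))//=.
  rewrite anchorZ// anchor_of_data// -(permE t_inj) permKV eqxx mulr1.
  rewrite big1 ?addr0// => i ij; rewrite anchorZ// anchor_of_data//.
  case: eqP => [jt|_]; last by rewrite mulr0.
  move: ij; rewrite (_ : i = s j) ?eqxx//; apply: (@perm_inj _ (perm t_inj)).
  by rewrite permKV permE; apply: val_inj.
have topPhi f : top_deriv (Phi f) = L (top_deriv f).
  rewrite decomp top_derivD (linear_bigsum (@top_deriv_lin _ _ _ _ _ _)) top_of_data.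
  by rewrite big1 ?add0r// => j _; rewrite top_derivZ top_of_data scaler0.
have Llin : linear L.
  by move=> c u v; rewrite /L (iter_int_lin x1ab k_gt0) lin top_deriv_lin.
have Lcone v : onv_cone (L v) <-> onv_cone v.
  split=> [H|H].
    apply/(cone_iter_int x1ab k_gt0)/coneE; rewrite PhiL; exact/(cone_iter_int x2ab k_gt0).
  by apply/(cone_iter_int x2ab k_gt0); rewrite -PhiL; apply/coneE/(cone_iter_int x1ab k_gt0).
have Lsurj w : exists v, L v = w.
  have [f fw] := surj (iter_int2 w); exists (top_deriv f).
  by rewrite -topPhi fw top_of_data.
exists s, L; split; last by [].
split => //.
- move=> u v; rewrite -(linear_sub Llin).
  have -> : onv_norm (L (u - v)) = onv_norm (iter_int2 (L (u - v)) : E2) by rewrite norm_iter_int.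
  by rewrite -PhiL normP norm_iter_int.
- apply/seteqP; split => [w [v Kv <-]|w Kw]; first exact/Lcone.
  by have [v vw] := Lsurj w; exists v => //; apply/Lcone; rewrite vw.
- by apply/seteqP; split => v; rewrite /preimage /= => /Lcone.
Qed.

End OneIso.
End Rigidity.

(** Taylor's formula also holds for the function with data c and v, and
    a function is determined by its values. *)
Lemma formula_data (R : realType) (a b x0 : R) (p : \bar R) (p1 : (1 <= p)%E) k
    (x0ab : a < x0 < b) (k_gt0 : (0 < k)%N) (f : sobolev a b p1 k)
    (c : 'I_k -> R[i]) (v : clspace (itv_measure a b) p1) :
  (forall x, a < x < b -> deriv_at 0 f x =
    \sum_(j < k) c j * ((x - x0) ^+ j / (j`!)%:R)%:C +
    ((((k.-1)`!)%:R)^-1)%:C * oint x0 x (fun t => ((x - t) ^+ k.-1)%:C * v t)) <->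
  (forall j : 'I_k, anchor x0 j f = c j) /\ top_deriv f = v.
Proof.
split=> [H|[H <-] x xab]; last first.
  apply: etrans (sobolev_taylor x0ab f k_gt0 xab) _.
  by congr (_ + _); apply: eq_bigr => j _; rewrite -H.
pose c' j := if insub j is Some i then c i else 0.
have c'E (j : 'I_k) : c' j = c j by rewrite /c' valK.
suff -> : f = of_data k x0ab c' v.
  by split=> [j|]; rewrite ?top_of_data// anchor_of_data// c'E.
apply: (sobolev_eq_values x0ab k_gt0) => x xab; rewrite H//.
apply: etrans _ (esym (sobolev_taylor x0ab (of_data k x0ab c' v) k_gt0 xab)).
rewrite -/(top_deriv _) top_of_data; congr (_ + _); apply: eq_bigr => j _.
by rewrite -/(anchor x0 j _) anchor_of_data// c'E.
Qed.

Theorem theorem2p6 (R : realType) (p : \bar R) (p1 : (1 <= p)%E)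
    (k : nat) (k_gt0 : (0 < k)%N)
    (a1 b1 x1 a2 b2 x2 : R)
    (x1_in : x1 \in `]a1, b1[%R) (x2_in : x2 \in `]a2, b2[%R)
    (Delta : positive_sphere (W_space k a1 b1 x1 p1) ->
             positive_sphere (W_space k a2 b2 x2 p1))
    (Delta_surj : forall g, exists f, Delta f = g)
    (Delta_isom : forall f g,
       onv_norm (val (Delta f) - val (Delta g)) = onv_norm (val f - val g)) :
  exists2 Phi : W_space k a1 b1 x1 p1 -> W_space k a2 b2 x2 p1,
    unique (fun Psi : W_space k a1 b1 x1 p1 -> W_space k a2 b2 x2 p1 =>
      isometric_order_iso Psi /\
      forall f : positive_sphere (W_space k a1 b1 x1 p1),
        Psi (val f) = val (Delta f)) Phi &
    exists! sL : 'S_k * (Lp_space a1 b1 p1 -> Lp_space a2 b2 p1),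
      isometric_order_iso sL.2 /\
      forall (f : sobolev a1 b1 p1 k) (x : R), x \in `]a2, b2[%R ->
        deriv_at 0 (Phi f : sobolev a2 b2 p1 k) x =
        \sum_(j < k) deriv_at (sL.1 j) f x1 * ((x - x2) ^+ j / (j`!)%:R)%:C +
        ((((k.-1)`!)%:R)^-1)%:C *
          oint x2 x (fun t => ((x - t) ^+ k.-1)%:C *
            (sL.2 (weak_deriv k f) : clspace (itv_measure a2 b2) p1) t).
Proof.
have x1ab : a1 < x1 < b1 by rewrite in_itv in x1_in.
have x2ab : a2 < x2 < b2 by rewrite in_itv in x2_in.
have M1 := sobolev_model p1 x1ab k_gt0; have M2 := sobolev_model p1 x2ab k_gt0.
have [Phi [iso PhiD]] := sphere_isometry_extends p1 (mixed_fin a1 b1 k)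
  (mixed_fin a2 b2 k) M1 M2 Delta_surj Delta_isom.
exists Phi.
  split=> [//|Psi [[Psi_lin _ _ _ _] PsiD]]; have [Phi_lin _ _ _ _] := iso.
  by apply: (linear_eq_on_sphere p1 M1 Phi_lin Psi_lin) => f; rewrite PhiD PsiD.
have [s [L [isoL sL]]] := iso_data x1ab x2ab k_gt0 iso.
exists (s, L); split=> [|[s' L'] [/= isoL' formula]].
  split=> //= f x; rewrite in_itv /= => xab.
  exact: ((formula_data x2ab k_gt0 (Phi f) (fun j => anchor x1 (s j) f) (L (top_deriv f))).2 (sL f) x xab).
have data' f : (forall j : 'I_k, anchor x2 j (Phi f) = anchor x1 (s' j) f) /\
    top_deriv (Phi f : sobolev a2 b2 p1 k) = L' (top_deriv f).
  by apply/(formula_data x2ab k_gt0) => x xab; apply: formula; rewrite in_itv.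
congr (_, _).
  apply/permP => j.
  have := (sL (taylor_mono p1 k x1ab (s j))).1 j; rewrite (data' _).1 !anchor_of_data// eqxx.
  by move=> /eqP; rewrite pnatr_eq1 eqb1 => /eqP/val_inj.
apply/funext => v.
by have := (sL (iter_int k x1ab v)).2; rewrite (data' _).2 top_of_data.
Qed.
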